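(* Let $G$ be a Poisson-Lie group with Lie bialgebra $(\mathfrak{g},\mathfrak{g}^* )$ and dual group $G^*$, let $\mathcal{M}$ be a Poisson manifold, and let $\Gamma:\mathcal{M}\to G^*$ be a smooth map. For $\epsilon\in\mathfrak{g}$ and $f\in C^\infty(\mathcal{M})$ let $\delta_\epsilon f=-\langle\epsilon,\Gamma^{-1}\{\Gamma,f\}\rangle$. If $\delta$ is a Lie algebra action, i.e. $[\delta_\epsilon,\delta_{\epsilon'}]=\delta_{[\epsilon,\epsilon']}$ for all $\epsilon,\epsilon'\in\mathfrak{g}$ (as is the case when $\Gamma$ is the non-abelian moment map of a Poisson-Lie action of $G$ on $\mathcal{M}$), then $$\{\iota^*(\Gamma)_1,\iota^*(\Gamma)_2\}=-\tfrac12\big[\mathcal{R}^D_{12},\iota^*(\Gamma)_1\iota^*(\Gamma)_2\big]+N_{12}\,\iota^*(\Gamma)_1\iota^*(\Gamma)_2$$ for some skew-symmetric $N_{12}$ valued in $\iota^*(\mathfrak{g}^* )\otimes\iota^*(\mathfrak{g}^* )$ which is central for the Poisson bracket $\{\cdot,\cdot\}$ of $\mathcal{M}$. Conversely, if the Poisson bracket of $\Gamma$ with itself is of this form, then $[\delta_\epsilon,\delta_{\epsilon'}]=\delta_{[\epsilon,\epsilon']}$ for all $\epsilon,\epsilon'\in\mathfrak{g}$.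
   Context: A Poisson-Lie group is a real Lie group with a Poisson bracket for which multiplication is a Poisson map; linearising the bracket at the identity gives a Lie bracket on $\mathfrak{g}^*$, $[d_ef,d_eg]_*=d_e\{f,g\}_G$, and $G^*$ is the connected, simply connected Lie group with Lie algebra $(\mathfrak{g}^*,[\cdot,\cdot]_* )$. A smooth action of $G$ on $\mathcal{M}$ is Poisson-Lie if $G\times\mathcal{M}\to\mathcal{M}$ is a Poisson map; a non-abelian moment map for it is a map $\Gamma:\mathcal{M}\to G^*$ such that the infinitesimal action is $\delta_\epsilon f=-\langle\epsilon,\Gamma^{-1}\{\Gamma,f\}\rangle$. The Drinfel'd double is $D\mathfrak{g}=\mathfrak{g}\oplus\mathfrak{g}^*$ (as a vector space) with embeddings $\iota:\mathfrak{g}\to D\mathfrak{g}$, $\iota^*:\mathfrak{g}^*\to D\mathfrak{g}$, the bilinear form $\langle(X,\lambda)|(Y,\mu)\rangle=\mu(X)+\lambda(Y)$, and the unique Lie bracket for which $\iota,\iota^*$ are Lie homomorphisms and $\langle\cdot|\cdot\rangle$ is ad-invariant. $DG$ is a Lie group with Lie algebra $D\mathfrak{g}$ and $\iota^*$ also denotes the lifted homomorphism $G^*\to DG$. With dual bases $\{T^a\}$ of $\mathfrak{g}$ and $\{T_a\}$ of $\mathfrak{g}^*$, $$\mathcal{R}^D_{12}=\sum_a\big(\iota(T^a)\otimes\iota^*(T_a)-\iota^*(T_a)\otimes\iota(T^a)\big).$$ Subscripts $1,2$ are tensor-factor indices. With $y=\iota^*(\Gamma)$, the bracket identity means, after right-trivialisation,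 $\{y_1,y_2\}y_1^{-1}y_2^{-1}=-\frac12\big(\mathcal{R}^D_{12}-(\mathrm{Ad}_y\otimes\mathrm{Ad}_y)\mathcal{R}^D_{12}\big)+N_{12}$. ''Central'' means that the components of $N_{12}$ Poisson commute with all functions on $\mathcal{M}$. *)

(* Defs.v *)
(* MathComp / MathComp-Analysis *)
From HB Require Import structures.
From mathcomp Require Import all_boot all_order all_algebra.
From mathcomp Require Import all_classical all_reals all_analysis.

Set Implicit Arguments.
Unset Strict Implicit.
Unset Printing Implicit Defensive.

Import Order.TTheory GRing.Theory Num.Theory.
Import numFieldNormedType.Exports.

Local Open Scope classical_set_scope.
Local Open Scope ring_scope.

(** * Smooth manifolds *)

Section Smooth.
Context {R : realType}.

Fixpoint Ck_on {V W : normedModType R} (k : nat) (U : set V) (f : V -> W)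
    : Prop :=
  if k is k'.+1 then
    (forall x, U x -> differentiable f x) /\ forall v, Ck_on k' U ('D_v f)
  else forall x, U x -> {for x, continuous f}.

(* Only used for open U. *)
Definition smooth_on {V W : normedModType R} (U : set V) (f : V -> W) : Prop :=
  forall k, Ck_on k U f.

(* [cto] and [cfrom] are total functions, whose values matter only on [cdom]
   and on [cimg] respectively. *)
Record chart (M : topologicalType) (n : nat) := Chart {
  cdom : set M;
  cto : M -> 'rV[R]_n;
  cfrom : 'rV[R]_n -> M }.

Definition cimg {M n} (c : chart M n) : set 'rV[R]_n := cto c @` cdom c.

Definition is_chart {M n} (c : chart M n) : Prop :=
  [/\ open (cdom c), open (cimg c),
      forall x, cdom c x -> cfrom c (cto c x) = x,
      forall x, cdom c x -> {for x, continuous (cto c)} &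
      forall u, cimg c u -> {for u, continuous (cfrom c)}].

Definition is_atlas {M n} (A : set (chart M n)) : Prop :=
  [/\ forall c, A c -> is_chart c,
      forall x, exists2 c, A c & cdom c x &
      forall c c', A c -> A c' ->
        smooth_on (cto c @` (cdom c `&` cdom c')) (cto c' \o cfrom c)].

Definition smooth_fun {M n} (A : set (chart M n)) (f : M -> R) : Prop :=
  forall c, A c -> smooth_on (cimg c) (f \o cfrom c).

Definition smooth_map {M n N p} (A : set (chart M n)) (B : set (chart N p))
    (F : M -> N) : Prop :=
  continuous F /\
  forall c c', A c -> B c' ->
    smooth_on (cto c @` (cdom c `&` F @^-1` cdom c')) (cto c' \o F \o cfrom c).

Definition prod_chart {M n N p} (c : chart M n) (c' : chart N p)
    : chart (M * N)%type (n + p) :=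
  Chart (cdom c `*` cdom c')
        (fun z => row_mx (cto c z.1) (cto c' z.2))
        (fun u => (cfrom c (lsubmx u), cfrom c' (rsubmx u))).

Definition prod_atlas {M n N p} (A : set (chart M n)) (B : set (chart N p))
    : set (chart (M * N)%type (n + p)) :=
  [set c | exists c1 c2, [/\ A c1, B c2 & c = prod_chart c1 c2]].

End Smooth.

Record smoothManifold (R : realType) := SmoothManifold {
  carrier :> topologicalType;
  mdim : nat;
  atlas : set (@chart R carrier mdim);
  manifold_hausdorff : hausdorff_space carrier;
  manifold_second_countable : @second_countable carrier;
  atlasP : is_atlas atlas }.

Arguments atlas {R} _.

(** * Poisson manifolds *)

Section Poisson.
Context {R : realType}.

(* A bracket on smooth functions is represented by an operation on all
   functions, whose values on non-smooth functions are irrelevant. *)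
Definition bracket (M : Type) := (M -> R) -> (M -> R) -> M -> R.

Definition is_poisson_bracket {M n} (A : set (@chart R M n)) (pb : bracket M)
    : Prop :=
  let C := smooth_fun A in
  [/\ forall f g, C f -> C g -> C (pb f g),
      forall (a : R) f g h, C f -> C g -> C h ->
        pb (fun x => a * f x + g x) h = (fun x => a * pb f h x + pb g h x),
      forall f g, C f -> C g -> pb f g = (fun x => - pb g f x),
      forall f g h, C f -> C g -> C h ->
        pb (fun x => f x * g x) h = (fun x => f x * pb g h x + pb f h x * g x) &
      forall f g h, C f -> C g -> C h -> forall x,
        pb f (pb g h) x + pb g (pb h f) x + pb h (pb f g) x = 0].

Definition prod_bracket {M N : Type} (pb : bracket M) (pb' : bracket N)
    : bracket (M * N) := fun f g z =>
  pb (fun x => f (x, z.2)) (fun x => g (x, z.2)) z.1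
  + pb' (fun y => f (z.1, y)) (fun y => g (z.1, y)) z.2.

Definition poisson_map {M n N p} (A : set (@chart R M n)) (pbM : bracket M)
    (B : set (@chart R N p)) (pbN : bracket N) (F : M -> N) : Prop :=
  smooth_map A B F /\
  forall f g, smooth_fun B f -> smooth_fun B g ->
    pbM (f \o F) (g \o F) = pbN f g \o F.

End Poisson.

Record poissonManifold (R : realType) := PoissonManifold {
  pmanifold :> smoothManifold R;
  pbr : @bracket R pmanifold;
  pbrP : is_poisson_bracket (atlas pmanifold) pbr }.

(** * Lie groups and their Lie algebras *)

Record lieGroup (R : realType) := LieGroup {
  gmanifold :> smoothManifold R;
  gmul : gmanifold -> gmanifold -> gmanifold;
  ginv : gmanifold -> gmanifold;
  gone : gmanifold;
  gmulA : associative gmul;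
  gmul1 : left_id gone gmul;
  gmulV : left_inverse gone ginv gmul;
  gmul_smooth : smooth_map (prod_atlas (atlas gmanifold) (atlas gmanifold))
                  (atlas gmanifold) (fun z => gmul z.1 z.2);
  ginv_smooth : smooth_map (atlas gmanifold) (atlas gmanifold) ginv }.

Record poissonLieGroup (R : realType) := PoissonLieGroup {
  plgroup :> lieGroup R;
  plbr : @bracket R plgroup;
  plbrP : is_poisson_bracket (atlas plgroup) plbr;
  plmul_poisson :
    poisson_map (prod_atlas (atlas plgroup) (atlas plgroup))
      (prod_bracket plbr plbr) (atlas plgroup) plbr
      (fun z => gmul z.1 z.2) }.

Section LieGroups.
Context {R : realType}.
Implicit Types (M : smoothManifold R) (G H : lieGroup R) (V : vectType R).

Definition smooth M (f : M -> R) : Prop := smooth_fun (atlas M) f.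

(* Tangent vectors at [p] are derivations at [p] of the algebra of smooth
   functions; values on non-smooth functions are irrelevant. *)
Definition is_tangent M (p : M) (v : (M -> R) -> R) : Prop :=
  (forall (a : R) f g, smooth f -> smooth g ->
     v (fun x => a * f x + g x) = a * v f + v g) /\
  (forall f g, smooth f -> smooth g ->
     v (fun x => f x * g x) = f p * v g + v f * g p).

(* A realisation of the Lie algebra of [G] on the vector space [V]: a linear
   isomorphism [ltan] of [V] onto the tangent space of [G] at the identity,
   with the bracket of left-invariant vector fields; the left-invariant field
   extending [Y] maps [f] to [fun x => ltan Y (fun y => f (gmul x y))]. *)
Record lieAlgebra G V := LieAlgebra {
  lbr : V -> V -> V;
  ltan : V -> (G -> R) -> R;
  ltan_tangent : forall X, is_tangent (gone G) (ltan X);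
  ltan_linear : forall (a : R) X Y f, smooth f ->
    ltan (a *: X + Y) f = a * ltan X f + ltan Y f;
  ltan_inj : forall X, (forall f, smooth f -> ltan X f = 0) -> X = 0;
  ltan_surj : forall v, is_tangent (gone G) v ->
    exists X, forall f, smooth f -> ltan X f = v f;
  lbrE : forall X Y f, smooth f ->
    ltan (lbr X Y) f = ltan X (fun x => ltan Y (fun y => f (gmul x y)))
                       - ltan Y (fun x => ltan X (fun y => f (gmul x y))) }.

(* The element of [V] representing the tangent vector [v] at the identity. *)
Definition of_tangent G V (L : lieAlgebra G V) (v : (G -> R) -> R) : V :=
  xget 0 [set X | forall f, smooth f -> ltan L X f = v f].

Definition Ad G V (L : lieAlgebra G V) (x : G) : 'End(V) :=
  linfun (fun X => of_tangent L
    (fun f => ltan L X (fun z => f (gmul (gmul x z) (ginv x))))).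

Definition dualv V : vectType R := 'Hom(V, R^o).

(* The differential at the identity. *)
Definition de G V (L : lieAlgebra G V) (f : G -> R) : dualv V :=
  linfun (fun X => ltan L X f : R^o).

Definition lie_group_hom G H (F : G -> H) : Prop :=
  smooth_map (atlas G) (atlas H) F /\
  forall x y, F (gmul x y) = gmul (F x) (F y).

(* [F] lifts the linear map [phi]: its differential at the identity is [phi]. *)
Definition lifts G H V W (L : lieAlgebra G V) (L' : lieAlgebra H W)
    (phi : V -> W) (F : G -> H) : Prop :=
  lie_group_hom F /\
  forall X f, smooth f -> ltan L X (f \o F) = ltan L' (phi X) f.

Definition simply_connected (X : topologicalType) : Prop :=
  forall gam : R -> X,
    {within `[0, 1], continuous gam} -> gam 0 = gam 1 ->
    exists h : R * R -> X,
      [/\ {within `[0, 1] `*` `[0, 1], continuous h},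
          forall t, t \in `[0, 1] -> h (0, t) = gam t,
          forall t, t \in `[0, 1] -> h (1, t) = gam 0 &
          forall s, s \in `[0, 1] -> h (s, 0) = gam 0 /\ h (s, 1) = gam 0].

End LieGroups.

(** * Tensors and the Drinfel'd double *)

Section Double.
Context {R : realType}.
Implicit Types (V W : vectType R) (g : vectType R).

(* [V (x) W] is modelled by the linear maps from the dual of [V] to [W];
   [x (x) y] is the map [p |-> p x *: y]. *)
Definition tensor V W : vectType R := 'Hom(dualv V, W).

Definition tens V W (x : V) (y : W) : tensor V W :=
  linfun (fun p : dualv V => (p x : R) *: y).

(* [p (x) q] applied to [t]. *)
Definition tens_pair V W (p : dualv V) (q : dualv W) (t : tensor V W) : R :=
  q (t p).

(* [(A (x) A) t] for an endomorphism [A]; on [x (x) y] it is [A x (x) A y]. *)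
Definition tens_map V (A : 'End(V)) (t : tensor V V) : tensor V V :=
  linfun (fun p : dualv V => A (t (p \o A)%VF)).

Definition drinfeld g : vectType R := (g * dualv g)%type.

Definition iota g (X : g) : drinfeld g := (X, 0).
Definition iotas g (l : dualv g) : drinfeld g := (0, l).

Definition dform g (x y : drinfeld g) : R := y.2 x.1 + x.2 y.1.

Definition is_double_bracket g (br : g -> g -> g)
    (brs : dualv g -> dualv g -> dualv g)
    (brD : drinfeld g -> drinfeld g -> drinfeld g) : Prop :=
  [/\ forall X Y, brD (iota X) (iota Y) = iota (br X Y),
      forall l m, brD (iotas l) (iotas m) = iotas (brs l m) &
      forall x y z, dform (brD z x) y + dform x (brD z y) = 0].

Definition dual_bases g n (T : n.-tuple g) (Ts : n.-tuple (dualv g)) : Prop :=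
  basis_of fullv T /\
  forall a b, tnth Ts b (tnth T a) = (a == b)%:R.

Definition RD g n (T : n.-tuple g) (Ts : n.-tuple (dualv g))
    : tensor (drinfeld g) (drinfeld g) :=
  \sum_(a < n) (tens (iota (tnth T a)) (iotas (tnth Ts a))
                - tens (iotas (tnth Ts a)) (iota (tnth T a))).

End Double.

(** * Poisson-Lie actions and moment maps *)

Section Moment.
Context {R : realType} (M : poissonManifold R).
Implicit Types (f : M -> R) (m : M).

(* [Gam^-1 {Gam, f}] at [m]: the tangent vector [k |-> {k o Gam, f}(m)] at
   [Gam m], left-translated to the identity. *)
Definition left_log_bracket (H : lieGroup R) (V : vectType R)
    (L : lieAlgebra H V) (Gam : M -> H) f m : V :=
  of_tangent L
    (fun k => pbr (fun m' => k (gmul (ginv (Gam m)) (Gam m'))) f m).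

Definition delta (H : lieGroup R) (g : vectType R)
    (L : lieAlgebra H (dualv g)) (Gam : M -> H) (e : g) f : M -> R :=
  fun m => - left_log_bracket L Gam f m e.

Definition is_lie_algebra_action (g : vectType R) (br : g -> g -> g)
    (del : g -> (M -> R) -> M -> R) : Prop :=
  forall e e' f, smooth f -> forall m,
    del e (del e' f) m - del e' (del e f) m = del (br e e') f m.

Definition is_left_action (G : lieGroup R) (act : G -> M -> M) : Prop :=
  (forall m, act (gone G) m = m) /\
  forall x y m, act (gmul x y) m = act x (act y m).

Definition is_right_action (G : lieGroup R) (act : G -> M -> M) : Prop :=
  (forall m, act (gone G) m = m) /\
  forall x y m, act (gmul x y) m = act y (act x m).

Definition is_poisson_action (G : poissonLieGroup R) (act : G -> M -> M)
    : Prop :=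
  poisson_map (prod_atlas (atlas G) (atlas M))
    (prod_bracket (@plbr R G) (@pbr R M)) (atlas M) (@pbr R M)
    (fun z => act z.1 z.2).

(* The infinitesimal action of [e] is normalised to be a Lie algebra
   homomorphism into vector fields: [d/dt f(exp(-te) . m)] at [t = 0] for a
   left action and [d/dt f(m . exp(te))] for a right one. *)
Definition is_moment_map (G : poissonLieGroup R) (g : vectType R)
    (L : lieAlgebra G g) (H : lieGroup R) (Ls : lieAlgebra H (dualv g))
    (act : G -> M -> M) (Gam : M -> H) : Prop :=
  is_poisson_action act /\
  ((is_left_action act /\ forall e f, smooth f -> forall m,
      - ltan L e (fun x => f (act x m)) = delta Ls Gam e f m) \/
   (is_right_action act /\ forall e f, smooth f -> forall m,
      ltan L e (fun x => f (act x m)) = delta Ls Gam e f m)).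

(* [{y_1, y_2} y_1^-1 y_2^-1] at [m]: the element of [V (x) V] whose pairing
   with [d_e h (x) d_e k] is the bracket at [m] of the pull-backs of [h] and
   [k] by [m' |-> y(m') y(m)^-1]. *)
Definition right_triv_bracket (D : lieGroup R) (V : vectType R)
    (L : lieAlgebra D V) (y : M -> D) m : tensor V V :=
  xget 0 [set t | forall h k, smooth h -> smooth k ->
    tens_pair (de L h) (de L k) t
    = pbr (fun m' => h (gmul (y m') (ginv (y m))))
          (fun m' => k (gmul (y m') (ginv (y m)))) m].

(* The bracket identity for [y = iota^*(Gam)]; [N a b] are the components of
   [N_12] with respect to [iota^*(T_a) (x) iota^*(T_b)]. *)
Definition has_double_bracket_form (g : vectType R) (D : lieGroup R)
    (L : lieAlgebra D (drinfeld g)) n (T : n.-tuple g) (Ts : n.-tuple (dualv g))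
    (y : M -> D) : Prop :=
  exists N : 'I_n -> 'I_n -> M -> R,
    [/\ forall a b, smooth (N a b),
        forall a b m, N a b m = - N b a m,
        forall a b f, smooth f -> forall m, pbr (N a b) f m = 0 &
        forall m, right_triv_bracket L y m =
          - (2^-1 *: (RD T Ts - tens_map (Ad L (y m)) (RD T Ts)))
          + \sum_(a < n) \sum_(b < n)
              N a b m *: tens (iotas (tnth Ts a)) (iotas (tnth Ts b))].

End Moment.

(* Main.v *)
(** Write [{h o Gam, k o Gam} = Pi (dh, dk)], where [Pi] is the left-trivialised
    bracket of [Gam] with itself and [dh], [dk] are the left-trivialised
    differentials.  The Jacobi identity for [h o Gam], [k o Gam], [f], with
    [dh] and [dk] prescribed at one point, gives
      [[delta_e, delta_e'] f = {Pi (e, e'), f} + [xi, Pi e] e' - [xi, Pi e'] e]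
    with [xi = Gam^-1 {Gam, f}].  Let [y = iota^* (Gam)] and
    [Ad_{y^-1} (iota e) = (p e, q e)].  In right trivialisation the bracket of
    [y] with itself is [Pi (p e, p e')], the R-matrix term is [q e (p e')], and
    differentiating both along [Gam] yields, for their difference [N],
      [{N (e, e'), f} = ([delta_{p e}, delta_{p e'}] - delta_{[p e, p e']}) f].
    Since [p] is invertible, [N] is central if and only if [delta] is a Lie
    algebra action.

    Tangent vectors are abstract derivations of the algebra of global smooth
    functions.  They are handled by a Hadamard expansion with parameters,
    [F (x, y) = F (x, p) + sum_i u_i y * g_i (x, y)] with [u_i p = 0], in which
    a derivation at [p] in the variable [y] only sees the values
    [g_i (x, p)]. *)

From Pilot Require Import Defs.
From HB Require Import structures.
From mathcomp Require Import all_boot all_order all_algebra.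
From mathcomp Require Import all_classical all_reals all_analysis.
From mathcomp Require Import perm ring.

Set Implicit Arguments.
Unset Strict Implicit.
Unset Printing Implicit Defensive.

Import Order.TTheory GRing.Theory Num.Theory.
Import numFieldNormedType.Exports.
Local Open Scope classical_set_scope.
Local Open Scope ring_scope.

(** * Calculus of [Ck_on] functions *)

(** A derivation of the algebra of global functions is not local by definition; the cut-offs inside
    the Hadamard expansion supply locality. Neither flows nor exponentials occur: invariance of the
    form passes from the Lie algebra to the dual group because a function on a connected group is
    constant once its left-invariant derivatives vanish. [p] is invertible because [Ad_{y^-1}]
    preserves the image of [iotas], so that it acts on the quotient of the double by this subspace,
    which is [g]. The factor 1/2: on the covectors [<a|.>] and [<b|.>], with [a = (a_1, a_2)], the
    R-matrix takes the value [a_2(b_1) - b_2(a_1) = 2 a_2(b_1) - <a|b>]. The invariant form cancels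
    in [R - Ad_y R], and by invariance again the rest depends on [a_1] and [b_1] only. So does the
    bracket of [y] with itself; hence [N] has both legs in the image of [iotas] for every smooth
    [Gam], and only its centrality is in question. Vectors and tensors are chosen pointwise by
    [xget]; their smoothness in [m] and their uniqueness rest on the fact that differentials at the
    identity of global functions exhaust the dual space. *)

Section Calculus.
Context {R : realType}.
Implicit Types V W : normedModType R.

Lemma diff_eps V W (f : V -> W) x : differentiable f x ->
  forall e : R, 0 < e ->
  \forall h \near 0, `|f (h + x) - f x - 'd f x h| <= e * `|h|.
Proof.
move=> /diff_locally/eqaddoP dfx e e0.
have := dfx _ e0; apply: filterS => h.
by rewrite /= !fctE/= opprD addrA.
Qed.

(** Proposing the differential together with the error estimate yields differentiability and the
    value of ['d] at once; the bilinear map of the Leibniz rule and the parameter integral are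
    differentiated this way. *)
Lemma eps_diff V W (f : V -> W) (df : {linear V -> W}) x : continuous df ->
  (forall e : R, 0 < e ->
    \forall h \near 0, `|f (h + x) - f x - df h| <= e * `|h|) ->
  differentiable f x /\ 'd f x = df :> (V -> W).
Proof.
move=> cdf H.
have E : f \o shift x = cst (f x) + df +o_ 0 id.
  apply/eqaddoP => e e0.
  have := H _ e0; apply: filterS => h.
  by rewrite /= !fctE/= opprD addrA.
have U := diff_unique cdf E.
by split=> //; apply/diff_locallyP; rewrite U; split.
Qed.

Lemma near_eq_differentiable V W (f g : V -> W) x :
  (\near x, f x = g x) -> differentiable f x -> differentiable g x.
Proof.
move=> fg df.
suff [] : differentiable g x /\ 'd g x = 'd f x :> (V -> W) by [].
apply: eps_diff; first exact: diff_continuous.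
move=> e e0.
have fgx := nbhs_singleton fg.
have fg0 : \forall h \near 0, f (h + x) = g (h + x).
  by move: fg; rewrite (near_shift 0)/= subr0.
near=> h.
rewrite -(near fg0)// -fgx; near: h; exact: diff_eps.
Unshelve. all: by end_near. Qed.

(** On an open set equality holds near every point, which is all that continuity and directional
    derivatives see. *)
Lemma Ck_on_eq V W k (U : set V) (f g : V -> W) : open U ->
  (forall x, U x -> f x = g x) -> Ck_on k U f -> Ck_on k U g.
Proof.
move=> oU; elim: k f g => [|k IH] f g fg /=.
  move=> cf x Ux.
  have nfg : \near x, f x = g x.
    by near do apply: fg; apply: open_nbhs_nbhs.
  have := cf _ Ux; rewrite /prop_for /continuous_at (fg _ Ux); apply: cvg_trans.
  exact: near_eq_cvg.
move=> [df Cf]; split=> [x Ux|v].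
  apply: near_eq_differentiable (df _ Ux).
  by near do apply: fg; apply: open_nbhs_nbhs.
apply: IH (Cf v) => x Ux; apply: near_eq_derive.
by near do apply: fg; apply: open_nbhs_nbhs.
Unshelve. all: by end_near. Qed.

Lemma Ck_onS V W k (U U' : set V) (f : V -> W) :
  U' `<=` U -> Ck_on k U f -> Ck_on k U' f.
Proof.
move=> UU; elim: k f => [|k IH] f /=; first by move=> H x /UU; exact: H.
by move=> [H1 H2]; split=> [x /UU|v]; [exact: H1|exact/IH/H2].
Qed.

(** Every clause of [Ck_on] concerns single points and derivatives of the total function, so any set
    containing the point will do. *)
Lemma Ck_on_local V W k (U : set V) (f : V -> W) :
  (forall x, U x -> exists2 O : set V, O x & Ck_on k O f) -> Ck_on k U f.
Proof.
elim: k f => [|k IH] f /= H.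
  by move=> x Ux; case: (H _ Ux) => O Ox cO; exact: cO.
split=> [x Ux|v]; first by case: (H _ Ux) => O Ox [dO _]; exact: dO.
by apply: IH => x Ux; case: (H _ Ux) => O Ox [_ /(_ v)]; exists O.
Qed.

Lemma Ck_onW V W k (U : set V) (f : V -> W) : Ck_on k.+1 U f -> Ck_on k U f.
Proof.
elim: k f => [|k IH] f; last by move=> [? H]; split=> // v; exact/IH/H.
by move=> [H _] x /H; exact: differentiable_continuous.
Qed.

Lemma Ck_on_cst V W k (U : set V) (a : W) : Ck_on k U (fun _ : V => a).
Proof.
elim: k a => [|k IH] a /=; first by move=> x _; exact: cst_continuous.
split=> [x _|v]; first exact: differentiable_cst.
rewrite (_ : 'D_v _ = fun=> 0); first exact: IH.
by apply/funext => x; rewrite derive_cst.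
Qed.

Lemma Ck_on_linear V W k (U : set V) (f : {linear V -> W}) :
  continuous f -> Ck_on k U f.
Proof.
move=> cf; case: k => [|k] /=; first by move=> x _; exact: cf.
split=> [x _|v]; first exact: linear_differentiable.
rewrite (_ : 'D_v _ = fun=> f v); first exact: Ck_on_cst.
by apply/funext => x; rewrite deriveE ?diff_lin//; exact: linear_differentiable.
Qed.

Lemma Ck_onD V W k (U : set V) (f g : V -> W) : open U ->
  Ck_on k U f -> Ck_on k U g -> Ck_on k U (fun x => f x + g x).
Proof.
move=> oU; elim: k f g => [|k IH] f g /=.
  by move=> Hf Hg x Ux; apply: cvgD; [exact: Hf|exact: Hg].
move=> [df Cf] [dg Cg]; split=> [x Ux|v].
  by apply: differentiableD; [exact: df|exact: dg].
apply: (@Ck_on_eq _ _ _ _ (fun x => 'D_v f x + 'D_v g x)) => // [x Ux|].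
  by rewrite -deriveD//; apply: diff_derivable; [exact: df|exact: dg].
by apply: IH; [exact: Cf|exact: Cg].
Qed.

(** Leibniz rule: the pair of functions is composed with the bilinear map [(r, w) |-> r *: w], and
    each derivative is again a sum of such products. *)
Lemma Ck_on_scale V W k (U : set V) (f : V -> R) (g : V -> W) : open U ->
  Ck_on k U f -> Ck_on k U g -> Ck_on k U (fun x => f x *: g x).
Proof.
move=> oU; elim: k f g => [|k IH] f g.
  by move=> Hf Hg x Ux; apply: cvgZ; [exact: Hf|exact: Hg].
move=> Hf0 Hg0; have Hf := Ck_onW Hf0; have Hg := Ck_onW Hg0.
have [df Cf] := Hf0; have [dg Cg] := Hg0.
have key x v : U x -> differentiable (fun x => f x *: g x) x /\
    'D_v (fun x => f x *: g x) x = 'D_v f x *: g x + f x *: 'D_v g x.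
  move=> Ux; have dfx := df _ Ux; have dgx := dg _ Ux.
  pose h (y : R * W) := y.1 *: y.2.
  pose dh (y : R * W) := f x *: y.2 + y.1 *: g x.
  have lin_dh : linear dh.
    move=> a [u1 u2] [v1 v2]; rewrite /dh/= scalerDr scalerDl !scalerDr !scalerA.
    by rewrite addrACA (mulrC (f x)).
  pose dhM := GRing.isLinear.Build _ _ _ _ _ lin_dh.
  pose dhL : {linear _ -> _} := HB.pack dh dhM.
  have [dhx dhxE] : differentiable h (f x, g x) /\
     'd h (f x, g x) = dhL :> (_ -> _).
    apply: eps_diff.
      move=> y; apply: cvgD; first by apply: cvgZl_tmp; exact: cvg_snd.
      by apply: cvgZr_tmp; exact: cvg_fst.
    move=> e e0; near=> y.
    rewrite /h/= /dh.
    (* The linearisation error of a bilinear map is the product of the two increments, hence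
       quadratic. *)
    have -> : (y.1 + f x) *: (y.2 + g x) - f x *: g x -
        (f x *: y.2 + y.1 *: g x) = y.1 *: y.2.
      rewrite scalerDl !scalerDr.
      by rewrite addrA addrK opprD addrA !addrK.
    rewrite normrZ ler_pM//.
      apply: (@le_trans _ _ `|y|); first by rewrite prod_normE le_max lexx.
      near: y; exact: (@nbhs0_le R (R^o * W)%type).
    by rewrite prod_normE le_max lexx orbT.
  have dp : differentiable (fun y => (f y, g y)) x by exact: differentiable_pair.
  have dc : differentiable (fun y => f y *: g y) x.
    exact: (differentiable_comp dp dhx).
  split=> //.
  rewrite deriveE// (_ : (fun _ => _) = h \o (fun y => (f y, g y)))//.
  by rewrite diff_comp// dhxE diff_pair//= /dh addrC !deriveE.
split=> [x Ux|v]; first by have [] := key x 0 Ux.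
apply: (@Ck_on_eq _ _ _ _ (fun x => 'D_v f x *: g x + f x *: 'D_v g x)) => //.
  by move=> x Ux; have [_ ->] := key x v Ux.
by apply: Ck_onD => //; apply: IH => //; [exact: Cf|exact: Cg].
Unshelve. all: by end_near. Qed.

Lemma Ck_on_lin_comp V W W' k (U : set V) (f : V -> W) (L : {linear W -> W'}) :
  open U -> continuous L -> Ck_on k U f -> Ck_on k U (fun x => L (f x)).
Proof.
move=> oU cL; elim: k f => [|k IH] f /=.
  move=> cf x Ux; apply: (@continuous_comp _ _ _ f L); first exact: cf.
  exact: cL.
have dL y : differentiable L y by exact: linear_differentiable.
move=> [df Cf]; split=> [x Ux|v].
  exact: (differentiable_comp (df _ Ux) (dL _)).
apply: (@Ck_on_eq _ _ _ _ (fun x => L ('D_v f x))) => // [x Ux|]; last first.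
  exact: (IH ('D_v f)).
have dfx := df _ Ux.
rewrite [RHS](deriveE _ (differentiable_comp dfx (dL _))) diff_comp// diff_lin//.
by rewrite deriveE.
Qed.

Lemma Ck_on_sum V W k (U : set V) (I : Type) (r : seq I) (P : pred I)
    (f : I -> V -> W) : open U -> (forall i, P i -> Ck_on k U (f i)) ->
  Ck_on k U (fun x => \sum_(i <- r | P i) f i x).
Proof.
move=> oU Hf; elim: r => [|i r IH].
  rewrite (_ : (fun _ => _) = fun=> 0); first exact: Ck_on_cst.
  by apply/funext => x; rewrite big_nil.
have [Pi|Pi] := boolP (P i); last first.
  by apply: Ck_on_eq IH => // x _; rewrite big_cons (negbTE Pi).
apply: (@Ck_on_eq _ _ _ _ (fun x => f i x + \sum_(j <- r | P j) f j x)) => //.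
  by move=> x _; rewrite big_cons Pi.
by apply: Ck_onD => //; exact: Hf.
Qed.

Lemma Ck_on_coord V n k (U : set V) (f : V -> 'rV[R]_n) i : open U ->
  Ck_on k U f -> Ck_on k U (fun x => f x 0 i).
Proof.
pose c (M : 'rV[R]_n) := M 0 i.
have lin_c : linear (c : 'rV[R]_n -> R^o) by move=> a u v; rewrite /c !mxE.
pose cM := GRing.isLinear.Build _ _ _ _ _ lin_c.
pose cL : {linear 'rV[R]_n -> R^o} := HB.pack c cM.
move=> oU Hf; apply: (@Ck_on_lin_comp _ _ _ _ _ _ cL) => //.
exact: coord_continuous.
Qed.

(** [Ck_on] iterates derivatives in fixed directions, whereas the chain rule yields the derivative
    of [g] in the varying direction ['D_v f x]. Expanding this direction in the standard basis
    restores fixed directions; hence the row vectors in the middle. *)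
Lemma Ck_on_comp V n W k (U : set V) (O : set 'rV[R]_n) (f : V -> 'rV[R]_n)
    (g : 'rV[R]_n -> W) : open U -> open O -> (forall x, U x -> O (f x)) ->
  Ck_on k U f -> Ck_on k O g -> Ck_on k U (fun x => g (f x)).
Proof.
move=> oU oO fUO; elim: k f g fUO => [|k IH] f g fUO.
  move=> cf cg x Ux; apply: (@continuous_comp _ _ _ f g); first exact: cf.
  by apply: cg; exact: fUO.
move=> Hf0 Hg0; have Hf := Ck_onW Hf0; have Hg := Ck_onW Hg0.
have [df Cf] := Hf0; have [dg Cg] := Hg0.
have dc x : U x -> differentiable (g \o f) x.
  by move=> Ux; apply: differentiable_comp; [exact: df|exact/dg/fUO].
split=> [x Ux|v]; first exact: dc.
apply: (@Ck_on_eq _ _ _ _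
    (fun x => \sum_i ('D_v f x) 0 i *: 'D_(delta_mx 0 i) g (f x))) => //.
  move=> x Ux; have dfx := df _ Ux; have dgx := dg _ (fUO _ Ux).
  rewrite [RHS](deriveE _ (dc _ Ux)) diff_comp//= -(deriveE v dfx).
  rewrite [X in _ = 'd g (f x) X]row_sum_delta linear_sum.
  by apply: eq_bigr => i _; rewrite (deriveE _ dgx) linearZ.
apply: Ck_on_sum => // i _; apply: Ck_on_scale => //.
  exact: Ck_on_coord (oU) (Cf v).
exact: IH Hf (Cg _).
Qed.

End Calculus.

Section Calculus2.
Context {R : realType}.
Implicit Types V W : normedModType R.

Lemma Ck_onM V k (U : set V) (f g : V -> R) : open U ->
  Ck_on k U f -> Ck_on k U g -> Ck_on k U (fun x => f x * g x).
Proof. by move=> oU Hf Hg; exact: (@Ck_on_scale R V R^o). Qed.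

Lemma Ck_on_prod V k (U : set V) (I : Type) (r : seq I) (P : pred I)
    (f : I -> V -> R) : open U -> (forall i, P i -> Ck_on k U (f i)) ->
  Ck_on k U (fun x => \prod_(i <- r | P i) f i x).
Proof.
move=> oU Hf; elim: r => [|i r IH].
  rewrite (_ : (fun _ => _) = fun=> 1); first exact: Ck_on_cst.
  by apply/funext => x; rewrite big_nil.
have [Pi|Pi] := boolP (P i); last first.
  by apply: Ck_on_eq IH => // x _; rewrite big_cons (negbTE Pi).
apply: (@Ck_on_eq _ _ _ _ _ (fun x => f i x * \prod_(j <- r | P j) f j x)) => //.
  by move=> x _; rewrite big_cons Pi.
by apply: Ck_onM => //; exact: Hf.
Qed.

Lemma Ck_on_id V k (U : set V) : Ck_on k U (fun x : V => x).
Proof. by apply: (@Ck_on_linear _ _ _ k U idfun) => x; exact: cvg_id. Qed.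

Lemma Ck_on_inv k (U : set R) : open U -> (forall x, U x -> x != 0) ->
  Ck_on k U (fun x : R => x^-1).
Proof.
move=> oU U0; elim: k => [|k IH].
  by move=> x Ux; apply: inv_continuous; exact: U0.
split=> [x Ux|v]; first by apply: differentiable_Rinv; exact: U0.
have H : Ck_on k U (fun x : R => x^-1 * x^-1 * - v).
  by apply: Ck_onM => //; [exact: Ck_onM|exact: Ck_on_cst].
apply: (Ck_on_eq oU _ H).
  move=> x Ux; rewrite deriveE; last by apply: differentiable_Rinv; exact: U0.
  by rewrite diff_Rinv ?U0//= -exprVn scaleNr mulrN /GRing.scale/= expr2.
Qed.

Lemma Ck_on_compR V k (U : set V) (O : set R) (f : V -> R) (g : R -> R) :
  open U -> open O -> (forall x, U x -> O (f x)) ->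
  Ck_on k U f -> Ck_on k O g -> Ck_on k U (fun x => g (f x)).
Proof.
move=> oU oO fUO; elim: k f g fUO => [|k IH] f g fUO.
  move=> cf cg x Ux; apply: (@continuous_comp _ _ _ f g); first exact: cf.
  by apply: cg; exact: fUO.
move=> Hf0 Hg0; have Hf := Ck_onW Hf0; have Hg := Ck_onW Hg0.
have [df Cf] := Hf0; have [dg Cg] := Hg0.
have dc x : U x -> differentiable (g \o f) x.
  by move=> Ux; exact: (differentiable_comp (df _ Ux) (dg _ (fUO _ Ux))).
split=> [x Ux|v]; first exact: dc.
have H : Ck_on k U (fun x => 'D_v f x * 'D_1 g (f x)).
  exact: Ck_onM oU (Cf v) (IH f _ fUO Hf (Cg 1)).
apply: (Ck_on_eq oU _ H).
  move=> x Ux; have dfx := df _ Ux; have dgx := dg _ (fUO _ Ux).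
  rewrite [RHS](deriveE _ (dc _ Ux)) diff_comp//= -(deriveE v dfx).
  by rewrite -[X in 'd g (f x) X]mulr1 linearZ (deriveE _ dgx).
Qed.

Lemma Ck_onV V k (U : set V) (f : V -> R) : open U -> 
  (forall x, U x -> f x != 0) ->
  Ck_on k U f -> Ck_on k U (fun x => (f x)^-1).
Proof.
move=> oU f0 Hf.
have o0 : open [set x : R | x != 0] by exact: open_neq.
by apply: (@Ck_on_compR _ _ _ [set x : R | x != 0] f GRing.inv) => //; exact: Ck_on_inv.
Qed.

Lemma Ck_on_row_mx V n p k (U : set V) (f : V -> 'rV[R]_n) (g : V -> 'rV[R]_p) :
  open U -> Ck_on k U f -> Ck_on k U g ->
  Ck_on k U (fun x => row_mx (f x) (g x)).
Proof.
move=> oU Hf Hg.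
pose e (j : 'I_(n + p)) : 'rV[R]_(n + p) := delta_mx 0 j.
apply: (@Ck_on_eq _ _ _ _ _ (fun x => \sum_i f x 0 i *: e (lshift p i) +
    \sum_i g x 0 i *: e (rshift n i))) => // [x Ux|].
  rewrite [RHS]row_sum_delta big_split_ord/=; congr (_ + _).
    by apply: eq_bigr => i _; rewrite row_mxEl.
  by apply: eq_bigr => i _; rewrite row_mxEr.
by apply: Ck_onD => //; apply: Ck_on_sum => // i _; apply: Ck_on_scale => //;
  try exact: Ck_on_cst; exact: Ck_on_coord.
Qed.

End Calculus2.

(** * Functions that are flat at the origin *)

Section FlatFunction.
Context {R : realType}.
Implicit Type p : {poly R}.

(** The functions [p(1/t) exp(-1/t)], extended by zero to [t <= 0], form a family closed under
    differentiation, so that smoothness at the origin becomes a single induction. *)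
Definition flat p (t : R) : R := if 0 < t then p.[t^-1] * expR (- t^-1) else 0.

Lemma horner_bound p : exists2 C : R, 0 <= C &
  forall s, 1 <= s -> `|p.[s]| <= C * s ^+ size p.
Proof.
exists (\sum_(i < size p) `|p`_i|); first by exact: sumr_ge0.
move=> s s1; rewrite horner_coef mulr_suml.
apply: le_trans (ler_norm_sum _ _ _) _; apply: ler_sum => i _.
rewrite normrM ler_wpM2l// normrX ger0_norm ?(le_trans ler01)//.
by rewrite ler_weXn2l// ltnW.
Qed.

Lemma flat_bound p : exists2 C : R, 0 <= C &
  forall t, `|t| <= 1 -> `|flat p t| <= C * t ^+ 2.
Proof.
have [C C0 HC] := horner_bound p.
(* The term of degree [n.+1 = size p + 2] of the exponential series at [1/t] dominates [p(1/t)],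
   which grows at most like the power [size p], with the factor [t ^+ 2] to spare. *)
pose n := (size p).+1.
exists (C * n.+1`!%:R); first by rewrite mulr_ge0.
move=> t t1; rewrite /flat; case: ifPn => t0; last first.
  by rewrite normr0; apply: mulr_ge0; [exact: mulr_ge0|exact: sqr_ge0].
have s1 : 1 <= t^-1 by rewrite invf_ge1// (le_trans (ler_norm _)).
have s0 : 0 < t^-1 by rewrite invr_gt0.
rewrite normrM expRN (ger0_norm (_ : 0 <= (expR t^-1)^-1)) ?invr_ge0 ?expR_ge0//.
apply: (@le_trans _ _ (C * t^-1 ^+ size p * (expR t^-1)^-1)).
  by rewrite ler_wpM2r ?invr_ge0 ?expR_ge0//; exact: HC.
rewrite -!mulrA ler_wpM2l// mulrC ler_pdivrMl ?expR_gt0//.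
have := expR_ge1Dxn n (ltW s0).
rewrite -/n; move=> H.
have {}H : t^-1 ^+ n.+1 / n.+1`!%:R <= expR t^-1.
  by apply: le_trans H; rewrite lerDr.
have -> : t^-1 ^+ size p = (t^-1 ^+ n.+1 / n.+1`!%:R) * (n.+1`!%:R * t ^+ 2).
  have f0 : n.+1`!%:R != 0 :> R by rewrite pnatr_eq0 -lt0n fact_gt0.
  rewrite /n !exprSr -/n; move: f0; set N := n.+1`!%:R => f0; field.
  by rewrite f0 gt_eqF.
by apply: ler_wpM2r => //; apply: mulr_ge0 => //; exact: sqr_ge0.
Qed.

(** With [s = 1/t], the derivative of [p(s) exp(-s)] in [t] is [s^2 (p(s) - p'(s)) exp(-s)], whence
    the new polynomial. At the origin the difference quotient tends to zero by the quadratic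
    bound. *)
Lemma is_derive_flat p (t : R) :
  is_derive t (1 : R) (flat p) (flat ('X^2 * (p - p^`())) t).
Proof.
have [t0|t0|<-] := ltgtP 0 t.
- have nt : \near t, p.[t^-1] * expR (- t^-1) = flat p t.
    near=> s; rewrite /flat ifT//.
    by near: s; exact: lt_nbhsr.
  apply: (near_eq_is_derive nt).
  have t'0 : t != 0 by rewrite gt_eqF.
  have dp : is_derive t^-1 (1 : R) (horner p) (p^`().[t^-1]).
    by rewrite derivE derive1E; apply: derivableP; exact: derivable_horner.
  have di : is_derive t (1 : R) (fun s : R => s^-1) (- t ^- 2).
    have := is_deriveV t'0 (is_derive_id t (1:R)).
    by rewrite scaleNr /GRing.scale/= mulr1.
  have dc : is_derive t (1 : R) (horner p \o (fun s : R => s^-1))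
      (p^`().[t^-1] * (- t ^- 2)) by exact: is_derive1_comp.
  have dn : is_derive t (1 : R) (fun s : R => - s^-1) (t ^- 2).
    by rewrite -[t ^- 2]opprK; exact: is_deriveN.
  have de : is_derive t (1 : R) (expR \o (fun s : R => - s^-1))
     (expR (- t^-1) * (t ^- 2)) by exact: is_derive1_comp.
  have H := is_deriveM dc de.
  apply: (is_derive_eq H).
  rewrite /flat t0 !hornerE /GRing.scale/= -exprVn.
  ring.
- have nt : \near t, 0 = flat p t.
    near=> s; rewrite /flat ifF//; apply/negbTE; rewrite -leNgt ltW//.
    by near: s; exact: lt_nbhsl.
  apply: (near_eq_is_derive nt).
  by rewrite /flat ltNge (ltW t0)/=; exact: is_derive_cst.
- have f0 q : flat q 0 = 0 by rewrite /flat ltxx.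
  rewrite f0.
  have [C C0 HC] := flat_bound p.
  have cv : h^-1 *: (flat p (h *: (1 : R) + 0) - flat p 0) @[h --> 0^'] --> (0 : R).
    apply/cvgrPdist_le => /= e e0; near=> h.
    have hn0 : h != 0 by near: h; exact: nbhs_dnbhs_neq.
    rewrite addr0 [h *: 1]mulr1 f0 subr0 sub0r normrN normrM normfV.
    rewrite ler_pdivrMl ?normr_gt0//.
    apply: (le_trans (HC _ _)).
      by near: h; apply: dnbhs0_le.
    rewrite -real_normK ?num_real// expr2 mulrCA ler_wpM2l//.
    apply: (@le_trans _ _ ((C + 1) * `|h|)).
      by rewrite ler_wpM2r// lerDl.
    rewrite mulrC -ler_pdivlMr ?ltr_wpDl//.
    by near: h; apply: dnbhs0_le; rewrite divr_gt0// ltr_wpDl.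
  by apply: DeriveDef; [apply/cvg_ex; exists 0|exact/cvg_lim].
Unshelve. all: by end_near. Qed.

Lemma Ck_on_flat p k : Ck_on k setT (flat p).
Proof.
have dflat q t : differentiable (flat q) t.
  by apply/derivable1_diffP; have [] := is_derive_flat q t.
elim: k p => [|k IH] p; first by move=> t _; exact: differentiable_continuous.
split=> [t _ //|v].
have H : Ck_on k setT (fun t => v * flat ('X^2 * (p - p^`())) t).
  by apply: Ck_onM; [exact: openT|exact: Ck_on_cst|exact: IH].
apply: (Ck_on_eq openT _ H) => t _.
have [_ <-] := is_derive_flat p t.
by rewrite !deriveE// -[in RHS](mulr1 v) linearZ.
Qed.

End FlatFunction.

(** * Smoothness of integrals with parameters *)

Section Int01.
Context {R : realType}.
Implicit Types f g : R -> R.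

Definition int01 f : R := (\int[lebesgue_measure]_(t in `[0, 1]) f t)%R.

Definition cont01 f := forall t : R, 0 <= t <= 1 -> {for t, continuous f}.

Let mI : measurable (`[0, 1] : set (measurableTypeR R)).
Proof. exact: measurable_itv. Qed.

Lemma integrable01 f : cont01 f ->
  lebesgue_measure.-integrable (`[0, 1] : set (measurableTypeR R)) (EFin \o f).
Proof.
move=> cf; apply: continuous_compact_integrable; first exact: segment_compact.
by apply: continuous_in_subspaceT => t; rewrite inE/= in_itv/=; exact: cf.
Qed.

Lemma eq_int01 f g : (forall t : R, 0 <= t <= 1 -> f t = g t) -> int01 f = int01 g.
Proof.
by move=> fg; apply: eq_Rintegral => t; rewrite inE/= in_itv/=; exact: fg.
Qed.

Lemma int01D f g : cont01 f -> cont01 g ->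
  int01 (fun t => f t + g t) = int01 f + int01 g.
Proof. by move=> cf cg; apply: RintegralD => //; exact: integrable01. Qed.

Lemma int01B f g : cont01 f -> cont01 g ->
  int01 (fun t => f t - g t) = int01 f - int01 g.
Proof. by move=> cf cg; apply: RintegralB => //; exact: integrable01. Qed.

Lemma int01Z (a : R) f : cont01 f -> int01 (fun t => a * f t) = a * int01 f.
Proof. by move=> cf; apply: RintegralZl => //; exact: integrable01. Qed.

Lemma int01_le (C : R) f : cont01 f -> (forall t : R, 0 <= t <= 1 -> `|f t| <= C) ->
  `|int01 f| <= C.
Proof.
move=> cf fC; apply: le_trans (le_normr_Rintegral _ (integrable01 cf)) _ => //.
apply: (@le_trans _ _ (int01 (fun=> C))).
  apply: le_Rintegral => //.
  - apply: (@integrable01 (fun t => `|f t|)) => t t01.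
    apply: (@continuous_comp _ _ _ f Num.norm); first exact: cf.
    exact: norm_continuous.
  - by apply: (@integrable01 (fun=> C)) => t _; exact: cst_continuous.
have E := @lebesgue_measure_itv R `[0, 1]%R.
rewrite /int01 Rintegral_cst// [X in fine X]E /= lte_fin ltr01/=.
by rewrite oppr0 addr0 mulr1.
Qed.

Lemma int01_FTC (f F : R -> R) :
  (forall t : R, 0 <= t <= 1 -> is_derive t (1 : R) F (f t)) ->
  cont01 f -> int01 f = F 1 - F 0.
Proof.
move=> dF cf.
have cF t : 0 <= t <= 1 -> {for t, continuous F}.
  move=> /dF [dFt _]; apply: differentiable_continuous.
  exact/derivable1_diffP.
rewrite /int01 /Rintegral (@continuous_FTC2 _ _ F 0 1)//.
- by apply: continuous_in_subspaceT => t; rewrite inE/= in_itv/=; exact: cf.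
- split.
  + by move=> t; rewrite in_itv/= => /andP[t0 t1]; case: (dF t) => //; rewrite !ltW.
  + by apply: cvg_at_right_filter; apply: cF; rewrite lexx ler01.
  + by apply: cvg_at_left_filter; apply: cF; rewrite lexx ler01.
- move=> t; rewrite in_itv/= => /andP[t0 t1]; rewrite derive1E.
  by case: (dF t) => //; rewrite !ltW.
Qed.

End Int01.

Section ParamInt.
Context {R : realType} {n : nat}.
Notation V := 'rV[R]_n.
Variables (U : set V) (W : set (V * R)).
Hypotheses (oU : open U) (oW : open W).
Hypothesis UW : forall (z : V) (t : R), U z -> 0 <= t <= 1 -> W (z, t).
Implicit Type psi : V * R -> R.

Definition pint psi (z : V) : R := int01 (fun t => psi (z, t)).

Lemma cont01_section psi (z : V) : U z -> (forall w, W w -> {for w, continuous psi}) ->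
  cont01 (fun t => psi (z, t)).
Proof.
move=> Uz cpsi t t01.
apply: (@continuous_comp _ _ _ (fun t => (z, t)) psi).
  by apply: (@cvg_pair _ _ _ _ (nbhs z) (nbhs t)); [exact: cvg_cst|exact: cvg_id].
by apply: cpsi; exact: UW.
Qed.

(** Packaged as a linear map so that ['d psi w] composed with it can be expanded over the standard
    basis of [V]. *)
Definition pair0 (h : V) : (V * R^o)%type := (h, 0).

Lemma pair0_is_linear : linear pair0.
Proof. by move=> a u v; congr pair; rewrite /= [RHS]addr0 [RHS]mulr0. Qed.

HB.instance Definition _ := GRing.isLinear.Build _ _ _ _ pair0 pair0_is_linear.

Lemma segment_MVT psi (z : V) (t : R) (h : V) : (forall s : R, 0 <= s <= 1 -> W (z + s *: h, t)) ->
  (forall w, W w -> differentiable psi w) ->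
  exists2 s : R, 0 <= s <= 1 &
    psi (z + h, t) - psi (z, t) = 'd psi (z + s *: h, t) (h, 0).
Proof.
move=> Wst dpsi.
pose c (s : R^o) : (V * R^o)%type := (z + s *: h, t : R^o).
have dc1 s : is_diff s (fun s : R^o => z + s *: h) (fun r : R^o => r *: h).
  rewrite (_ : (fun r : R^o => r *: h) = 0 + (fun r => r *: h)); last first.
    by rewrite add0r.
  exact: (is_diffD (is_diff_cst z s) (is_diff_scalel s h)).
have dc s : is_diff s c (fun r => (r *: h, 0)).
  exact: (is_diff_pair (dc1 s) (is_diff_cst (t : R^o) s)).
have dpc (s : R) : 0 <= s <= 1 ->
    is_derive s (1 : R) (psi \o c) ('d psi (c s) (h, 0)).
  move=> s01.
  have dpsis : differentiable psi (c s) by apply/dpsi/Wst.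
  have dcs : differentiable c s by [].
  have dpc := differentiable_comp dcs dpsis.
  apply: DeriveDef; first exact: diff_derivable.
  by rewrite deriveE// diff_comp//= diff_val scale1r.
have [||s] := @MVT_segment _ (psi \o c) (fun s => 'd psi (c s) (h, 0)) 0 1 ler01.
- move=> s; rewrite in_itv/= => /andP[s0 s1]; apply: dpc.
  by rewrite !ltW.
- apply: continuous_in_subspaceT => s; rewrite inE/= in_itv/= => s01.
  case: (dpc _ s01) => dps _; apply: differentiable_continuous.
  exact/derivable1_diffP.
- rewrite in_itv/= /c/= subr0 mulr1 scale1r scale0r addr0 => s01 E.
  by exists s.
Qed.

Lemma d_pair0 psi w (h : V) :
  'd psi w (h, 0 : R) = \sum_i h 0 i * 'd psi w (delta_mx 0 i, 0 : R).
Proof.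
rewrite -[(h, 0)]/(pair0 h) [X in pair0 X]row_sum_delta !linear_sum.
by apply: eq_bigr => i _; rewrite !linearZ.
Qed.

Lemma d_pair0B psi w w' (h : V) :
  'd psi w (h, 0 : R) - 'd psi w' (h, 0 : R) =
  \sum_i h 0 i * ('d psi w (delta_mx 0 i, 0 : R) - 'd psi w' (delta_mx 0 i, 0 : R)).
Proof.
transitivity (\sum_i h 0 i * 'd psi w (delta_mx 0 i, 0 : R)
  - \sum_i h 0 i * 'd psi w' (delta_mx 0 i, 0 : R)).
  by congr (_ - _); exact: d_pair0.
rewrite -sumrB; apply: eq_bigr => i _; exact/esym/mulrBr.
Qed.

(** The estimate has to be uniform in [t] before it can be integrated. The mean value theorem
    reduces it to continuity of the partial derivatives, and compactness of [[0, 1]] makes the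
    neighbourhood of [0] independent of [t]. *)
Lemma pint_remainder psi (z : V) (e : R) : U z -> 0 < e ->
  (forall w, W w -> differentiable psi w) ->
  (forall v w, W w -> {for w, continuous ('D_v psi)}) ->
  \forall h \near (0 : V), forall t : R, 0 <= t <= 1 ->
    `|psi (h + z, t) - psi (z, t) - 'd psi (z, t) (h, 0)| <= e * `|h|.
Proof.
move=> Uz e0 dpsi cD.
pose D i := 'D_(delta_mx 0 i, 0 : R) psi.
(* Each of the [n] coordinates costs two comparisons with [D i (z, t)]; [n.+1] keeps the quotient
   meaningful for [n = 0]. *)
pose e' := e / (2 * n.+1%:R).
have e'0 : 0 < e' by rewrite divr_gt0.
have cI : compact (`[0, 1] : set R) by exact: segment_compact.
have H := (@compact_near_coveringP R (`[0, 1])).1 cI V (nbhs (0 : V))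
  (fun (h : V) (t : R) =>
    `|psi (h + z, t) - psi (z, t) - 'd psi (z, t) (h, 0)| <= e * `|h|) _.
suff H' : forall t : R, `[0, 1]%classic t -> \forall t' \near t & h \near (0 : V),
    `|psi (h + z, t') - psi (z, t') - 'd psi (z, t') (h, 0)| <= e * `|h|.
  apply: (filterS _ (H (nbhs_filter (0 : V)) H')) => h hP t t01; apply: hP.
  by rewrite /= in_itv.
move=> t; rewrite /= in_itv/= => t01.
have Wzt : W (z, t) by exact: UW.
have : \forall w \near (z, t), W w /\ forall i, `|D i (z, t) - D i w| <= e'.
  have W1 : \forall w \near (z, t), W w by exact: open_nbhs_nbhs.
  have W2 i : nbhs (z, t) (fun w => `|D i (z, t) - D i w| <= e').
    by have /cvgrPdist_le := cD (delta_mx 0 i, 0) _ Wzt; exact.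
  have {}W2 : nbhs (z, t) (fun w => forall i, `|D i (z, t) - D i w| <= e').
    exact: (@filter_forall _ _ (fun i w => `|D i (z, t) - D i w| <= e') _
      (nbhs_filter (z, t)) W2).
  exact: filterI W1 W2.
move=> /nbhs_ballP[d /= d0 Hd].
have bd (h : V) (s t' : R) : `|h| < d -> 0 <= s <= 1 -> ball t d t' ->
    ball (z, t) d (z + s *: h, t').
  move=> hd /andP[s0 s1] bt; split => //=.
  rewrite -ball_normE/= opprD addrA subrr sub0r normrN normrZ ger0_norm//.
  by rewrite (le_lt_trans _ hd)// ler_piMl.
exists (ball t d, ball (0 : V) d) => /=.
  by split; exact: nbhsx_ballx.
move=> [t' h] /= [btt']; rewrite -ball_normE/= sub0r normrN => hd.
have [s s01 ->] : exists2 s : R, 0 <= s <= 1 &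
    psi (h + z, t') - psi (z, t') = 'd psi (z + s *: h, t') (h, 0).
  rewrite (addrC h); have Ws s : 0 <= s <= 1 -> W (z + s *: h, t').
    by move=> s01; case: (Hd _ (bd _ _ _ hd s01 btt')).
  exact: (segment_MVT Ws dpsi).
have [Ws Ds] := Hd _ (bd _ _ _ hd s01 btt').
have := bd h 0 t' hd; rewrite lexx ler01 scale0r addr0 => /(_ isT btt')/Hd[W0 D0].
rewrite d_pair0B.
apply: (@le_trans _ _ (\sum_(i < n) `|h| * (2 * e'))).
  apply: le_trans (ler_norm_sum _ _ _) _; apply: ler_sum => i _.
  rewrite normrM ler_pM//.
    by rewrite [leRHS]/Num.Def.normr/= mx_normrE; exact: (le_bigmax _ _ (0, i)).
  have dws := dpsi _ Ws; have dw0 := dpsi _ W0.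
  apply: (@le_trans _ _ (`|D i (z, t) - D i (z + s *: h, t')|
      + `|D i (z, t) - D i (z, t')|)); last first.
    by rewrite mulr_natl mulr2n; apply: lerD; [exact: Ds|exact: D0].
  rewrite (distrC (D i (z, t)) (D i (z + s *: h, t'))).
  apply: le_trans (ler_normD _ _); rewrite subrKA.
  rewrite le_eqVlt; apply/orP; left; apply/eqP; congr (`|_ - _|).
    exact/esym/(deriveE _ dws).
  exact/esym/(deriveE _ dw0).
rewrite sumr_const card_ord -[X in X <= _]mulr_natl /e'.
have -> : n%:R * (`|h| * (2 * (e / (2 * n.+1%:R)))) = (n%:R / n.+1%:R) * (e * `|h|).
  by field.
apply: ler_piMl; first by rewrite mulr_ge0// ltW.
by rewrite ler_pdivrMr ?ltr0n// mul1r ler_nat.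
Qed.

(** Differentiation under the integral sign: the candidate is [v |-> pint ('D_(v, 0) psi) z], and
    its remainder is the integral of a uniformly small one. *)
Lemma pint_diff psi (z : V) : U z ->
  (forall w, W w -> differentiable psi w) ->
  (forall v w, W w -> {for w, continuous ('D_v psi)}) ->
  differentiable (pint psi) z /\
  forall v, 'D_v (pint psi) z = pint ('D_(v, 0) psi) z.
Proof.
move=> Uz dpsi cD.
have cpsi w : W w -> {for w, continuous psi}.
  by move=> Ww; apply: differentiable_continuous; exact: dpsi.
have cDs v y : U y -> cont01 (fun t => 'D_(v, 0) psi (y, t)).
  by move=> Uy; exact: (cont01_section Uy (cD (v, 0))).
have DE v (y : V) (t : R) : U y -> 0 <= t <= 1 -> 'D_v psi (y, t) = 'd psi (y, t) v.
  by move=> Uy t01; rewrite deriveE//; exact/dpsi/UW.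
pose L v := pint ('D_(v, 0) psi) z.
have lin_L : linear (L : V -> R^o).
  move=> a u v; change (L (a *: u + v) = a * L u + L v); rewrite /L /pint.
  rewrite -int01Z; last exact: cDs.
  rewrite -int01D; last 2 first.
    by move=> t t01; apply: cvgMr; exact: cDs.
    exact: cDs.
  apply: eq_int01 => t t01; rewrite !DE//.
  by rewrite -[(a *: u + v, 0)]/(pair0 (a *: u + v)) !linearP.
pose LM := GRing.isLinear.Build _ _ _ _ _ lin_L.
pose LL : {linear V -> R^o} := HB.pack L LM.
have cL : continuous LL.
  have -> : LL = (fun h => \sum_i h 0 i * L (delta_mx 0 i)) :> (V -> R).
    apply/funext => h; rewrite [in LHS](row_sum_delta h) linear_sum.
    by apply: eq_bigr => i _; rewrite linearZ.
  move=> h.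
  apply: (@Ck_on_sum _ _ R^o 0 setT _ _ _ (fun i (h : V) => h 0 i * L (delta_mx 0 i)))
     => //; first exact: openT.
  move=> i _; apply: Ck_onM; [exact: openT| |exact: Ck_on_cst].
  by apply: Ck_on_coord; [exact: openT|exact: Ck_on_id].
have [dp dpE] : differentiable (pint psi : V -> R^o) z /\
    'd (pint psi : V -> R^o) z = LL :> (V -> R^o).
  apply: eps_diff => // e e0.
  have nU : \forall h \near (0 : V), U (h + z).
    have : \near z, U z by exact: open_nbhs_nbhs.
    by rewrite (near_shift 0)/= subr0.
  near=> h.
  have Uh : U (h + z) by near: h.
  rewrite /pint -int01B; last 2 first.
  - exact: cont01_section.
  - exact: cont01_section.
  rewrite /= /L /pint -int01B; last 2 first.
  - by move=> t t01; apply: cvgB; apply: cont01_section.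
  - exact: cDs.
  apply: int01_le.
    move=> t t01; apply: cvgB; last exact: cDs.
    by apply: cvgB; apply: cont01_section.
  move=> t t01; rewrite DE//; move: t t01; near: h.
  exact: pint_remainder.
by split=> // v; rewrite deriveE// dpE.
Unshelve. all: by end_near. Qed.

Lemma Ck_on_pint psi k : smooth_on W psi -> Ck_on k U (pint psi).
Proof.
elim: k psi => [|k IH] psi Hpsi.
  have [dpsi Cpsi] := Hpsi 1%N.
  by move=> z Uz; apply: differentiable_continuous; have [] := pint_diff Uz dpsi Cpsi.
have [dpsi Cpsi] := Hpsi 1%N.
split=> [z Uz|v]; first by have [] := pint_diff Uz dpsi Cpsi.
have H : Ck_on k U (pint ('D_(v, 0) psi)).
  by apply: IH => j; case: (Hpsi j.+1) => _ /(_ (v, 0)).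
apply: (Ck_on_eq oU _ H) => z Uz.
by have [_ ->] := pint_diff Uz dpsi Cpsi.
Qed.

End ParamInt.

Section SmoothOn.
Context {R : realType}.
Implicit Types V W : normedModType R.

Lemma smooth_on_eq V W (U : set V) (f g : V -> W) : open U ->
  (forall x, U x -> f x = g x) -> smooth_on U f -> smooth_on U g.
Proof. by move=> oU fg Hf k; exact: Ck_on_eq oU fg (Hf k). Qed.

Lemma smooth_onS V W (U U' : set V) (f : V -> W) :
  U' `<=` U -> smooth_on U f -> smooth_on U' f.
Proof. by move=> UU Hf k; exact: Ck_onS UU (Hf k). Qed.

Lemma smooth_on_local V W (U : set V) (f : V -> W) :
  (forall x, U x -> exists2 O : set V, O x & smooth_on O f) -> smooth_on U f.
Proof.
move=> H k; apply: Ck_on_local => x /H [ O Ox HO]; exists O => //; exact: HO.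
Qed.

Lemma smooth_on_comp V n W (U : set V) (O : set 'rV[R]_n) (f : V -> 'rV[R]_n)
    (g : 'rV[R]_n -> W) : open U -> open O -> (forall x, U x -> O (f x)) ->
  smooth_on U f -> smooth_on O g -> smooth_on U (fun x => g (f x)).
Proof. by move=> oU oO UO Hf Hg k; exact: (Ck_on_comp oU oO UO (Hf k) (Hg k)). Qed.

Lemma smooth_on_lsubmx n p (U : set 'rV[R]_(n + p)) :
  smooth_on U (fun u : 'rV[R]_(n + p) => lsubmx u).
Proof.
move=> k; apply: (@Ck_on_linear _ _ _ k U (@lsubmx R 1 n p)).
exact: continuous_lsubmx.
Qed.

Lemma smooth_on_rsubmx n p (U : set 'rV[R]_(n + p)) :
  smooth_on U (fun u : 'rV[R]_(n + p) => rsubmx u).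
Proof.
move=> k; apply: (@Ck_on_linear _ _ _ k U (@rsubmx R 1 n p)).
exact: continuous_rsubmx.
Qed.

End SmoothOn.

(** * Smooth maps between manifolds *)

Section Charts.
Context {R : realType} {M : topologicalType} {n : nat}.
Implicit Types (c : @chart R M n) (A : set (@chart R M n)) (O : set M).
Implicit Types W : normedModType R.

Lemma cimgP c u : is_chart c -> cimg c u ->
  cdom c (cfrom c u) /\ cto c (cfrom c u) = u.
Proof. by case=> _ _ fK _ _ [x dx <-]; rewrite fK. Qed.

Lemma cto_imgE c O : is_chart c ->
  cto c @` (cdom c `&` O) = cimg c `&` [set u | O (cfrom c u)].
Proof.
move=> hc; rewrite eqEsubset; split=> u /=.
  move=> [x [dx Ox] <-]; split; first by exists x.
  by case: hc => _ _ fK _ _; rewrite fK.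
by move=> [iu Ou]; have [du uE] := cimgP hc iu; exists (cfrom c u).
Qed.

Lemma open_cto_img c O : is_chart c -> open O -> open (cto c @` (cdom c `&` O)).
Proof.
move=> hc oO; rewrite cto_imgE//; case: (hc) => _ oi _ _ cf.
rewrite openE => u [iu Ou]; apply: filterI; first exact: open_nbhs_nbhs.
by apply: (cf _ iu); exact: open_nbhs_nbhs.
Qed.

Lemma open_cto_pre c (B : set 'rV[R]_n) : is_chart c -> open B ->
  open (cdom c `&` cto c @^-1` B).
Proof.
move=> hc oB; case: (hc) => od _ _ ct _.
rewrite openE => x [dx Bx]; apply: filterI; first exact: open_nbhs_nbhs.
by apply: (ct _ dx); exact: open_nbhs_nbhs.
Qed.

(** Smoothness on part of [M], with values in any normed space: gluing and chart coordinates need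
    it, while [smooth_fun] is global and scalar. *)
Definition smooth_in A O W (h : M -> W) : Prop :=
  forall c, A c -> smooth_on (cto c @` (cdom c `&` O)) (h \o cfrom c).

Variable A : set (@chart R M n).
Hypothesis hA : is_atlas A.

Lemma atlas_chart c : A c -> is_chart c.
Proof. by case: hA => + _ _; exact. Qed.

Lemma smooth_in_eq W O (f g : M -> W) : open O ->
  (forall x, O x -> f x = g x) -> smooth_in A O f -> smooth_in A O g.
Proof.
move=> oO fg Hf c Ac; have hc := atlas_chart Ac.
apply: smooth_on_eq (Hf c Ac); first exact: open_cto_img.
by move=> _ [x [dx Ox] <-] /=; case: hc => _ _ fK _ _; rewrite fK// fg.
Qed.

Lemma smooth_inS W O O' (f : M -> W) :
  O' `<=` O -> smooth_in A O f -> smooth_in A O' f.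
Proof.
move=> OO Hf c Ac; apply: smooth_onS (Hf c Ac) => _ [x [dx Ox] <-].
by exists x => //; split => //; exact: OO.
Qed.

Lemma smooth_in_local W O (f : M -> W) :
  (forall x, O x -> exists2 O', O' x & smooth_in A O' f) -> smooth_in A O f.
Proof.
move=> H c Ac; apply: smooth_on_local => _ [x [dx Ox] <-].
have [ O' O'x HO'] := H _ Ox; exists (cto c @` (cdom c `&` O')).
  by exists x.
exact: HO'.
Qed.

Lemma smooth_in_cst W O (a : W) : smooth_in A O (fun=> a).
Proof. by move=> c Ac k; exact: Ck_on_cst. Qed.

Lemma smooth_inD W O (f g : M -> W) : open O ->
  smooth_in A O f -> smooth_in A O g -> smooth_in A O (fun x => f x + g x).
Proof.
move=> oO Hf Hg c Ac k; apply: Ck_onD; [|exact: Hf|exact: Hg].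
exact: open_cto_img (atlas_chart Ac) oO.
Qed.

Lemma smooth_inM O (f g : M -> R) : open O ->
  smooth_in A O f -> smooth_in A O g -> smooth_in A O (fun x => f x * g x).
Proof.
move=> oO Hf Hg c Ac k; apply: Ck_onM; [|exact: Hf|exact: Hg].
exact: open_cto_img (atlas_chart Ac) oO.
Qed.

Lemma smooth_in_sum W O (I : Type) (r : seq I) (P : pred I) (f : I -> M -> W) :
  open O -> (forall i, P i -> smooth_in A O (f i)) ->
  smooth_in A O (fun x => \sum_(i <- r | P i) f i x).
Proof.
move=> oO Hf c Ac k; apply: Ck_on_sum => [|i Pi]; last exact: Hf.
exact: open_cto_img (atlas_chart Ac) oO.
Qed.

Lemma smooth_in_prod O (I : Type) (r : seq I) (P : pred I) (f : I -> M -> R) :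
  open O -> (forall i, P i -> smooth_in A O (f i)) ->
  smooth_in A O (fun x => \prod_(i <- r | P i) f i x).
Proof.
move=> oO Hf c Ac k; apply: Ck_on_prod => [|i Pi]; last exact: Hf.
exact: open_cto_img (atlas_chart Ac) oO.
Qed.

Lemma smooth_inV O (f : M -> R) : open O -> (forall x, O x -> f x != 0) ->
  smooth_in A O f -> smooth_in A O (fun x => (f x)^-1).
Proof.
move=> oO f0 Hf c Ac k; have hc := atlas_chart Ac.
apply: (@Ck_onV _ _ _ _ (f \o cfrom c)); last exact: Hf.
  exact: open_cto_img (atlas_chart Ac) oO.
move=> _ [x [dx Ox] <-] /=; case: hc => _ _ fK _ _; rewrite fK//; exact: f0.
Qed.

Lemma smooth_in_postcomp W p O (B : set 'rV[R]_p) (f : M -> 'rV[R]_p)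
    (g : 'rV[R]_p -> W) : open O -> open B -> (forall x, O x -> B (f x)) ->
  smooth_in A O f -> smooth_on B g -> smooth_in A O (fun x => g (f x)).
Proof.
move=> oO oB OB Hf Hg c Ac; have hc := atlas_chart Ac.
apply: (@smooth_on_comp _ _ _ _ _ B (f \o cfrom c) g) => //.
- exact: open_cto_img.
- by move=> _ [x [dx Ox] <-] /=; case: hc => _ _ fK _ _; rewrite fK//; exact: OB.
- exact: Hf.
Qed.

Lemma smooth_in_cto c : A c -> smooth_in A (cdom c) (cto c).
Proof. by move=> Ac c' Ac'; case: hA => _ _; exact. Qed.

(** One chart suffices, since [h] is its local expression composed with [cto c], whose smoothness in
    the other charts is the atlas condition. *)
Lemma smooth_in_of_chart W O c (h : M -> W) : A c -> open O -> O `<=` cdom c ->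
  smooth_on (cto c @` (cdom c `&` O)) (h \o cfrom c) -> smooth_in A O h.
Proof.
move=> Ac oO Od Hh; have hc := atlas_chart Ac.
apply: (@smooth_in_eq _ _ (fun x => (h \o cfrom c) (cto c x))) => //.
  by move=> x /Od dx /=; case: hc => _ _ fK _ _; rewrite fK.
have OB x : O x -> (cto c @` (cdom c `&` O)) (cto c x).
  by move=> Ox; exists x => //; split => //; exact: Od.
exact: smooth_in_postcomp oO (open_cto_img hc oO) OB
  (smooth_inS Od (smooth_in_cto Ac)) Hh.
Qed.

Lemma smooth_funP (f : M -> R) : smooth_fun A f <-> smooth_in A setT f.
Proof. by split=> Hf c Ac; have := Hf c Ac; rewrite setIT. Qed.

End Charts.

Section SmoothMaps.
Context {R : realType}.

Section Comp.
Context {M N : topologicalType} {n p : nat}.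
Variables (A : set (@chart R M n)) (B : set (@chart R N p)).
Hypotheses (hA : is_atlas A) (hB : is_atlas B).

Lemma smooth_in_comp (W : normedModType R) (F : M -> N) (O : set N) (h : N -> W) :
  smooth_map A B F -> open O -> smooth_in B O h ->
  smooth_in A (F @^-1` O) (h \o F).
Proof.
move=> [cF sF] oO Hh.
have oFO (O' : set N) : open O' -> open (F @^-1` O').
  by move=> oO'; apply: open_comp => // x _; exact: cF.
apply: smooth_in_local => x Ox.
have [_ /(_ (F x)) [c Bc dc] _] := hB; have hc := atlas_chart hB Bc.
case: (hc) => od oi fK _ _.
exists (F @^-1` (cdom c `&` O)); first by split.
have oFc := oFO _ (openI od oO).
apply: (@smooth_in_eq _ _ _ _ hA _ _ (fun y => (h \o cfrom c) (cto c (F y)))) => //.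
  by move=> y [dy Oy] /=; rewrite fK.
have OB y : (F @^-1` (cdom c `&` O)) y -> (cto c @` (cdom c `&` O)) (cto c (F y)).
  by move=> Fy; exists (F y).
have sFc : smooth_in A (F @^-1` (cdom c `&` O)) (cto c \o F).
  move=> c' Ac'; apply: smooth_onS (sF _ _ Ac' Bc).
  by move=> _ [y [dy [Fy Oy]] <-]; exists y.
exact: (smooth_in_postcomp hA oFc (open_cto_img hc oO) OB sFc (Hh _ Bc)).
Qed.

Lemma smooth_fun_comp (F : M -> N) (f : N -> R) :
  smooth_map A B F -> smooth_fun B f -> smooth_fun A (f \o F).
Proof.
move=> sF /smooth_funP Hf; apply/smooth_funP.
by have := smooth_in_comp sF openT Hf; rewrite preimage_setT.
Qed.

End Comp.

Lemma smooth_map_comp (M N P : topologicalType) n p q (A : set (@chart R M n))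
    (B : set (@chart R N p)) (C : set (@chart R P q)) (F : M -> N) (G : N -> P) :
  is_atlas A -> is_atlas B -> is_atlas C ->
  smooth_map A B F -> smooth_map B C G -> smooth_map A C (G \o F).
Proof.
move=> hA hB hC sF [cG sG]; split.
  by move=> x; apply: continuous_comp; [case: sF => + _; exact|exact: cG].
move=> c c' Ac Cc'.
have od : open (cdom c') by case: (atlas_chart hC Cc').
have oG : open (G @^-1` cdom c') by apply: open_comp => // x _; exact: cG.
have H : smooth_in B (G @^-1` cdom c') (cto c' \o G) by move=> b Bb; exact: sG.
exact: (smooth_in_comp hA hB sF oG H).
Qed.

Lemma smooth_map_id (M : topologicalType) n (A : set (@chart R M n)) :
  is_atlas A -> smooth_map A A id.
Proof. by case=> _ _ H; split=> [x|c c' Ac Ac']; [exact: cvg_id|exact: H]. Qed.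

Lemma smooth_map_cst (M N : topologicalType) n p (A : set (@chart R M n))
    (B : set (@chart R N p)) (y : N) : smooth_map A B (fun=> y).
Proof.
split=> [|c c' Ac Bc' k]; first by move=> x; exact: cvg_cst.
exact: Ck_on_cst.
Qed.

Section Product.
Context {M N : topologicalType} {n p : nat}.
Variables (A : set (@chart R M n)) (B : set (@chart R N p)).
Hypotheses (hA : is_atlas A) (hB : is_atlas B).

Lemma cimg_prod (c : @chart R M n) (c' : @chart R N p) : cimg (prod_chart c c') =
  [set u : 'rV[R]_(n + p) | cimg c (lsubmx u) /\ cimg c' (rsubmx u)].
Proof.
rewrite eqEsubset; split=> [_ [[x y] [/= dx dy] <-]|u [/= [x dx xE] [y dy yE]]].
  by rewrite row_mxKl row_mxKr; split; [exists x|exists y].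
by exists (x, y); rewrite //= xE yE hsubmxK.
Qed.

Lemma prod_is_chart (c : @chart R M n) (c' : @chart R N p) :
  is_chart c -> is_chart c' -> is_chart (prod_chart c c').
Proof.
move=> [od oi fK ct cf] [od' oi' fK' ct' cf']; split.
- by rewrite openE => -[x y] [/= dx dy]; exists (cdom c, cdom c') => //;
    split => /=; exact: open_nbhs_nbhs.
- rewrite cimg_prod; apply: openI.
    by apply: open_comp => // u _; exact: continuous_lsubmx.
  by apply: open_comp => // u _; exact: continuous_rsubmx.
- by move=> [x y] [/= dx dy]; rewrite row_mxKl row_mxKr fK// fK'.
- move=> [x y] [/= dx dy].
  have c1 : {for (x, y), continuous (fun z : M * N => cto c z.1)}.
    by apply: (@continuous_comp _ _ _ fst (cto c)); [exact: cvg_fst|exact: ct].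
  have c2 : {for (x, y), continuous (fun z : M * N => cto c' z.2)}.
    by apply: (@continuous_comp _ _ _ snd (cto c')); [exact: cvg_snd|exact: ct'].
  have c12 : {for (x, y), continuous (fun z : M * N => (cto c z.1, cto c' z.2))}.
    exact: (@cvg_pair _ _ _ (nbhs (x, y)) (nbhs (cto c x)) (nbhs (cto c' y))).
  apply: (@continuous_comp _ _ _ (fun z : M * N => (cto c z.1, cto c' z.2))
    (fun w : 'rV[R]_n * 'rV[R]_p => row_mx w.1 w.2) (x, y) c12).
  have C1 : Ck_on 0 setT (fun w : 'rV[R]_n * 'rV[R]_p => w.1).
    by move=> w _; exact: cvg_fst.
  have C2 : Ck_on 0 setT (fun w : 'rV[R]_n * 'rV[R]_p => w.2).
    by move=> w _; exact: cvg_snd.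
  exact: (Ck_on_row_mx openT C1 C2).
- rewrite cimg_prod => u [/= iu iu'].
  apply: (@cvg_pair _ _ _ (nbhs u) (nbhs (cfrom c (lsubmx u)))
    (nbhs (cfrom c' (rsubmx u)))).
    apply: (@continuous_comp _ _ _ (@lsubmx R 1 n p) (cfrom c)); last exact: cf.
    exact: continuous_lsubmx.
  apply: (@continuous_comp _ _ _ (@rsubmx R 1 n p) (cfrom c')); last exact: cf'.
  exact: continuous_rsubmx.
Qed.

Let fst_on (W : normedModType R) c c' (O : set M) (h : M -> W) : A c -> B c' ->
  open O -> smooth_in A O h ->
  smooth_on (cto (prod_chart c c') @` (cdom (prod_chart c c') `&` fst @^-1` O))
    (h \o fst \o cfrom (prod_chart c c')).
Proof.
move=> Ac Bc' oO Hh; have hc := atlas_chart hA Ac; have hc' := atlas_chart hB Bc'.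
apply: (@smooth_on_comp _ _ _ _ _ (cto c @` (cdom c `&` O)) lsubmx (h \o cfrom c)).
- apply: open_cto_img; first exact: prod_is_chart.
  by apply: open_comp => // z _; exact: cvg_fst.
- exact: open_cto_img.
- by move=> _ [[x y] [[/= dx dy] Ox] <-] /=; rewrite row_mxKl; exists x.
- exact: smooth_on_lsubmx.
- exact: Hh.
Qed.

Let snd_on (W : normedModType R) c c' (O : set N) (h : N -> W) : A c -> B c' ->
  open O -> smooth_in B O h ->
  smooth_on (cto (prod_chart c c') @` (cdom (prod_chart c c') `&` snd @^-1` O))
    (h \o snd \o cfrom (prod_chart c c')).
Proof.
move=> Ac Bc' oO Hh; have hc := atlas_chart hA Ac; have hc' := atlas_chart hB Bc'.
apply: (@smooth_on_comp _ _ _ _ _ (cto c' @` (cdom c' `&` O)) rsubmx (h \o cfrom c')).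
- apply: open_cto_img; first exact: prod_is_chart.
  by apply: open_comp => // z _; exact: cvg_snd.
- exact: open_cto_img.
- by move=> _ [[x y] [[/= dx dy] Ox] <-] /=; rewrite row_mxKr; exists y.
- exact: smooth_on_rsubmx.
- exact: Hh.
Qed.

Lemma prod_is_atlas : is_atlas (prod_atlas A B).
Proof.
split.
- move=> _ [c [c' [Ac Bc' ->]]].
  by apply: prod_is_chart; [exact: atlas_chart Ac|exact: atlas_chart Bc'].
- move=> [x y]; have [_ /(_ x)[c Ac dx] _] := hA.
  have [_ /(_ y)[c' Bc' dy] _] := hB.
  by exists (prod_chart c c') => //; exists c, c'.
- move=> _ _ [c1 [c2 [Ac1 Bc2 ->]]] [d1 [d2 [Ad1 Bd2 ->]]].
  have [e1 _ _ _ _] := atlas_chart hA Ad1.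
  have [e2 _ _ _ _] := atlas_chart hB Bd2.
  have H1 := fst_on Ac1 Bc2 e1 (smooth_in_cto hA Ad1).
  have H2 := snd_on Ac1 Bc2 e2 (smooth_in_cto hB Bd2).
  have oi : open (cto (prod_chart c1 c2) @`
      (cdom (prod_chart c1 c2) `&` cdom (prod_chart d1 d2))).
    apply: open_cto_img; first by apply: prod_is_chart;
      [exact: atlas_chart Ac1|exact: atlas_chart Bc2].
    by case: (prod_is_chart (atlas_chart hA Ad1) (atlas_chart hB Bd2)).
  move=> k; apply: Ck_on_row_mx => //.
    apply: Ck_onS (H1 k) => _ [z [dz [d1z d2z]] <-]; by exists z.
  by apply: Ck_onS (H2 k) => _ [z [dz [d1z d2z]] <-]; exists z.
Qed.

Lemma smooth_map_fst : smooth_map (prod_atlas A B) A fst.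
Proof.
split; first by move=> z; exact: cvg_fst.
move=> _ d [c [c' [Ac Bc' ->]]] Ad; have [od _ _ _ _] := atlas_chart hA Ad.
exact: fst_on Ac Bc' od (smooth_in_cto hA Ad).
Qed.

Lemma smooth_map_snd : smooth_map (prod_atlas A B) B snd.
Proof.
split; first by move=> z; exact: cvg_snd.
move=> _ d [c [c' [Ac Bc' ->]]] Bd; have [od _ _ _ _] := atlas_chart hB Bd.
exact: snd_on Ac Bc' od (smooth_in_cto hB Bd).
Qed.

Lemma smooth_map_pair (P : topologicalType) q (C : set (@chart R P q))
    (F : P -> M) (G : P -> N) : is_atlas C ->
  smooth_map C A F -> smooth_map C B G ->
  smooth_map C (prod_atlas A B) (fun x => (F x, G x)).
Proof.
move=> hC [cF sF] [cG sG]; split.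
  by move=> x; apply: (@cvg_pair _ _ _ (nbhs x) (nbhs (F x)) (nbhs (G x)));
    [exact: cF|exact: cG].
move=> c _ Cc [d [d' [Ad Bd' ->]]] k.
have [od _ _ _ _] := atlas_chart hA Ad; have [od' _ _ _ _] := atlas_chart hB Bd'.
apply: Ck_on_row_mx.
- have -> : (fun x => (F x, G x)) @^-1` cdom (prod_chart d d') =
    F @^-1` cdom d `&` G @^-1` cdom d' by [].
  apply: open_cto_img; first exact: atlas_chart Cc.
  by apply: openI; apply: open_comp => // x _.
- by apply: Ck_onS (sF _ _ Cc Ad k) => _ [z [dz [d1z d2z]] <-]; exists z.
- by apply: Ck_onS (sG _ _ Cc Bd' k) => _ [z [dz [d1z d2z]] <-]; exists z.
Qed.

End Product.

End SmoothMaps.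

(** * Hadamard's lemma *)

Section BoxBump.
Context {R : realType} {p : nat}.
Variables (a : 'rV[R]_p) (r : R).
Hypothesis r0 : 0 < r.

Definition box : set 'rV[R]_p := [set w | forall i, `|w 0 i - a 0 i| <= r].

(** The denominator normalises the value at the centre to 1. A box is used rather than a ball
    because the function is then a product over the coordinates, each factor cut off by [flat 1]. *)
Definition boxbump (w : 'rV[R]_p) : R :=
  (\prod_i flat 1 (r ^+ 2 - (w 0 i - a 0 i) ^+ 2)) / \prod_(i < p) flat 1 (r ^+ 2).

Lemma flat1_gt0 (t : R) : 0 < t -> 0 < flat 1 t.
Proof. by move=> t0; rewrite /flat t0 hornerC mul1r expR_gt0. Qed.

Lemma boxbump_center : boxbump a = 1.
Proof.
rewrite /boxbump; under eq_bigr do rewrite subrr expr0n subr0.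
rewrite divff//; apply: lt0r_neq0; apply: prodr_gt0 => i _.
by apply: flat1_gt0; rewrite exprn_gt0.
Qed.

Lemma boxbump_out w : ~ box w -> boxbump w = 0.
Proof.
move=> /existsNP[i /negP]; rewrite -ltNge => wi.
suff f0 : flat 1 (r ^+ 2 - (w 0 i - a 0 i) ^+ 2) = 0.
  by rewrite /boxbump (bigD1 i)//= f0 !mul0r.
rewrite /flat ifF//; apply/negbTE; rewrite -leNgt subr_le0.
by rewrite -[leRHS]real_normK ?num_real// ler_sqr ?nnegrE// ltW.
Qed.

Lemma compact_box : compact box.
Proof.
have : compact [set v : 'rV[R]_p | forall i, `[a 0 i - r, a 0 i + r]%classic (v ord0 i)].
  exact: (@rV_compact R p (fun i => `[a 0 i - r, a 0 i + r]%classic)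
    (fun i => @segment_compact R _ _)).
congr compact; rewrite eqEsubset; split=> w H i; have := H i.
  by rewrite /= in_itv/= ler_distl.
by rewrite /= in_itv/= ler_distl.
Qed.

Lemma smooth_boxbump : smooth_on setT boxbump.
Proof.
move=> k; apply: Ck_onM; [exact: openT| |exact: Ck_on_cst].
apply: Ck_on_prod => [|i _]; first exact: openT.
have Hc : Ck_on k setT (fun w : 'rV[R]_p => w 0 i - a 0 i).
  apply: Ck_onD; [exact: openT| |exact: Ck_on_cst].
  by apply: Ck_on_coord; [exact: openT|exact: Ck_on_id].
apply: (@Ck_on_compR _ _ _ setT setT
  (fun w : 'rV[R]_p => r ^+ 2 - (w 0 i - a 0 i) ^+ 2) (flat 1));
  [exact: openT|exact: openT|by []| |exact: Ck_on_flat].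
apply: (@Ck_on_eq _ _ _ _ _
  (fun w : 'rV[R]_p => r ^+ 2 + (-1) * ((w 0 i - a 0 i) * (w 0 i - a 0 i)))).
- exact: openT.
- by move=> w _; rewrite mulN1r expr2.
- apply: Ck_onD; [exact: openT|exact: Ck_on_cst|].
  apply: Ck_onM; [exact: openT|exact: Ck_on_cst|].
  by apply: Ck_onM; first exact: openT.
Qed.

End BoxBump.

Section ZeroExtension.
Context {R : realType} {N G : topologicalType} {n p : nat}.
Variables (A : set (@chart R N n)) (B : set (@chart R G p)).
Hypotheses (hA : is_atlas A) (hB : is_atlas B) (hG : hausdorff_space G).

Definition zext (c : @chart R G p) (H : 'rV[R]_p -> R) (y : G) : R :=
  if `[< cdom c y >] then H (cto c y) else 0.

(** Two kinds of open sets cover the product: where the chart and [B0] are available the formula is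
    smooth, and off the image of [K] the extension is zero. That image is closed, being compact in a
    Hausdorff space, and it does not depend on the parameter [x]. *)
Lemma smooth_zext c (H : N -> 'rV[R]_p -> R) (B0 K : set 'rV[R]_p) : B c ->
  open B0 -> compact K -> K `<=` B0 -> B0 `<=` cimg c ->
  (forall x w, ~ K w -> H x w = 0) ->
  (forall d, A d -> smooth_on [set u : 'rV[R]_(n + p) |
      cimg d (lsubmx u) /\ B0 (rsubmx u)]
      (fun u => H (cfrom d (lsubmx u)) (rsubmx u))) ->
  smooth_fun (prod_atlas A B) (fun z => zext c (H z.1) z.2).
Proof.
move=> Bc oB0 cK KB0 B0c HK Hs; apply/smooth_funP.
have hc := atlas_chart hB Bc; case: (hc) => od oi fK ct cf.
have hAB := prod_is_atlas hA hB.
apply: smooth_in_local => -[x y] _.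
have [[dy By]|nBy] := pselect (cdom c y /\ B0 (cto c y)).
- have [_ /(_ x)[d Ad dx] _] := hA; have hd := atlas_chart hA Ad.
  have [odd _ fKd _ _] := hd.
  pose Q : set (N * G) := [set z | cdom d z.1 /\ (cdom c `&` cto c @^-1` B0) z.2].
  have oQ : open Q.
    apply: (@openI _ (fst @^-1` cdom d) (snd @^-1` (cdom c `&` cto c @^-1` B0))).
      by apply: open_comp => // z _; exact: cvg_fst.
    apply: open_comp; first by move=> z _; exact: cvg_snd.
    exact: open_cto_pre.
  exists Q; first by [].
  apply: (@smooth_in_of_chart _ _ _ _ hAB _ _ (prod_chart d c)) => //.
  + by exists d, c.
  + by move=> z [d1 [d2 _]].
  + have Hd := Hs _ Ad.
    have oO : open (cto (prod_chart d c) @` (cdom (prod_chart d c) `&` Q)).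
      by apply: open_cto_img => //; exact: prod_is_chart.
    apply: (smooth_on_eq oO _ (smooth_onS _ Hd)).
      move=> _ [[x' y'] [_ [/= d1 [d2 B2]]] <-] /=.
      by rewrite row_mxKl row_mxKr /zext fK// asboolT// fKd.
    move=> _ [[x' y'] [_ [/= d1 [d2 B2]]] <-] /=.
    by rewrite row_mxKl row_mxKr; split=> //; exists x'.
- pose K' := cfrom c @` K.
  have cK' : compact K'.
    apply: continuous_compact => //; apply: continuous_in_subspaceT => u.
    by rewrite inE => /KB0/B0c; exact: cf.
  have clK' : closed K' by exact: compact_closed.
  exists (snd @^-1` ~` K').
    move=> /= [w Kw wy]; apply: nBy; rewrite -wy.
    by have [? ->] := cimgP hc (B0c _ (KB0 _ Kw)); split => //; exact: KB0.
  have oO : open (@snd N G @^-1` ~` K').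
    apply: open_comp; first by move=> z _; exact: cvg_snd.
    exact: closed_openC.
  apply: (@smooth_in_eq _ _ _ _ hAB _ _ (fun=> 0)) => //.
    move=> [x' y'] /= nK'; rewrite /zext; case: asboolP => // dy'.
    rewrite HK// => Kw; apply: nK'; exists (cto c y') => //; exact: fK.
  exact: smooth_in_cst.
Qed.

End ZeroExtension.

Section Hadamard.
Context {R : realType} {N G : topologicalType} {n p : nat}.
Variables (A : set (@chart R N n)) (B : set (@chart R G p)).
Hypotheses (hA : is_atlas A) (hB : is_atlas B) (hG : hausdorff_space G).
Variables (c0 : @chart R G p) (a : 'rV[R]_p) (rho : R).
Hypotheses (Bc0 : B c0) (rho0 : 0 < rho) (Ba : ball a rho `<=` cimg c0).
Variable F : N * G -> R.
Hypothesis hF : smooth_fun (prod_atlas A B) F.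

Let sec (x : N) (w : 'rV[R]_p) : R := F (x, cfrom c0 w).

(* The remainder of the first order Taylor formula in the second variable. *)
Definition hcoef (i : 'I_p) (x : N) (w : 'rV[R]_p) : R :=
  int01 (fun t => 'D_(delta_mx 0 i) (sec x) (a + t *: (w - a))).

Lemma ball_segment (w : 'rV[R]_p) (t : R) : ball a rho w -> 0 <= t <= 1 ->
  ball a rho (a + t *: (w - a)).
Proof.
move=> bw /andP[t0 t1]; move: bw; rewrite -!ball_normE/= => bw.
rewrite opprD addrA subrr sub0r normrN normrZ ger0_norm// distrC.
by apply: le_lt_trans bw; rewrite ler_piMl.
Qed.

Lemma smooth_section (x : N) : smooth_on (cimg c0) (sec x).
Proof.
have H : smooth_fun B (F \o (fun y => (x, y))).
  apply: (smooth_fun_comp hB (prod_is_atlas hA hB)) hF.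
  apply: smooth_map_pair => //; first exact: smooth_map_cst.
  exact: smooth_map_id.
exact: H.
Qed.

Lemma int01_sum (I : Type) (s : seq I) (b : I -> R) (f : I -> R -> R) :
  (forall i, cont01 (f i)) ->
  cont01 (fun t => \sum_(i <- s) b i * f i t) /\
  int01 (fun t => \sum_(i <- s) b i * f i t) = \sum_(i <- s) b i * int01 (f i).
Proof.
move=> cf; elim: s => [|i s [cs IH]].
  split; first by under eq_fun do rewrite big_nil; move=> t _; exact: cst_continuous.
  rewrite big_nil -[RHS](mul0r (int01 (fun=> 0))) -int01Z; last first.
    by move=> t _; exact: cst_continuous.
  by apply: eq_int01 => t _; rewrite big_nil mul0r.
have ci : cont01 (fun t => b i * f i t).
  by move=> t t01; apply: cvgM; [exact: cvg_cst|exact: cf].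
have E : (fun t => \sum_(j <- i :: s) b j * f j t) =
    (fun t => b i * f i t + \sum_(j <- s) b j * f j t).
  by apply/funext => t; rewrite big_cons.
split; first by rewrite E => t t01; apply: cvgD; [exact: ci|exact: cs].
by rewrite E int01D// IH big_cons int01Z.
Qed.

(** The fundamental theorem of calculus for the section along the segment from [a] to [w]. *)
Lemma hcoefE (x : N) (w : 'rV[R]_p) : ball a rho w ->
  F (x, cfrom c0 w) = F (x, cfrom c0 a) + \sum_i (w - a) 0 i * hcoef i x w.
Proof.
move=> bw; have sx := smooth_section x.
pose l (t : R) := a + t *: (w - a).
have lin t : 0 <= t <= 1 -> cimg c0 (l t).
  by move=> t01; apply: Ba; exact: ball_segment.
have dl (t : R) : is_diff t l (fun r : R^o => r *: (w - a)).
  rewrite (_ : (fun r : R^o => r *: (w - a)) = 0 + (fun r => r *: (w - a))); last first.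
    by rewrite add0r.
  exact: (is_diffD (is_diff_cst a t) (is_diff_scalel t (w - a))).
have cl (t : R) : {for t, continuous l}.
  by apply: differentiable_continuous.
have [ds Cs] := sx 1%N.
have cD i : cont01 (fun t => 'D_(delta_mx 0 i) (sec x) (l t)).
  move=> t t01.
  exact: (@continuous_comp _ _ _ l ('D_(delta_mx 0 i) (sec x)) t (cl t)
    (Cs _ _ (lin _ t01))).
have [cS IS] := @int01_sum _ (index_enum 'I_p) (fun i => (w - a) 0 i) _ cD.
have dF (t : R) : 0 <= t <= 1 -> is_derive t (1 : R) (sec x \o l)
    (\sum_i (w - a) 0 i * 'D_(delta_mx 0 i) (sec x) (l t)).
  move=> t01.
  have dst : differentiable (sec x) (l t) by exact/ds/lin.
  have dlt : differentiable l t by [].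
  have dc := differentiable_comp dlt dst.
  apply: DeriveDef; first exact: diff_derivable.
  rewrite deriveE// diff_comp//= diff_val scale1r.
  rewrite [X in 'd _ _ X](row_sum_delta (w - a)) linear_sum.
  by apply: eq_bigr => i _; rewrite linearZ deriveE.
have := int01_FTC dF cS; rewrite IS /hcoef => ->.
by rewrite /l/= scale1r scale0r addr0 addrC (addrC a) !subrK.
Qed.

Lemma smooth_hcoef i (d : @chart R N n) : A d ->
  smooth_on [set u : 'rV[R]_(n + p) | cimg d (lsubmx u) /\ ball a rho (rsubmx u)]
    (fun u => hcoef i (cfrom d (lsubmx u)) (rsubmx u)).
Proof.
move=> Ad; set U := [set u | _].
have hd := atlas_chart hA Ad; have hc0 := atlas_chart hB Bc0.
have [_ oid _ _ _] := hd; have [_ oi0 _ _ _] := hc0.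
have oU : open U.
  apply: openI.
    by apply: open_comp => // u _; exact: continuous_lsubmx.
  apply: open_comp; first by move=> u _; exact: continuous_rsubmx.
  exact: ball_open.
pose Fd := F \o cfrom (prod_chart d c0).
pose Q := cimg (prod_chart d c0).
have sFd : smooth_on Q Fd by apply: hF; exists d, c0.
have oQ : open Q by case: (prod_is_chart hd hc0).
pose e : 'rV[R]_(n + p) := row_mx 0 (delta_mx 0 i).
(* Contraction of the second block towards [a] by the factor [z.2], the parameter block being fixed:
   [hcoef] becomes the integral over [[0, 1]] of a smooth function of the chart variable and [t]. *)
pose q (z : 'rV[R]_(n + p) * R) : 'rV[R]_(n + p) :=
  row_mx (lsubmx z.1) (a + z.2 *: (rsubmx z.1 - a)).
have Cq k : Ck_on k setT q.
  have Cfst : Ck_on k setT (fun z : 'rV[R]_(n + p) * R => z.1).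
    apply: (@Ck_on_linear R ('rV[R]_(n + p) * R^o)%type 'rV[R]_(n + p) k setT fst).
    by move=> z; exact: cvg_fst.
  have Csnd : Ck_on k setT (fun z : 'rV[R]_(n + p) * R => z.2).
    apply: (@Ck_on_linear R ('rV[R]_(n + p) * R^o)%type R^o k setT snd).
    by move=> z; exact: cvg_snd.
  apply: Ck_on_row_mx; first exact: openT.
    exact: (Ck_on_comp openT openT (fun _ _ => I) Cfst (smooth_on_lsubmx _ k)).
  apply: Ck_onD; [exact: openT|exact: Ck_on_cst|].
  apply: Ck_on_scale; [exact: openT|exact: Csnd|].
  apply: Ck_onD; [exact: openT| |exact: Ck_on_cst].
  exact: (Ck_on_comp openT openT (fun _ _ => I) Cfst (smooth_on_rsubmx _ k)).
pose W := q @^-1` Q.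
have oW : open W.
  by apply: open_comp => // z _; exact: (Cq 0%N).
pose psi (z : 'rV[R]_(n + p) * R) : R := 'D_e Fd (q z).
have spsi : smooth_on W psi.
  move=> k; have [_ Hk] := sFd k.+1.
  apply: (Ck_on_comp oW oQ _ _ (Hk e)) => //.
  exact: Ck_onS (Cq k).
have UW z (t : R) : U z -> 0 <= t <= 1 -> W (z, t).
  move=> [Uz1 Uz2] t01; rewrite /W/= /Q cimg_prod/= /q/= row_mxKl row_mxKr.
  by split=> //; apply: Ba; exact: ball_segment.
move=> k; have Hk := Ck_on_pint oU oW UW k spsi.
apply: (Ck_on_eq oU _ Hk) => u [Uu1 Uu2].
rewrite /pint /hcoef; apply: eq_int01 => t t01; rewrite /psi /q/=.
set x := cfrom d (lsubmx u); set b' := a + _; set b := row_mx _ _.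
(* A step along [e] only moves the second block, so the derivative in the product chart is that of
   the section. *)
have E h : Fd (h *: e + b) = sec x (h *: delta_mx 0 i + b').
  rewrite /Fd /sec/= /e /b scale_row_mx scaler0 add_row_mx add0r.
  by rewrite row_mxKl row_mxKr.
have Eb : Fd b = sec x b' by rewrite /Fd /sec/= row_mxKl row_mxKr.
rewrite /derive Eb.
have -> : (fun h : R => h^-1 *: ((Fd \o shift b) (h *: e) - sec x b')) =
    (fun h => h^-1 *: ((sec x \o shift b') (h *: delta_mx 0 i) - sec x b')).
  by apply/funext => h; rewrite /= E.
by [].
Qed.

End Hadamard.

(** * The algebra of global smooth functions *)

Section SmoothAlgebra.
Context {R : realType}.
Implicit Types M N G : smoothManifold R.

Definition smooth2 N G (F : N * G -> R) : Prop :=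
  smooth_fun (prod_atlas (atlas N) (atlas G)) F.

Definition prodP N G := prod_is_atlas (atlasP N) (atlasP G).

Lemma smooth_cst M (a : R) : smooth (fun _ : M => a).
Proof. by apply/smooth_funP; exact: smooth_in_cst. Qed.

Lemma smoothD M (f g : M -> R) : smooth f -> smooth g ->
  smooth (fun x => f x + g x).
Proof.
move=> /smooth_funP Hf /smooth_funP Hg; apply/smooth_funP.
exact: (smooth_inD (atlasP M) openT Hf Hg).
Qed.

Lemma smoothM M (f g : M -> R) : smooth f -> smooth g ->
  smooth (fun x => f x * g x).
Proof.
move=> /smooth_funP Hf /smooth_funP Hg; apply/smooth_funP.
exact: (smooth_inM (atlasP M) openT Hf Hg).
Qed.

Lemma smoothZ M (a : R) (f : M -> R) : smooth f -> smooth (fun x => a * f x).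
Proof. by move=> Hf; apply: smoothM => //; exact: smooth_cst. Qed.

Lemma smoothN M (f : M -> R) : smooth f -> smooth (fun x => - f x).
Proof. by move=> /(smoothZ (-1)); under eq_fun do rewrite mulN1r. Qed.

Lemma smoothB M (f g : M -> R) : smooth f -> smooth g ->
  smooth (fun x => f x - g x).
Proof. by move=> Hf Hg; apply: smoothD => //; exact: smoothN. Qed.

Lemma smooth_sum M (I : Type) (r : seq I) (P : pred I) (f : I -> M -> R) :
  (forall i, P i -> smooth (f i)) -> smooth (fun x => \sum_(i <- r | P i) f i x).
Proof.
move=> Hf; apply/smooth_funP; apply: (@smooth_in_sum _ _ _ _ (atlasP M) R^o _ _ _ _ f openT) => i Pi.
exact/smooth_funP/Hf.
Qed.

Lemma smooth_comp M N (F : M -> N) (f : N -> R) :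
  smooth_map (atlas M) (atlas N) F -> smooth f -> smooth (fun x => f (F x)).
Proof. by move=> sF; exact: (smooth_fun_comp (atlasP M) (atlasP N) sF). Qed.

Lemma smooth2_comp M N G (F : M -> N) (F' : M -> G) (f : N * G -> R) :
  smooth_map (atlas M) (atlas N) F -> smooth_map (atlas M) (atlas G) F' ->
  smooth2 f -> smooth (fun x => f (F x, F' x)).
Proof.
move=> sF sF'; apply: (smooth_fun_comp (atlasP M) (@prodP N G)).
exact: smooth_map_pair (atlasP N) (atlasP G) _ _ _ _ _ (atlasP M) sF sF'.
Qed.

Lemma smooth2l M N (F : M * N -> R) x : smooth2 F -> smooth (fun y => F (x, y)).
Proof.
apply: smooth2_comp; first exact: smooth_map_cst.
exact: (smooth_map_id (atlasP N)).
Qed.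

Lemma smooth2r M N (F : M * N -> R) y : smooth2 F -> smooth (fun x => F (x, y)).
Proof.
move=> sF; apply: (@smooth2_comp _ _ _ (fun x => x) (fun=> y) F) => //.
  exact: (smooth_map_id (atlasP M)).
exact: smooth_map_cst.
Qed.

Lemma smooth2_swap M N (F : M * N -> R) : smooth2 F ->
  smooth2 (fun z : N * M => F (z.2, z.1)).
Proof.
apply: (@smooth_fun_comp _ _ _ _ _ _ _ (@prodP N M) (@prodP M N)
  (fun z : N * M => (z.2, z.1))).
apply: (smooth_map_pair (atlasP M) (atlasP N) (@prodP N M)).
  exact: (smooth_map_snd (atlasP N) (atlasP M)).
exact: (smooth_map_fst (atlasP N) (atlasP M)).
Qed.

(** The case of a constant parameter, with [G] itself as dummy parameter manifold. *)
Lemma smooth_zext1 G (c : chart G (mdim G)) (H : 'rV[R]_(mdim G) -> R)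
    (B0 K : set 'rV[R]_(mdim G)) : atlas G c -> open B0 -> compact K ->
  K `<=` B0 -> B0 `<=` cimg c -> (forall w, ~ K w -> H w = 0) ->
  smooth_on B0 H -> smooth (zext c H).
Proof.
move=> Ac oB0 cK KB0 B0c HK sH.
have H2 : smooth2 (fun z : G * G => zext c H z.2).
  apply: (@smooth_zext _ _ _ _ _ _ _ (atlasP G) (atlasP G) (@manifold_hausdorff _ G)
     c (fun _ => H) B0 K) => // d Ad k.
  apply: (@Ck_on_comp _ _ _ _ k _ B0 rsubmx H) => //.
  - have [_ oi _ _ _] := atlas_chart (atlasP G) Ad.
    apply: openI.
      by apply: open_comp => // u _; exact: continuous_lsubmx.
    by apply: open_comp => // u _; exact: continuous_rsubmx.
  - by move=> u [].
  - exact: smooth_on_rsubmx.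
by apply: (@smooth2_comp G G G id id _ _ _ H2); exact: (smooth_map_id (atlasP G)).
Qed.

(* The [u i] are the localised coordinate functions at [p], together with
   [1 - chi ^ 2] for a bump function [chi]. *)
Lemma hadamard N G (p : G) : exists (I : finType) (u : I -> G -> R),
  [/\ forall i, smooth (u i), forall i, u i p = 0 &
      forall F : N * G -> R, smooth2 F -> exists g : I -> N * G -> R,
        (forall i, smooth2 (g i)) /\
        forall x y, F (x, y) = F (x, p) + \sum_i u i y * g i (x, y)].
Proof.
have [_ /(_ p)[c Ac dp] _] := atlasP G.
have hc := atlas_chart (atlasP G) Ac; have [od oi fK ct cf] := hc.
pose a := cto c p.
have : nbhs a (cimg c) by apply: open_nbhs_nbhs; split => //; exists p.
move=> /nbhs_ballP[rho /= rho0 Ba].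
(* Half the radius keeps the closed box inside the open ball. *)
pose r := rho / 2.
have r0 : 0 < r by rewrite divr_gt0.
have KB : box a r `<=` ball a rho.
  move=> w bw; rewrite -ball_normE/= (@le_lt_trans _ _ r)//; last first.
    by rewrite ltr_pdivrMr// ltr_pMr// ltr1n.
  rewrite [leLHS]/Num.Def.normr/= mx_normrE; apply: bigmax_le; first exact: ltW.
  by move=> [i j] _ /=; rewrite !mxE distrC (ord1 i); exact: bw.
have ob : open (ball a rho) by exact: ball_open.
have cK : compact (box a r) by exact: compact_box.
have sb : smooth_on (ball a rho) (boxbump a r).
  apply: (@smooth_onS _ _ _ setT); [by []|exact: smooth_boxbump].
pose chi := zext c (boxbump a r).
have schi : smooth chi.
  apply: (smooth_zext1 Ac ob cK KB Ba _ sb) => w; exact: boxbump_out.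
have chip : chi p = 1 by rewrite /chi /zext asboolT// boxbump_center.
pose v i := zext c (fun w => boxbump a r w * (w 0 i - a 0 i)).
have sv i : smooth (v i).
  apply: (smooth_zext1 Ac ob cK KB Ba).
    by move=> w /(boxbump_out r0) ->; rewrite mul0r.
  move=> k; apply: Ck_onM => //; apply: Ck_onD => //; last exact: Ck_on_cst.
  by apply: Ck_on_coord => //; exact: Ck_on_id.
have vp i : v i p = 0 by rewrite /v /zext asboolT// subrr mulr0.
pose u (i : option 'I_(mdim G)) y :=
  if i is Some j then v j y else 1 - chi y * chi y.
exists (option 'I_(mdim G)), u; split.
- case=> [i|]; first exact: sv.
  by apply: smoothB; [exact: smooth_cst|exact: smoothM].
- by case=> [i|] /=; rewrite ?vp// chip mulr1 subrr.
move=> F sF.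
pose H i x w := boxbump a r w * hcoef c a F i x w.
(* [F (x, y) - F (x, p)] is split by [chi ^ 2] and [1 - chi ^ 2]. In the first part one factor [chi]
   localises the coordinate and the other the Taylor coefficient; in the second part the difference
   itself is the coefficient. *)
pose g (i : option 'I_(mdim G)) (z : N * G) :=
  if i is Some j then zext c (H j z.1) z.2 else F z - F (z.1, p).
exists g; split.
- case=> [i|] /=.
    apply: (@smooth_zext _ _ _ _ _ _ _ (atlasP N) (atlasP G) (@manifold_hausdorff _ G)
      c (H i) (ball a rho) (box a r)) => //.
      by move=> x w /(boxbump_out r0); rewrite /H => ->; rewrite mul0r.
    move=> d Ad k.
    have [_ oid _ _ _] := atlas_chart (atlasP N) Ad.
    have oU : open [set u : 'rV[R]_(mdim N + mdim G) |
        cimg d (lsubmx u) /\ ball a rho (rsubmx u)].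
      apply: openI.
        by apply: open_comp => // z _; exact: continuous_lsubmx.
      by apply: open_comp => // z _; exact: continuous_rsubmx.
    apply: Ck_onM => //; last exact: (smooth_hcoef (atlasP N) (atlasP G) Ac Ba sF).
    apply: (@Ck_on_comp _ _ _ _ k _ (ball a rho) rsubmx (boxbump a r)) => //.
    + by move=> z [].
    + exact: smooth_on_rsubmx.
  have sF' : smooth2 (fun z : N * G => F (z.1, p)).
    apply: (@smooth_fun_comp _ _ _ _ _ _ _ (@prodP N G) (@prodP N G)
      (fun z : N * G => (z.1, p))) sF.
    apply: (smooth_map_pair (atlasP N) (atlasP G) (@prodP N G)).
      exact: (smooth_map_fst (atlasP N) (atlasP G)).
    exact: smooth_map_cst.
  apply/smooth_funP.
  move/smooth_funP : sF => sF; move/smooth_funP : sF' => sF'.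
  have sm1 := @smooth_in_cst R _ _ (prod_atlas (atlas N) (atlas G)) R^o setT (-1 : R).
  have := smooth_inD (@prodP N G) openT sF (smooth_inM (@prodP N G) openT sm1 sF').
  by under eq_fun do rewrite mulN1r.
- move=> x y; rewrite (bigD1 None)//=.
  have -> : \sum_(i | i != None) u i y * g i (x, y) =
      chi y * chi y * (F (x, y) - F (x, p)).
    rewrite (reindex_omap Some id)/=; last by case.
    under eq_bigl do rewrite eqxx.
    rewrite /chi /v /zext; case: asboolP => dy; last first.
      by rewrite !mul0r big1// => i _; rewrite mul0r.
    have [bw|nbw] := pselect (ball a rho (cto c y)); last first.
      have -> : boxbump a r (cto c y) = 0.
        by apply: boxbump_out => // /KB.
      by rewrite !mul0r big1// => i _; rewrite !mul0r.
    have := hcoefE (atlasP N) (atlasP G) Ac Ba sF x bw; rewrite !fK// => ->.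
    rewrite addrC addKr mulr_sumr; apply: eq_bigr => i _.
    by rewrite /H !mxE; ring.
  ring.
Qed.

End SmoothAlgebra.

(** * Tangent vectors *)

Section Tangent.
Context {R : realType}.
Implicit Types M N G : smoothManifold R.

Section Alg.
Context {M : smoothManifold R} {p : M} {v : (M -> R) -> R}.
Hypothesis tv : is_tangent p v.

Lemma tangentD f g : smooth f -> smooth g ->
  v (fun x => f x + g x) = v f + v g.
Proof.
move=> sf sg; case: tv => L _; have := L 1 f g sf sg.
by rewrite mul1r => <-; congr v; apply/funext => x; rewrite mul1r.
Qed.

Lemma tangentM f g : smooth f -> smooth g ->
  v (fun x => f x * g x) = f p * v g + v f * g p.
Proof. by case: tv => _; exact. Qed.

Lemma tangent_cst a : v (fun=> a) = 0.
Proof.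
have s1 := @smooth_cst _ M 1.
have v1 : v (fun=> 1) = 0.
  have := tangentM s1 s1; under eq_fun do rewrite mulr1.
  by rewrite mul1r mulr1 => /esym/eqP; rewrite -subr_eq0 addrK => /eqP.
have sa := @smooth_cst _ M a; have := tangentM sa s1.
under eq_fun do rewrite mulr1.
rewrite v1 mulr0 mulr1 add0r => _.
have s0 := @smooth_cst _ M 0.
have v0 : v (fun=> 0) = 0.
  have := tangentD s0 s0; under eq_fun do rewrite addr0.
  by move=> /esym/eqP; rewrite -subr_eq0 addrK => /eqP.
case: tv => L _; have := L a _ _ s1 s0.
by rewrite v1 v0 mulr0 mulr1 !addr0.
Qed.

Lemma tangentZ a f : smooth f -> v (fun x => a * f x) = a * v f.
Proof.
move=> sf; have sa := @smooth_cst _ M a.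
by rewrite tangentM// tangent_cst mul0r addr0.
Qed.

Lemma tangentN f : smooth f -> v (fun x => - f x) = - v f.
Proof.
move=> sf; rewrite -mulN1r -tangentZ//.
by congr v; apply/funext => x; rewrite mulN1r.
Qed.

Lemma tangentB f g : smooth f -> smooth g ->
  v (fun x => f x - g x) = v f - v g.
Proof. by move=> sf sg; rewrite tangentD ?tangentN//; exact: smoothN. Qed.

Lemma tangent_sum (I : Type) (r : seq I) (P : pred I) (f : I -> M -> R) :
  (forall i, P i -> smooth (f i)) ->
  v (fun x => \sum_(i <- r | P i) f i x) = \sum_(i <- r | P i) v (f i).
Proof.
move=> sf; elim: r => [|i r IH].
  by rewrite big_nil -[RHS](tangent_cst 0); congr v; apply/funext => x;
    rewrite big_nil.
rewrite big_cons -IH; have [Pi|Pi] := boolP (P i); last first.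
  by congr v; apply/funext => x; rewrite big_cons (negbTE Pi).
rewrite -tangentD; [|exact: sf|exact: smooth_sum].
by congr v; apply/funext => x; rewrite big_cons Pi.
Qed.

End Alg.

(** Under [v] the expansion becomes [\sum_i v (u_i) g_i (x, p)], a finite combination of smooth
    functions of [x]. *)
Lemma tangent_smooth N G (p : G) v (F : N * G -> R) : is_tangent p v ->
  smooth2 F -> smooth (fun x => v (fun y => F (x, y))).
Proof.
move=> tv sF; have [I [u [su up /(_ F sF) [g [sg FE]]]]] := hadamard N p.
have E x : v (fun y => F (x, y)) = \sum_i v (u i) * g i (x, p).
  under eq_fun do rewrite FE.
  have sug i : smooth (fun y => u i y * g i (x, y)).
    by apply: smoothM => //; exact: smooth2l.
  rewrite (tangentD tv); [|exact: smooth_cst|exact: smooth_sum].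
  rewrite (tangent_cst tv) add0r (tangent_sum tv)//; apply: eq_bigr => i _.
  rewrite (tangentM tv) ?up ?mul0r ?add0r//; exact: smooth2l.
under eq_fun do rewrite E.
apply: smooth_sum => i _; apply: smoothZ; exact: smooth2r.
Qed.

(** Both sides reduce to [\sum_i v (u_i) w (g_i (., p))]. *)
Lemma tangent_swap N G (q : N) w (p : G) v (F : N * G -> R) :
  is_tangent q w -> is_tangent p v -> smooth2 F ->
  w (fun x => v (fun y => F (x, y))) = v (fun y => w (fun x => F (x, y))).
Proof.
move=> tw tv sF; have [I [u [su up /(_ F sF) [g [sg FE]]]]] := hadamard N p.
have sgi x i : smooth (fun y => g i (x, y)) by exact: smooth2l.
have sgi' y i : smooth (fun x => g i (x, y)) by exact: smooth2r.
have swg i : smooth (fun y => w (fun x => g i (x, y))).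
  by apply: (@tangent_smooth G N q w (fun z => g i (z.2, z.1))) => //;
    exact: smooth2_swap.
transitivity (\sum_i v (u i) * w (fun x => g i (x, p))).
  transitivity (w (fun x => \sum_i v (u i) * g i (x, p))).
    congr w; apply/funext => x; under eq_fun do rewrite FE.
    have sug i : smooth (fun y => u i y * g i (x, y)) by exact: smoothM.
    rewrite (tangentD tv); [|exact: smooth_cst|exact: smooth_sum].
    rewrite (tangent_cst tv) add0r (tangent_sum tv)//; apply: eq_bigr => i _.
    by rewrite (tangentM tv) ?up ?mul0r ?add0r.
  rewrite (tangent_sum tw) => [|i _]; last exact: smoothZ.
  by apply: eq_bigr => i _; rewrite (tangentZ tw).
transitivity (v (fun y => w (fun x => F (x, p)) +
    \sum_i u i y * w (fun x => g i (x, y)))).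
  rewrite (tangentD tv); [|exact: smooth_cst|]; last first.
    by apply: smooth_sum => i _; exact: smoothM.
  rewrite (tangent_cst tv) add0r (tangent_sum tv) => [|i _]; last exact: smoothM.
  by apply: eq_bigr => i _; rewrite (tangentM tv) ?up ?mul0r ?add0r.
congr v; apply/funext => y; under [in RHS]eq_fun do rewrite FE.
rewrite (tangentD tw); [|exact: smooth2r|]; last first.
  by apply: smooth_sum => i _; exact: smoothZ.
rewrite (tangent_sum tw) => [|i _]; last exact: smoothZ.
by congr (_ + _); apply: eq_bigr => i _; rewrite (tangentZ tw).
Qed.

(** Since [u_i] vanishes at [p], the coefficients [g_i (x, x)] and [g_i (p, x)] both contribute only
    through [g_i (p, p)]. *)
Lemma tangent_diag G (p : G) v (F : G * G -> R) : is_tangent p v -> smooth2 F ->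
  v (fun x => F (x, x)) = v (fun x => F (x, p)) + v (fun x => F (p, x)).
Proof.
move=> tv sF; have [I [u [su up /(_ F sF) [g [sg FE]]]]] := hadamard G p.
have sgx i : smooth (fun x => g i (x, x)).
  by apply: (@smooth2_comp R G G G id id (g i)) => //;
    exact: (smooth_map_id (atlasP G)).
have sgp i : smooth (fun x => g i (p, x)) by exact: smooth2l.
have sFp : smooth (fun x => F (x, p)) by exact: smooth2r.
under eq_fun do rewrite FE.
rewrite (tangentD tv)//; last by apply: smooth_sum => i _; exact: smoothM.
congr (_ + _).
under [in RHS]eq_fun do rewrite FE.
rewrite (tangentD tv); [|exact: smooth_cst|]; last first.
  by apply: smooth_sum => i _; exact: smoothM.
rewrite (tangent_cst tv) add0r.
rewrite !(tangent_sum tv); try by move=> i _; exact: smoothM.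
by apply: eq_bigr => i _; rewrite !(tangentM tv)// !up !mul0r.
Qed.

Lemma tangent_push M N (p : M) v (F : M -> N) : smooth_map (atlas M) (atlas N) F ->
  is_tangent p v -> is_tangent (F p) (fun k => v (fun x => k (F x))).
Proof.
move=> sF tv; split=> [a f g sf sg|f g sf sg].
  by case: tv => L _; rewrite L//; exact: smooth_comp.
by case: tv => _ L; rewrite L//; exact: smooth_comp.
Qed.

End Tangent.

Section ProductManifold.
Context {R : realType}.
Implicit Types M N : smoothManifold R.

Lemma hausdorff_prod (M N : topologicalType) :
  hausdorff_space M -> hausdorff_space N -> hausdorff_space (M * N)%type.
Proof.
move=> hM hN [x y] [x' y'] xy; congr pair.
  apply: hM => A B nA nB.
  have nA1 : nbhs (x, y) (fst @^-1` A) by exists (A, setT) => /=;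
    [split=> //; exact: filterT|move=> z []].
  have nB1 : nbhs (x', y') (fst @^-1` B) by exists (B, setT) => /=;
    [split=> //; exact: filterT|move=> z []].
  by have [[u v] [/= Au Bu]] := xy _ _ nA1 nB1; exists u.
apply: hN => A B nA nB.
have nA1 : nbhs (x, y) (snd @^-1` A) by exists (setT, A) => /=;
  [split=> //; exact: filterT|move=> z []].
have nB1 : nbhs (x', y') (snd @^-1` B) by exists (setT, B) => /=;
  [split=> //; exact: filterT|move=> z []].
by have [[u v] [/= Au Bu]] := xy _ _ nA1 nB1; exists v.
Qed.

Lemma second_countable_prod (M N : topologicalType) :
  @second_countable M -> @second_countable N -> @second_countable (M * N)%type.
Proof.
move=> [B cB [oB bB]] [C cC [oC bC]].
pose D := (fun z : set M * set N => z.1 `*` z.2) @` (B `*` C).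
exists D.
  apply: sub_countable (countableX cB cC); exact: card_image_le.
split=> [_ [[U V] [/= BU CV] <-]|[x y] W].
  have oU := oB _ BU; have oV := oC _ CV.
  by rewrite openE => -[u v] [/= Uu Vv]; exists (U, V) => //;
    split => /=; exact: open_nbhs_nbhs.
move=> [[P Q] /= [nP nQ] PQ].
have [U [BU Ux] UP] := bB x P nP; have [V [CV Vy] VQ] := bC y Q nQ.
exists (U `*` V); first by split; [exists (U, V)|].
by move=> [u v] [/= /UP Pu /VQ Qv]; exact: PQ.
Qed.

(** Products as bundled manifolds, so that a pair of group elements can be the parameter in
    [tangent_smooth]. *)
Definition prodM M N : smoothManifold R :=
  SmoothManifold (hausdorff_prod (@manifold_hausdorff _ M) (@manifold_hausdorff _ N))
    (second_countable_prod (@manifold_second_countable _ M)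
      (@manifold_second_countable _ N))
    (prodP M N).

End ProductManifold.

(** * Lie groups *)

Section LieGroupTheory.
Context {R : realType} (G : lieGroup R).
Implicit Types (x y z : G).

Local Notation "x *' y" := (gmul x y) (at level 40, left associativity).
Local Notation "1'" := (gone G).

Lemma gmulVr x : x *' ginv x = 1'.
Proof.
rewrite -[LHS]gmul1 -[X in X *' _](gmulV (ginv x)) -gmulA.
by rewrite [X in _ *' X](gmulA (ginv x)) gmulV gmul1 gmulV.
Qed.

Lemma gmul1r x : x *' 1' = x.
Proof. by rewrite -(gmulV x) gmulA gmulVr gmul1. Qed.

Lemma gmulKl x y : ginv x *' (x *' y) = y.
Proof. by rewrite gmulA gmulV gmul1. Qed.

Lemma gmulVKl x y : x *' (ginv x *' y) = y.
Proof. by rewrite gmulA gmulVr gmul1. Qed.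

Lemma ginvK x : ginv (ginv x) = x.
Proof. by rewrite -[LHS]gmul1r -(gmulV x) gmulA gmulV gmul1. Qed.

Lemma ginvM x y : ginv (x *' y) = ginv y *' ginv x.
Proof.
rewrite -[RHS]gmul1r -(gmulVr (x *' y)) !gmulA -[_ *' x]gmulA gmulV.
by rewrite gmul1r gmulV gmul1.
Qed.

Lemma ginv1 : ginv 1' = 1'.
Proof. by rewrite -[LHS]gmul1r gmulV. Qed.

Section SmoothOps.
Context {P : topologicalType} {q : nat} (C : set (@chart R P q)).
Hypothesis hC : is_atlas C.
Implicit Types F : P -> G.

Lemma smooth_gmul F F' : smooth_map C (atlas G) F -> smooth_map C (atlas G) F' ->
  smooth_map C (atlas G) (fun u : P => F u *' F' u).
Proof.
move=> sF sF'.
have sp := smooth_map_pair (atlasP G) (atlasP G) hC sF sF'.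
exact: (smooth_map_comp hC (prodP G G) (atlasP G) sp (gmul_smooth G)).
Qed.

Lemma smooth_ginv F : smooth_map C (atlas G) F ->
  smooth_map C (atlas G) (fun u : P => ginv (F u)).
Proof.
by move=> sF; exact: (smooth_map_comp hC (atlasP G) (atlasP G) sF (ginv_smooth G)).
Qed.

End SmoothOps.

Lemma smooth_gid : smooth_map (atlas G) (atlas G) (fun x => x).
Proof. exact: (smooth_map_id (atlasP G)). Qed.

Lemma smooth_gmull x : smooth_map (atlas G) (atlas G) (fun y => x *' y).
Proof.
apply: (smooth_gmul (atlasP G)); [exact: smooth_map_cst|exact: smooth_gid].
Qed.

Lemma smooth_lmul (k : G -> R) x : smooth k -> smooth (fun y => k (x *' y)).
Proof. by move=> sk; exact: smooth_comp (smooth_gmull x) sk. Qed.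

Lemma smooth2_mul (k : G -> R) : smooth k -> smooth2 (fun z : G * G => k (z.1 *' z.2)).
Proof. exact: (smooth_fun_comp (prodP G G) (atlasP G) (gmul_smooth G)). Qed.

End LieGroupTheory.

Section LieAlgebraTheory.
Context {R : realType} {G : lieGroup R} {V : vectType R} (L : lieAlgebra G V).
Implicit Types (x y z : G) (X Y Z : V) (k h : G -> R).

Local Notation "x *' y" := (gmul x y) (at level 40, left associativity).
Local Notation "1'" := (gone G).
Local Notation tanL := (ltan_tangent L).

Lemma ltanD X Y k : smooth k -> ltan L (X + Y) k = ltan L X k + ltan L Y k.
Proof. by move=> sk; rewrite -[X in X + Y]scale1r ltan_linear// mul1r. Qed.

Lemma ltan0 k : smooth k -> ltan L 0 k = 0.
Proof.
move=> sk; have := ltanD 0 0 sk; rewrite addr0 => /esym/eqP.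
by rewrite -subr_eq0 addrK => /eqP.
Qed.

Lemma ltanZ a X k : smooth k -> ltan L (a *: X) k = a * ltan L X k.
Proof. by move=> sk; rewrite -[a *: X]addr0 ltan_linear// ltan0// addr0. Qed.

Lemma ltanN X k : smooth k -> ltan L (- X) k = - ltan L X k.
Proof. by move=> sk; rewrite -scaleN1r ltanZ// mulN1r. Qed.

Lemma ltanB X Y k : smooth k -> ltan L (X - Y) k = ltan L X k - ltan L Y k.
Proof. by move=> sk; rewrite ltanD// ltanN. Qed.

Lemma ltan_eq X Y : (forall k, smooth k -> ltan L X k = ltan L Y k) -> X = Y.
Proof.
move=> H; apply/eqP; rewrite -subr_eq0; apply/eqP; apply: (@ltan_inj _ _ _ L).
by move=> f sf; rewrite ltanB// H// subrr.
Qed.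

Lemma of_tangentP v : is_tangent 1' v -> forall k, smooth k ->
  ltan L (of_tangent L v) k = v k.
Proof.
move=> tv; rewrite /of_tangent; case: xgetP => [X _ //|nX].
by have [X HX] := ltan_surj L tv; have := nX X.
Qed.

Lemma smooth_lfield X k : smooth k ->
  smooth (fun x => ltan L X (fun y => k (x *' y))).
Proof. by move=> sk; exact: (tangent_smooth (tanL X) (smooth2_mul sk)). Qed.

(** The left Maurer-Cartan form: a tangent vector at [x] carried back to the identity. *)
Definition ltrans x (v : (G -> R) -> R) : V :=
  of_tangent L (fun k => v (fun z => k (ginv x *' z))).

Lemma ltransP x v : is_tangent x v -> forall k, smooth k ->
  ltan L (ltrans x v) k = v (fun z => k (ginv x *' z)).
Proof.
move=> tv k sk; rewrite /ltrans of_tangentP// -(gmulV x).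
exact: tangent_push (smooth_gmull _) tv.
Qed.

Lemma ltransE x v : is_tangent x v -> forall k, smooth k ->
  v k = ltan L (ltrans x v) (fun y => k (x *' y)).
Proof.
move=> tv k sk; rewrite ltransP//; last exact: smooth_lmul.
by congr v; apply/funext => z; rewrite gmulVKl.
Qed.

Lemma tangent_lmul x X : is_tangent x (fun k => ltan L X (fun y => k (x *' y))).
Proof. by have := tangent_push (smooth_gmull x) (tanL X); rewrite gmul1r. Qed.

Lemma deE h X : smooth h -> de L h X = ltan L X h.
Proof.
move=> sh.
have lin_h : linear (fun X => ltan L X h : R^o).
  by move=> a Y Z; rewrite ltan_linear.
pose hM := GRing.isLinear.Build _ _ _ _ _ lin_h.
pose hL : {linear V -> R^o} := HB.pack (fun X => ltan L X h : R^o) hM.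
by rewrite /de -[X in linfun X]/(hL : V -> R^o) lfunE.
Qed.

Let b := vbasis (@fullv _ V).

(** As long as there are fewer functions than dimensions, some nonzero [X] is annihilated by all of
    them, and injectivity of [ltan] provides a smooth function detecting it. Pairing a relation
    among the rows with the coordinates [w] of [X] isolates the new row, whose coefficient must then
    vanish. *)
Let rank_step m : (m <= \dim (@fullv _ V))%N ->
  exists2 h : 'I_m -> G -> R, (forall j, smooth (h j)) &
    row_free (\matrix_(j < m, i < \dim (@fullv _ V)) ltan L b`_i (h j)).
Proof.
set d := \dim (@fullv _ V); elim: m => [_|m IH md].
  exists (fun _ _ => 0); first by move=> j; exact: smooth_cst.
  by rewrite /row_free -leqn0 rank_leq_row.
have [h sh hfree] := IH (ltnW md); set A := \matrix_(_, _) _ in hfree.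
have : kermx A^T != 0.
  by rewrite kermx_eq0 /row_free mxrank_tr (eqP hfree) neq_ltn md.
move=> /rowV0Pn[w /sub_kermxP wA w0].
pose X := \sum_(i < d) w 0 i *: b`_i.
have X0 : X != 0.
  apply: contra w0 => /eqP X0.
  have /freeP fb := basis_free (vbasisP (@fullv _ V)).
  by apply/eqP/rowP => i; rewrite mxE; exact: fb.
have [k [sk kX]] : exists k, smooth k /\ ltan L X k != 0.
  apply: contrapT => H; move/eqP: X0; apply; apply: (@ltan_inj _ _ _ L) => f sf.
  by apply/eqP; apply: contrapT => /negP fX; apply: H; exists f.
have Xk (f : G -> R) : smooth f -> ltan L X f = \sum_i w 0 i * ltan L b`_i f.
  move=> sf; rewrite -deE// /X linear_sum; apply: eq_bigr => i _.
  by rewrite linearZ/= deE.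
exists (fun j : 'I_(1 + m) => match fintype.split j with inl _ => k | inr i => h i end).
  by move=> j; case: fintype.split => // i; exact: sh.
set B := \matrix_(_, _) _.
have BE : B = col_mx (\row_i ltan L b`_i k) A.
  apply/matrixP => i j; rewrite !mxE; case: splitP => i' _; rewrite !mxE//.
rewrite -kermx_eq0; apply/rowV0P => v /sub_kermxP.
have := hsubmxK (v : 'rV[R]_(1 + m)).
move: (lsubmx _) (rsubmx _) => l r <-.
rewrite BE => vB0.
have vB : l *m (\row_i ltan L b`_i k) + r *m A = 0.
  by rewrite -mul_row_col; exact: vB0.
have : (l *m \row_i ltan L b`_i k + r *m A) *m w^T = 0 by rewrite vB mul0mx.
have Aw : A *m w^T = 0 by apply: trmx_inj; rewrite trmx_mul trmxK wA trmx0.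
rewrite mulmxDl -!mulmxA Aw mulmx0 addr0 => /matrixP/(_ 0 0).
rewrite mxE big_ord1 [in RHS]mxE mxE.
rewrite [Y in _ * Y = _](_ : _ = ltan L X k); last first.
  by rewrite Xk//; apply: eq_bigr => i _; rewrite !mxE mulrC.
move=> /eqP; rewrite mulf_eq0 (negbTE kX) orbF => /eqP l0.
have lv0 : l = 0 by apply/matrixP => i j; rewrite !ord1 l0 !mxE.
move: vB; rewrite lv0 mul0mx add0r => vA.
have r0 : r = 0.
  move: hfree; rewrite -kermx_eq0 => /rowV0P; apply=> //.
  exact/sub_kermxP.
by rewrite r0 row_mx0.
Qed.

(** An invertible matrix of values on a basis lets every covector be solved for; no chart at the
    identity is involved. *)
Lemma de_surj (phi : dualv V) : exists2 h, smooth h & de L h = phi.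
Proof.
have [h sh] := rank_step (leqnn _); set d := \dim _; set A := \matrix_(_, _) _.
rewrite row_free_unit => uA.
pose t : 'rV[R]_d := \row_i phi b`_i.
pose c := t *m invmx A.
exists (fun x => \sum_j c 0 j * h j x).
  by apply: smooth_sum => j _; exact: smoothZ.
have sf : smooth (fun x => \sum_j c 0 j * h j x).
  by apply: smooth_sum => j _; exact: smoothZ.
apply/lfunP => X.
rewrite (coord_vbasis (memvf X)) !linear_sum; apply: eq_bigr => i _.
rewrite !linearZ; congr (_ *: _); rewrite /= deE// (tangent_sum (tanL _)); last first.
  by move=> j _; exact: smoothZ.
have /matrixP/(_ 0 i) : c *m A = t by rewrite /c mulmxKV.
rewrite [LHS]mxE [RHS]mxE => <-; apply: eq_bigr => j _.
by rewrite (tangentZ (tanL _))//; congr (_ * _); rewrite mxE.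
Qed.

Lemma dual_eq X Y : (forall phi : dualv V, phi X = phi Y) -> X = Y.
Proof.
by move=> H; apply: ltan_eq => k sk; rewrite -!deE//; exact: H.
Qed.

Lemma lbr_lfield X Y k x : smooth k ->
  ltan L (lbr L X Y) (fun z => k (x *' z)) =
  ltan L X (fun y => ltan L Y (fun z => k (x *' y *' z))) -
  ltan L Y (fun y => ltan L X (fun z => k (x *' y *' z))).
Proof.
move=> sk; rewrite lbrE; last exact: smooth_lmul.
by congr (_ - _); congr (ltan _ _ _); apply/funext => y; congr (ltan _ _ _);
  apply/funext => z; rewrite gmulA.
Qed.

Lemma lbrC X Y : lbr L X Y = - lbr L Y X.
Proof. by apply: ltan_eq => k sk; rewrite ltanN// !lbrE// opprB. Qed.

(** Obtained by differentiating the constant [k (x x^-1)] along the diagonal. *)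
Lemma ltan_inv X k : smooth k -> ltan L X (fun x => k (ginv x)) = - ltan L X k.
Proof.
move=> sk; pose F (z : G * G) := k (z.1 *' ginv z.2).
have sF : smooth2 F.
  apply: (smooth_fun_comp (prodP G G) (atlasP G)) sk.
  apply: (smooth_gmul (prodP G G)); first exact: (smooth_map_fst (atlasP G) (atlasP G)).
  apply: (smooth_ginv (prodP G G)); exact: (smooth_map_snd (atlasP G) (atlasP G)).
have := tangent_diag (tanL X) sF; rewrite /F/=.
under eq_fun do rewrite gmulVr.
rewrite (tangent_cst (tanL X)).
under [X in _ = ltan _ _ X + _]eq_fun do rewrite ginv1 gmul1r.
under [X in _ = _ + ltan _ _ X]eq_fun do rewrite gmul1.
by move=> /esym/eqP; rewrite addrC addr_eq0 => /eqP.
Qed.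

Lemma smooth_conj x k : smooth k -> smooth (fun z => k (x *' z *' ginv x)).
Proof.
move=> sk; apply: (smooth_comp _ sk).
apply: (smooth_gmul (atlasP G)); last exact: smooth_map_cst.
exact: smooth_gmull.
Qed.

Let tangent_conj x X : is_tangent 1' (fun f => ltan L X (fun z => f (x *' z *' ginv x))).
Proof.
rewrite -[X in is_tangent X](_ : x *' 1' *' ginv x = 1'); last first.
  by rewrite gmul1r gmulVr.
apply: (tangent_push _ (tanL X)).
apply: (smooth_gmul (atlasP G)); last exact: smooth_map_cst.
exact: smooth_gmull.
Qed.

Lemma AdP x X k : smooth k ->
  ltan L (Ad L x X) k = ltan L X (fun z => k (x *' z *' ginv x)).
Proof.
move=> sk.
pose f X := of_tangent L (fun f => ltan L X (fun z => f (x *' z *' ginv x))).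
have lin_f : linear f.
  move=> a Y Z; apply: ltan_eq => h sh.
  rewrite ltan_linear// !of_tangentP//; try exact: tangent_conj.
  by rewrite ltan_linear//; exact: smooth_conj.
pose fM := GRing.isLinear.Build _ _ _ _ _ lin_f.
pose fL : {linear V -> V} := HB.pack f fM.
rewrite /Ad -[X in linfun X]/(fL : V -> V) lfunE/= /f of_tangentP//.
Qed.

Lemma AdM x y X : Ad L (x *' y) X = Ad L x (Ad L y X).
Proof.
apply: ltan_eq => k sk; rewrite !AdP//; last exact: smooth_conj.
by congr (ltan _ _ _); apply/funext => z; rewrite ginvM !gmulA.
Qed.

Lemma Ad1 X : Ad L 1' X = X.
Proof.
apply: ltan_eq => k sk; rewrite !AdP//.
by congr (ltan _ _ _); apply/funext => z; rewrite ginv1 gmul1 gmul1r.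
Qed.

Lemma AdK x X : Ad L (ginv x) (Ad L x X) = X.
Proof. by rewrite -AdM gmulV Ad1. Qed.

(* The derivative of [Ad_{x^-1} Y] at the identity: the factors [x^-1] and [x]
   are differentiated separately, and the second derivative is moved past [Y]
   because the fields act on different variables. *)
Lemma ltan_conj_bracket X Y k : smooth k ->
  ltan L X (fun x => ltan L Y (fun z => k (ginv x *' z *' x))) = ltan L (lbr L Y X) k.
Proof.
move=> sk.
pose F3 (z : prodM G G * G) := k (ginv z.1.1 *' z.2 *' z.1.2).
have sF3 : smooth2 F3.
  have hA2 := prodP G G.
  have hA3 := prodP (prodM G G) G.
  have s1 := smooth_map_fst hA2 (atlasP G).
  have s11 := smooth_map_comp hA3 hA2 (atlasP G) s1
    (smooth_map_fst (atlasP G) (atlasP G)).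
  have s12 := smooth_map_comp hA3 hA2 (atlasP G) s1
    (smooth_map_snd (atlasP G) (atlasP G)).
  have s2 := smooth_map_snd hA2 (atlasP G).
  apply: (smooth_fun_comp hA3 (atlasP G)) sk.
  apply: (smooth_gmul hA3 _ s12); apply: (smooth_gmul hA3 _ s2).
  exact: (smooth_ginv hA3 s11).
pose Psi (z : G * G) := ltan L Y (fun w => k (ginv z.1 *' w *' z.2)).
have sPsi : smooth2 Psi by exact: (tangent_smooth (tanL Y) sF3).
have := tangent_diag (tanL X) sPsi; rewrite /Psi/= => ->.
rewrite ginv1.
under [X in ltan _ _ X + _]eq_fun => x do under eq_fun do rewrite gmul1r.
under [X in _ + ltan _ _ X]eq_fun => x do under eq_fun do rewrite gmul1.
rewrite (ltan_inv X (k := fun x => ltan L Y (fun z => k (x *' z)))); last first.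
  exact: smooth_lfield.
rewrite (tangent_swap (F := fun z : G * G => k (z.2 *' z.1)) (tanL X) (tanL Y)).
  by rewrite lbrE// addrC.
exact: (smooth2_swap (smooth2_mul sk)).
Qed.

End LieAlgebraTheory.

(** * Functions with values in a vector space *)

Definition cfun (R : realType) (W : vectType R) i : dualv W :=
  linfun (coord (vbasis (@fullv R W)) i : W -> R^o).
Arguments cfun {R} W i.

Section VectorValued.
Context {R : realType} {M : smoothManifold R}.
Implicit Types U V W : vectType R.

(** A [vectType] carries no topology, so smoothness is tested on functionals. *)
Definition vsmooth W (f : M -> W) := forall phi : dualv W, smooth (fun x => phi (f x)).

Local Notation bas W := (vbasis (@fullv R W)).


Lemma cfunE W i (w : W) : cfun W i w = coord (bas W) i w.
Proof. by rewrite lfunE. Qed.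

Lemma vbasis_expand W (w : W) : w = \sum_i cfun W i w *: (bas W)`_i.
Proof.
rewrite [LHS](coord_vbasis (memvf w)).
by apply: eq_bigr => i _; rewrite cfunE.
Qed.

Definition vder W (v : (M -> R) -> R) (f : M -> W) : W :=
  \sum_i v (fun x => cfun W i (f x)) *: (bas W)`_i.

Section AtPoint.
Context {m : M} {v : (M -> R) -> R}.
Hypothesis tv : is_tangent m v.

Lemma vderE W (f : M -> W) (phi : dualv W) : vsmooth f ->
  phi (vder v f) = v (fun x => phi (f x)).
Proof.
move=> sf; rewrite /vder linear_sum.
transitivity (v (fun x => \sum_(i < \dim (@fullv R W)) phi (bas W)`_i * cfun W i (f x))).
  rewrite (tangent_sum tv) => [|i _]; last exact: smoothZ.
  apply: eq_bigr => i _; rewrite (tangentZ tv)//.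
  by rewrite linearZ/= mulrC.
congr v; apply/funext => x; rewrite [in RHS](vbasis_expand (f x)) linear_sum.
by apply: eq_bigr => i _; rewrite linearZ/= mulrC.
Qed.

Section Bilinear.
Context {U W : vectType R}.
Variables (P : M -> U -> W -> R) (f : M -> U) (g : M -> W).
Hypothesis PlinL : forall x a u u' w, P x (a *: u + u') w = a * P x u w + P x u' w.
Hypothesis PlinR : forall x a u w w', P x u (a *: w + w') = a * P x u w + P x u w'.
Hypothesis sP : forall u w, smooth (fun x => P x u w).
Hypotheses (sf : vsmooth f) (sg : vsmooth g).

Let PsumL x (I : Type) (r : seq I) (a : I -> R) (u : I -> U) w :
  P x (\sum_(i <- r) a i *: u i) w = \sum_(i <- r) a i * P x (u i) w.
Proof.
elim: r => [|i r IH]; last by rewrite !big_cons PlinL IH.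
by rewrite !big_nil -[0 in LHS](addr0 0) -[X in P x (X + _) w](scale0r 0) PlinL;
  rewrite mul0r add0r; have := PlinL x (-1) 0 0 w;
  rewrite scaler0 addr0 mulN1r addNr.
Qed.

Let PsumR x (I : Type) (r : seq I) (a : I -> R) u (w : I -> W) :
  P x u (\sum_(i <- r) a i *: w i) = \sum_(i <- r) a i * P x u (w i).
Proof.
elim: r => [|i r IH]; last by rewrite !big_cons PlinR IH.
by rewrite !big_nil -[0 in LHS](addr0 0) -[X in P x u (X + _)](scale0r 0) PlinR;
  rewrite mul0r add0r; have := PlinR x (-1) u 0 0;
  rewrite scaler0 addr0 mulN1r addNr.
Qed.

Let Pexp x u w : P x u w =
  \sum_i \sum_j cfun U i u * (cfun W j w * P x (bas U)`_i (bas W)`_j).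
Proof.
rewrite {1}(vbasis_expand u) PsumL; apply: eq_bigr => i _.
by rewrite {1}(vbasis_expand w) PsumR mulr_sumr.
Qed.

Lemma smooth_bil : smooth (fun x => P x (f x) (g x)).
Proof.
under eq_fun do rewrite Pexp.
by apply: smooth_sum => i _; apply: smooth_sum => j _; apply: smoothM => //;
  apply: smoothM.
Qed.

(** Leibniz rule with three factors, the pairing [P] itself varying with the point. In bases it is
    the scalar product rule for the coordinates of [f], the coordinates of [g] and the coefficients
    of [P]. *)
Lemma tangent_bil : v (fun x => P x (f x) (g x)) =
  v (fun x => P x (f m) (g m)) + P m (vder v f) (g m) + P m (f m) (vder v g).
Proof.
have sij i j : smooth (fun x => cfun W j (g x) * P x (bas U)`_i (bas W)`_j).
  by apply: smoothM.
have sij' i j : smooth (fun x => cfun U i (f x) *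
    (cfun W j (g x) * P x (bas U)`_i (bas W)`_j)) by apply: smoothM.
transitivity (\sum_i \sum_j
   (cfun U i (f m) * (cfun W j (g m) * v (fun x => P x (bas U)`_i (bas W)`_j))
   + v (fun x => cfun U i (f x)) * (cfun W j (g m) * P m (bas U)`_i (bas W)`_j)
   + cfun U i (f m) * (v (fun x => cfun W j (g x)) * P m (bas U)`_i (bas W)`_j))).
  under [in LHS]eq_fun do rewrite Pexp.
  rewrite (tangent_sum tv); last by move=> i _; exact: smooth_sum.
  apply: eq_bigr => i _; rewrite (tangent_sum tv)//; apply: eq_bigr => j _.
  rewrite (tangentM tv)// (tangentM tv)//; ring.
under eq_bigr do rewrite big_split big_split/=.
rewrite big_split big_split/=; congr (_ + _ + _).
- under [in RHS]eq_fun do rewrite Pexp.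
  have sc i j : smooth (fun x => cfun U i (f m) *
      (cfun W j (g m) * P x (bas U)`_i (bas W)`_j)).
    by apply: smoothZ; apply: smoothZ.
  rewrite (tangent_sum tv); last by move=> i _; exact: smooth_sum.
  apply: eq_bigr => i _; rewrite (tangent_sum tv)//; apply: eq_bigr => j _.
  by rewrite (tangentZ tv)//; [rewrite (tangentZ tv)|exact: smoothZ].
- rewrite /vder PsumL; apply: eq_bigr => i _.
  by rewrite [in RHS](vbasis_expand (g m)) PsumR mulr_sumr.
- rewrite [in RHS](vbasis_expand (f m)) PsumL; apply: eq_bigr => i _.
  by rewrite /vder PsumR mulr_sumr.
Qed.

End Bilinear.

End AtPoint.

Lemma vsmooth_eval (U : vectType R) (f : M -> dualv U) (u : U) :
  vsmooth f -> smooth (fun x => f x u).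
Proof.
move=> sf; have lin_e : linear (fun h : dualv U => h u : R^o).
  by move=> a h h'; rewrite !lfunE/= lfunE.
pose eM := GRing.isLinear.Build _ _ _ _ _ lin_e.
pose eL : {linear dualv U -> R^o} := HB.pack (fun h : dualv U => h u : R^o) eM.
have := sf (linfun eL); under eq_fun do rewrite lfunE/=.
exact.
Qed.

Lemma vsmooth_dual (U : vectType R) (f : M -> dualv U) :
  (forall u, smooth (fun x => f x u)) -> vsmooth f.
Proof.
move=> sf phi.
have E (h : dualv U) : h = \sum_(i < \dim (@fullv R U)) h (bas U)`_i *: cfun U i.
  apply/lfunP => u; rewrite [in LHS](vbasis_expand u) linear_sum sum_lfunE.
  by apply: eq_bigr => i _; rewrite linearZ/= scale_lfunE; exact: mulrC.
have -> : (fun x => phi (f x)) =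
    (fun x => \sum_(i < \dim (@fullv R U)) phi (cfun U i) * f x (bas U)`_i).
  apply/funext => x; rewrite [in LHS](E (f x)) linear_sum.
  by apply: eq_bigr => i _; rewrite linearZ/=; exact: mulrC.
by apply: smooth_sum => i _; exact: smoothZ.
Qed.

End VectorValued.

(** * Functions with vanishing left-invariant derivatives *)

Section LocalConstancy.
Context {R : realType}.

Lemma tangent_derive (M : smoothManifold R) (c : chart M (mdim M)) w d :
  atlas M c -> cimg c w ->
  is_tangent (cfrom c w) (fun k : M -> R => 'D_d (k \o cfrom c) w).
Proof.
move=> Ac iw.
have dk (k : M -> R) : smooth k -> differentiable (k \o cfrom c) w.
  by move=> sk; have [dk _] := sk _ Ac 1%N; exact: dk.
split=> [a f g sf sg|f g sf sg].
- have -> : (fun x => a * f x + g x) \o cfrom c =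
      a *: (f \o cfrom c) + (g \o cfrom c) by [].
  have df := diff_derivable (v := d) (dk _ sf).
  have dg := diff_derivable (v := d) (dk _ sg).
  have daf : derivable (a *: (f \o cfrom c)) w d by exact: derivableZ.
  by rewrite (deriveD daf dg) (deriveZ _ df).
- have -> : (fun x => f x * g x) \o cfrom c =
      (f \o cfrom c) * (g \o cfrom c) by [].
  have df := diff_derivable (v := d) (dk _ sf).
  have dg := diff_derivable (v := d) (dk _ sg).
  by rewrite (deriveM df dg); congr (_ + _); exact: mulrC.
Qed.

Lemma zero_derive_locally_cst n (U : set 'rV[R]_n) (f : 'rV[R]_n -> R) a rho w :
  (forall w, ball a rho w -> U w) ->
  (forall w, U w -> differentiable f w) ->
  (forall w d, U w -> 'D_d f w = 0) -> ball a rho w -> f w = f a.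
Proof.
move=> BU df D0 bw.
pose l (t : R) := a + t *: (w - a).
have dl (t : R) : is_diff t l (fun r : R^o => r *: (w - a)).
  rewrite (_ : (fun r : R^o => r *: (w - a)) = 0 + (fun r => r *: (w - a))); last first.
    by rewrite add0r.
  exact: (is_diffD (is_diff_cst a t) (is_diff_scalel t (w - a))).
have dF (t : R) : 0 <= t <= 1 -> is_derive t (1 : R) (f \o l) 0.
  move=> t01.
  have Ul : U (l t) by apply: BU; exact: ball_segment.
  have dst := df _ Ul.
  have dlt : differentiable l t by [].
  have dc := differentiable_comp dlt dst.
  apply: DeriveDef; first exact: diff_derivable.
  by rewrite deriveE// diff_comp//= diff_val scale1r -deriveE// D0.
have [||t _] := @MVT_segment _ (f \o l) (fun=> 0) 0 1 ler01.
- move=> t; rewrite in_itv/= => /andP[t0 t1]; apply: dF.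
  by rewrite !ltW.
- apply: continuous_in_subspaceT => t; rewrite inE/= in_itv/= => t01.
  case: (dF _ t01) => dps _; apply: differentiable_continuous.
  exact/derivable1_diffP.
- rewrite /l/= mul0r scale1r scale0r addr0 (addrC a) subrK => /eqP.
  by rewrite subr_eq0 => /eqP.
Qed.

(** Left-invariant fields span every tangent space, so all derivatives in charts vanish and [f] is
    locally constant; its level sets are then open and closed. *)
Lemma zero_lfield_cst (G : lieGroup R) (V : vectType R) (L : lieAlgebra G V)
    (f : G -> R) : connected [set: G] -> smooth f ->
  (forall x X, ltan L X (fun y => f (gmul x y)) = 0) -> forall x y, f x = f y.
Proof.
move=> cG sf Df.
have loc x : exists2 O : set G, open_nbhs x O & forall y, O y -> f y = f x.
  have [_ /(_ x)[c Ac dx] _] := atlasP G.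
  have hc := atlas_chart (atlasP G) Ac; have [od oi fK _ _] := hc.
  have : nbhs (cto c x) (cimg c) by apply: open_nbhs_nbhs; split => //; exists x.
  move=> /nbhs_ballP[rho /= rho0 Ba].
  exists (cdom c `&` cto c @^-1` ball (cto c x) rho).
    split; last by split => //; exact: ballxx.
    by apply: open_cto_pre => //; exact: ball_open.
  move=> y [dy By].
  have [df _] := sf _ Ac 1%N.
  have := @zero_derive_locally_cst _ (cimg c) (f \o cfrom c) (cto c x) rho
    (cto c y) Ba df _ By.
  rewrite /= !fK//; apply=> w d iw.
  (* A derivative in a chart is a tangent vector at that point, hence the left translate of an
     element of the Lie algebra. *)
  by rewrite (ltransE L (tangent_derive d Ac iw) sf) Df.
have op (P : R -> Prop) : open [set x | P (f x)].
  rewrite openE => x /= Px; have [ O [oO Ox] fO] := loc x.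
  by apply: (filterS _ (open_nbhs_nbhs (conj oO Ox))) => y /fO /= ->.
move=> x y.
have H : [set z | f z = f y] = [set: G].
  apply: cG.
  - by exists y.
  - by exists [set z | f z = f y]; [exact: (op (fun r => r = f y))|rewrite setTI].
  - exists [set z | f z = f y]; last by rewrite setTI.
    rewrite -[X in closed X]setCK; apply: open_closedC.
    exact: (op (fun r => r <> f y)).
have : [set z | f z = f y] x by rewrite H.
by [].
Qed.

End LocalConstancy.

(** * Smooth dependence of pointwise chosen vectors *)

Section SmoothRepresentative.
Context {R : realType}.

Lemma smooth_det (M : smoothManifold R) n (A : M -> 'M[R]_n) :
  (forall i j, smooth (fun m => A m i j)) -> smooth (fun m => \det (A m)).
Proof.
move=> sA; apply: smooth_sum => s _; apply: smoothZ.
have H : smooth_in (atlas M) setT (fun m => \prod_i A m i (s i)).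
  have sA' i : predT i -> smooth_in (atlas M) setT (fun m => A m i (s i)).
    by move=> _; exact/smooth_funP/sA.
  exact: (smooth_in_prod (atlasP M) (index_enum 'I_n) openT sA').
exact/smooth_funP.
Qed.

Lemma smooth_continuous (M : smoothManifold R) (f : M -> R) :
  smooth f -> continuous f.
Proof.
move=> sf x; have [_ /(_ x)[c Ac dx] _] := atlasP M.
have hc := atlas_chart (atlasP M) Ac; have [od oi fK ct _] := hc.
have cc : {for x, continuous (fun y => (f \o cfrom c) (cto c y))}.
  apply: (@continuous_comp _ _ _ (cto c) (f \o cfrom c)); first exact: ct.
  by apply: (sf _ Ac 0%N); exists x.
have nE : \near x, f x = (f \o cfrom c) (cto c x).
  have nd : nbhs x (cdom c) by exact: open_nbhs_nbhs.
  by apply: filterS nd => y dy /=; rewrite fK.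
rewrite /continuous_at (nbhs_singleton nE).
apply: cvg_trans cc; apply: near_eq_cvg.
by apply: filterS nE => y /= ->.
Qed.

(* The coordinates of the representative solve a linear system with smooth
   coefficients, invertible near a given point (Cramer's rule). *)
Lemma smooth_ltrans (M : smoothManifold R) (H : lieGroup R) (V : vectType R)
    (L : lieAlgebra H V) (Gam : M -> H) (D : (M -> R) -> M -> R) :
  smooth_map (atlas M) (atlas H) Gam ->
  (forall m, is_tangent m (fun f => D f m)) ->
  (forall f, smooth f -> smooth (D f)) ->
  vsmooth (fun m => ltrans L (Gam m) (fun k => D (fun m' => k (Gam m')) m)).
Proof.
move=> sG tD sD; set pi := fun m => _.
have piE m k : smooth k -> D (fun m' => k (Gam m')) m =
    ltan L (pi m) (fun y => k (gmul (Gam m) y)).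
  by move=> sk; exact: (ltransE L (tangent_push sG (tD m)) sk).
suff sc i0 : smooth (fun m => cfun V i0 (pi m)).
  move=> phi.
  have -> : (fun x => phi (pi x)) = (fun x => \sum_(i < \dim (@fullv R V))
      phi (vbasis (@fullv R V))`_i * cfun V i (pi x)).
    apply/funext => x; rewrite [in LHS](vbasis_expand (pi x)) linear_sum.
    by apply: eq_bigr => j _; rewrite linearZ/= mulrC.
  by apply: smooth_sum => j _; exact: smoothZ.
apply/smooth_funP/smooth_in_local => m0 _.
pose d := \dim (@fullv R V); pose b := vbasis (@fullv R V).
have [h hP] := choice (fun j => 
  let: ex_intro2 h sh hE := de_surj L (cfun V j) in
  ex_intro (fun h => smooth h /\ de L h = cfun V j) h (conj sh hE)).
(* Functions with the coordinate covectors as differentials, translated to [Gam m0] so that the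
   matrix of the system is the identity at [m0]. *)
pose K j z := h j (gmul (ginv (Gam m0)) z).
have sK j : smooth (K j) by apply: smooth_lmul; case: (hP j).
pose A m : 'M[R]_d := \matrix_(j, i) ltan L b`_i (fun y => K j (gmul (Gam m) y)).
have sA i j : smooth (fun m => A m i j).
  under eq_fun do rewrite mxE.
  exact: (smooth_comp sG (smooth_lfield L _ (sK _))).
have A0 : A m0 = 1%:M.
  apply/matrixP => j i; rewrite !mxE /K.
  under eq_fun do rewrite gmulKl.
  have [sh hE] := hP j; rewrite -(deE L _ sh) hE cfunE.
  rewrite (coord_free _ _ (basis_free (vbasisP (@fullv R V)))).
  by rewrite eq_sym.
pose O := [set m | \det (A m) != 0].
have oO : open O.
  apply: (@open_comp _ _ (fun m => \det (A m)) [set r : R | r != 0]).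
    by move=> m _; apply: smooth_continuous; exact: smooth_det.
  exact: open_neq.
exists O; first by rewrite /O/= A0 det1 oner_neq0.
pose dd m : 'cV[R]_d := \col_j D (fun m' => K j (Gam m')) m.
have E m : O m -> (\sum_j \adj (A m) i0 j * dd m j 0) * (\det (A m))^-1 =
    cfun V i0 (pi m).
  move=> Om; pose c : 'cV[R]_d := \col_i cfun V i (pi m).
  have dE : dd m = A m *m c.
    apply/matrixP => j j'; rewrite !mxE piE//.
    have sKm := smooth_lmul (Gam m) (sK j).
    rewrite -(deE L (pi m) sKm).
    rewrite [in LHS](vbasis_expand (pi m)) linear_sum; apply: eq_bigr => i' _.
    rewrite linearZ/= (deE L _ sKm) mulrC; congr (_ * _).
      by rewrite [RHS]mxE.
    by rewrite [RHS]mxE.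
  have : \adj (A m) *m dd m = \det (A m) *: c.
    by rewrite dE mulmxA mul_adj_mx mul_scalar_mx.
  move=> /matrixP/(_ i0 0); rewrite [LHS]mxE [RHS]mxE => ->.
  rewrite mxE.
  by rewrite mulrC mulKf.
apply: (smooth_in_eq (atlasP M) oO E).
apply: (smooth_inM (atlasP M) oO).
  apply: (@smooth_inS _ _ _ _ _ setT) => //; apply/smooth_funP.
  apply: smooth_sum => j _; apply: smoothM.
    under eq_fun do rewrite mxE; apply: smoothZ; apply: smooth_det => i' j'.
    by under eq_fun do rewrite !mxE; exact: (smooth_comp sG (smooth_lfield L _ (sK _))).
  under eq_fun do rewrite mxE.
  by apply: sD; exact: smooth_comp.
apply: (smooth_inV (atlasP M) oO) => //.
apply: (@smooth_inS _ _ _ _ _ setT) => //; apply/smooth_funP.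
exact: smooth_det.
Qed.

End SmoothRepresentative.

(** * The bracket of a map with values in a group *)

Section Gradient.
Context {R : realType} (H : lieGroup R) (g : vectType R).
Variable L : lieAlgebra H (dualv g).

Definition eval_at (e : g) : dualv (dualv g) := linfun (fun l : dualv g => l e : R^o).

Lemma eval_atE e (l : dualv g) : eval_at e l = l e.
Proof.
have lin_e : linear (fun h : dualv g => h e : R^o).
  by move=> a h h'; rewrite !lfunE/= lfunE.
pose eM := GRing.isLinear.Build _ _ _ _ _ lin_e.
pose eL : {linear dualv g -> R^o} := HB.pack (fun h : dualv g => h e : R^o) eM.
by rewrite /eval_at -[X in linfun X]/(eL : dualv g -> R^o) lfunE.
Qed.

(** Reflexivity of the finite-dimensional space [g], made explicit in a basis. *)
Definition undual (Phi : dualv (dualv g)) : g :=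
  \sum_(i < \dim (@fullv R g)) Phi (cfun g i) *: (vbasis (@fullv R g))`_i.

Lemma undualE Phi (l : dualv g) : l (undual Phi) = Phi l.
Proof.
have E : l = \sum_(i < \dim (@fullv R g)) l (vbasis (@fullv R g))`_i *: cfun g i.
  apply/lfunP => u; rewrite [in LHS](vbasis_expand u) linear_sum sum_lfunE.
  by apply: eq_bigr => i _; rewrite linearZ/= scale_lfunE; exact: mulrC.
rewrite [in RHS]E /undual !linear_sum; apply: eq_bigr => i _.
by rewrite !linearZ/=; exact: mulrC.
Qed.

Lemma dualv_eq (e e' : g) : (forall l : dualv g, l e = l e') -> e = e'.
Proof.
move=> E; rewrite (vbasis_expand e) (vbasis_expand e').
by apply: eq_bigr => i _; rewrite E.
Qed.

(** The left-trivialised differential of [k]. The Lie algebra of [H] being [dualv g], it is a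
    functional on [dualv g], that is, an element of [g]. *)
Definition grad (k : H -> R) (x : H) : g := undual (de L (fun y => k (gmul x y))).

Lemma gradE k x (l : dualv g) : smooth k -> l (grad k x) = ltan L l (fun y => k (gmul x y)).
Proof. by move=> sk; rewrite undualE deE//; exact: smooth_lmul. Qed.

Lemma grad_surj (e : g) x : exists2 k, smooth k & grad k x = e.
Proof.
have [h sh hE] := de_surj L (eval_at e).
exists (fun y => h (gmul (ginv x) y)); first exact: smooth_lmul.
apply: dualv_eq => l; rewrite gradE; last exact: smooth_lmul.
by under eq_fun do rewrite gmulKl; rewrite -deE// hE eval_atE.
Qed.

Lemma vsmooth_grad (M : smoothManifold R) (F : M -> H) k :
  smooth_map (atlas M) (atlas H) F -> smooth k -> vsmooth (fun m => grad k (F m)).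
Proof.
move=> sF sk l; under eq_fun do rewrite gradE//.
exact: (smooth_comp sF (smooth_lfield L l sk)).
Qed.

End Gradient.

Section MomentCalculus.
Context {R : realType} (M : poissonManifold R) (H : lieGroup R) (g : vectType R).
Variables (L : lieAlgebra H (dualv g)) (Gam : M -> H).
Hypothesis sG : smooth_map (atlas M) (atlas H) Gam.
Implicit Types (f : M -> R) (m : M) (e : g).

Local Notation pb := (@pbr R M).

Lemma pbr_smooth f f' : smooth f -> smooth f' -> smooth (pb f f').
Proof. by case: (pbrP M) => + _ _ _ _; exact. Qed.

Lemma pbrC f f' m : smooth f -> smooth f' -> pb f f' m = - pb f' f m.
Proof. by case: (pbrP M) => _ _ C _ _ sf sf'; rewrite (C f f'). Qed.

Lemma pbr_tangent f m : smooth f -> is_tangent m (fun f' => pb f' f m).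
Proof.
case: (pbrP M) => _ D _ Lb _ sf; split=> [a f1 f2 s1 s2|f1 f2 s1 s2].
  by rewrite D.
by rewrite Lb.
Qed.

Lemma pbr_tangentr f m : smooth f -> is_tangent m (fun f' => pb f f' m).
Proof.
move=> sf; have [D Lb] := pbr_tangent m sf.
split=> [a f1 f2 s1 s2|f1 f2 s1 s2].
  rewrite pbrC//; last by apply: smoothD => //; exact: smoothZ.
  by rewrite D// (pbrC _ sf s1) (pbrC _ sf s2); ring.
rewrite pbrC//; last exact: smoothM.
by rewrite Lb// (pbrC _ sf s1) (pbrC _ sf s2); ring.
Qed.

Definition xi f m : dualv g := left_log_bracket L Gam f m.

Lemma deltaE e f m : delta L Gam e f m = - xi f m e.
Proof. by []. Qed.

Lemma xi_grad f k m : smooth f -> smooth k ->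
  pb (fun m' => k (Gam m')) f m = xi f m (grad L k (Gam m)).
Proof.
move=> sf sk; rewrite gradE//.
exact: (ltransE L (tangent_push sG (pbr_tangent m sf)) sk).
Qed.

Lemma vsmooth_xi f : smooth f -> vsmooth (xi f).
Proof.
move=> sf; apply: (smooth_ltrans L sG (D := fun f' => pb f' f)).
  by move=> m; exact: pbr_tangent.
by move=> f' sf'; exact: pbr_smooth.
Qed.

Lemma delta_smooth e f : smooth f -> smooth (delta L Gam e f).
Proof. by move=> sf; apply: smoothN; exact: vsmooth_eval (vsmooth_xi sf). Qed.

Lemma delta_pbr e k f m : smooth f -> smooth k -> grad L k (Gam m) = e ->
  delta L Gam e f m = - pb (fun m' => k (Gam m')) f m.
Proof. by move=> sf sk <-; rewrite deltaE xi_grad. Qed.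

(** [delta] is built from a chosen vector and not visibly a derivation in [f]. With [k] of gradient
    [e] at [Gam m] it becomes minus the bracket with [k \o Gam] at [m]. *)
Lemma delta_tangent e m : is_tangent m (fun f => delta L Gam e f m).
Proof.
have [k sk kE] := grad_surj L e (Gam m).
have sk' : smooth (fun m' => k (Gam m')) by exact: smooth_comp.
have [D Lb] := pbr_tangentr m sk'.
split=> [a f1 f2 s1 s2|f1 f2 s1 s2].
  rewrite !(delta_pbr _ sk kE)//; last by apply: smoothD => //; exact: smoothZ.
  by rewrite D//; ring.
rewrite !(delta_pbr _ sk kE)//; last exact: smoothM.
by rewrite Lb//; ring.
Qed.

(* The contraction with [e] of the left-trivialised bracket of [Gam] with
   itself; the sign is that of [delta]. *)
Definition bivec e m : dualv g :=
  - ltrans L (Gam m) (fun k => delta L Gam e (fun m' => k (Gam m')) m).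

Lemma delta_grad e k m : smooth k ->
  delta L Gam e (fun m' => k (Gam m')) m = - bivec e m (grad L k (Gam m)).
Proof.
move=> sk; rewrite /bivec opp_lfunE opprK gradE//.
exact: (ltransE L (tangent_push sG (delta_tangent e m)) sk).
Qed.

Lemma vsmooth_bivec e : vsmooth (bivec e).
Proof.
have := smooth_ltrans L sG (D := delta L Gam e) (delta_tangent e) (@delta_smooth e).
move=> sP phi; under eq_fun do rewrite linearN/=.
exact/smoothN/sP.
Qed.

Lemma pbr_grad h k m : smooth h -> smooth k ->
  pb (fun m' => h (Gam m')) (fun m' => k (Gam m')) m =
  bivec (grad L h (Gam m)) m (grad L k (Gam m)).
Proof.
move=> sh sk; rewrite xi_grad//; last exact: smooth_comp.
by apply: oppr_inj; rewrite -deltaE delta_grad.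
Qed.

(** All gradients occur, so skew-symmetry of the Poisson bracket passes to the bivector; linearity
    in the first argument follows from it. *)
Lemma bivecC e e' m : bivec e m e' = - bivec e' m e.
Proof.
have [h sh <-] := grad_surj L e (Gam m); have [k sk <-] := grad_surj L e' (Gam m).
by rewrite -!pbr_grad// pbrC//; exact: smooth_comp.
Qed.

Lemma bivec_linear a e1 e2 m e' : bivec (a *: e1 + e2) m e' = a * bivec e1 m e' + bivec e2 m e'.
Proof.
by rewrite bivecC linearP/= (bivecC e1) (bivecC e2) /GRing.scale/= opprD mulrN.
Qed.

(** The inner bracket is the pairing of [xi f] with the gradient of [k], both varying with the
    point. Differentiating the former gives the iterated [delta], differentiating the latter a
    second derivative of [k] along left-invariant fields. *)
Lemma double_pbr h k f m : smooth h -> smooth k -> smooth f ->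
  pb (fun m' => h (Gam m')) (pb (fun m' => k (Gam m')) f) m =
  delta L Gam (grad L h (Gam m)) (delta L Gam (grad L k (Gam m)) f) m
  + ltan L (bivec (grad L h (Gam m)) m) (fun y => ltan L (xi f m)
      (fun z => k (gmul (gmul (Gam m) y) z))).
Proof.
move=> sh sk sf; set e := grad L h _; set e' := grad L k _.
have skf : smooth (pb (fun m' => k (Gam m')) f).
  by apply: pbr_smooth => //; exact: smooth_comp.
rewrite -[LHS]opprK -(delta_pbr skf sh (erefl (grad L h (Gam m)))) -/e.
have tv := delta_tangent e m.
have -> : pb (fun m' => k (Gam m')) f = (fun m' => xi f m' (grad L k (Gam m'))).
  by apply/funext => m'; rewrite xi_grad.
have sx := vsmooth_xi sf.
have sgk := vsmooth_grad L sG sk.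
have := @tangent_bil _ _ _ _ tv _ _ (fun _ (l : dualv g) (u : g) => l u) (xi f)
  (fun m' => grad L k (Gam m')).
move=> -> //; first last.
- by move=> u w; exact: smooth_cst.
- by move=> x a u w w'; rewrite linearP.
- by move=> x a u u' w; rewrite !lfunE/= lfunE.
rewrite (tangent_cst tv) add0r (vderE tv)//.
rewrite -eval_atE (vderE tv)// -/e'.
under eq_fun do rewrite eval_atE.
have -> : (fun x => xi f x e') = (fun x => - delta L Gam e' f x).
  by apply/funext => x; rewrite deltaE opprK.
rewrite (tangentN tv); last exact: delta_smooth.
rewrite opprD opprK; congr (_ + _).
under eq_fun do rewrite gradE//.
rewrite [X in - X](delta_grad e m (smooth_lfield L (xi f m) sk)) opprK.
by rewrite gradE//; exact: smooth_lfield.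
Qed.

(** Prescribed gradients do not fix the second derivatives of [h] and [k]. In the Jacobi identity
    these occur only as commutators of left-invariant fields, which depend on the gradients alone
    and give the [lbr] terms. *)
Lemma delta_bracket e e' f m : smooth f ->
  delta L Gam e (delta L Gam e' f) m - delta L Gam e' (delta L Gam e f) m =
  pb (fun m' => bivec e m' e') f m
  + lbr L (xi f m) (bivec e m) e' - lbr L (xi f m) (bivec e' m) e.
Proof.
move=> sf.
have [h sh hE] := grad_surj L e (Gam m); have [k sk kE] := grad_surj L e' (Gam m).
have shG : smooth (fun m' => h (Gam m')) by exact: smooth_comp.
have skG : smooth (fun m' => k (Gam m')) by exact: smooth_comp.
have Ehk := double_pbr m sh sk sf; have Ekh := double_pbr m sk sh sf.
rewrite hE kE in Ehk Ekh.
have tf := pbr_tangent m sf.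
(* Three variations: of the bivector with frozen arguments, and of each of the two gradients. *)
have Ebr : pb (pb (fun m' => h (Gam m')) (fun m' => k (Gam m'))) f m =
    pb (fun m' => bivec e m' e') f m
    - ltan L (xi f m) (fun y => ltan L (bivec e' m)
        (fun z => h (gmul (gmul (Gam m) y) z)))
    + ltan L (xi f m) (fun y => ltan L (bivec e m)
        (fun z => k (gmul (gmul (Gam m) y) z))).
  have -> : pb (fun m' => h (Gam m')) (fun m' => k (Gam m')) =
      (fun m' => bivec (grad L h (Gam m')) m' (grad L k (Gam m'))).
    by apply/funext => m'; rewrite pbr_grad.
  have := @tangent_bil _ _ _ _ tf _ _ (fun m' (u w : g) => bivec u m' w)
    (fun m' => grad L h (Gam m')) (fun m' => grad L k (Gam m')).
  move=> -> //; first last.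
  - exact: (vsmooth_grad L sG).
  - exact: (vsmooth_grad L sG).
  - by move=> u w; exact: vsmooth_eval (vsmooth_bivec u).
  - by move=> x a u w w'; rewrite linearP.
  - by move=> x a u u' w; rewrite bivec_linear.
  rewrite hE kE; congr (_ + _ + _).
    rewrite bivecC (vderE tf); last exact: (vsmooth_grad L sG).
    under eq_fun do rewrite gradE//.
    rewrite (xi_grad m sf (smooth_lfield L (bivec e' m) sh)).
    by rewrite gradE//; exact: smooth_lfield.
  rewrite (vderE tf); last exact: (vsmooth_grad L sG).
  under eq_fun do rewrite gradE//.
  rewrite (xi_grad m sf (smooth_lfield L (bivec e m) sk)).
  by rewrite gradE//; exact: smooth_lfield.
have [_ _ _ _ /(_ _ _ _ shG skG sf m)] := pbrP M.
rewrite (pbrC _ sf); last exact: pbr_smooth.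
have -> : pb f (fun m' => h (Gam m')) = (fun m' => - pb (fun m' => h (Gam m')) f m').
  by apply/funext => m'; rewrite pbrC.
rewrite (tangentN (pbr_tangentr m skG)); last exact: pbr_smooth.
rewrite Ehk Ekh Ebr.
have lb l l' k' e1 : smooth k' -> grad L k' (Gam m) = e1 -> lbr L l l' e1 =
    ltan L l (fun y => ltan L l' (fun z => k' (gmul (gmul (Gam m) y) z))) -
    ltan L l' (fun y => ltan L l (fun z => k' (gmul (gmul (Gam m) y) z))).
  by move=> sk' <-; rewrite gradE// lbr_lfield.
rewrite (lb _ _ k e' sk kE) (lb _ _ h e sh hE) => J.
apply/eqP; rewrite -subr_eq0 -{}J; apply/eqP; ring.
Qed.

End MomentCalculus.

(** * The double *)

Section DoubleForm.
Context {R : realType} {g : vectType R}.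
Implicit Types (x y z : drinfeld g) (l m : dualv g) (X Y : g).

Lemma dform_linl a x x' y : dform (a *: x + x') y = a * dform x y + dform x' y.
Proof.
rewrite /dform /= linearP/= !lfunE/= lfunE/= /GRing.scale/=; ring.
Qed.

Lemma dformC x y : dform x y = dform y x.
Proof. by rewrite /dform addrC. Qed.

Lemma dform_linr a x y y' : dform x (a *: y + y') = a * dform x y + dform x y'.
Proof. by rewrite dformC dform_linl !(dformC x). Qed.

Lemma dformNl x y : dform (- x) y = - dform x y.
Proof.
have := dform_linl (-1) x x y; rewrite scaleN1r addNr mulN1r addNr => z0.
have := dform_linl (-1) x 0 y; rewrite scaleN1r addr0 mulN1r => ->.
have := dform_linl (-1) 0 0 y; rewrite scaler0 addr0 mulN1r addNr => ->.
by rewrite addr0.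
Qed.

Lemma dformNr x y : dform x (- y) = - dform x y.
Proof. by rewrite dformC dformNl dformC. Qed.

Lemma dformDl x x' y : dform (x + x') y = dform x y + dform x' y.
Proof. by rewrite -[x in x + _]scale1r dform_linl mul1r. Qed.

Lemma dform_iotas x l : dform x (iotas l) = l x.1.
Proof. by rewrite /dform/= linear0 addr0. Qed.

Lemma dform_iota x X : dform x (Defs.iota X) = x.2 X.
Proof. by rewrite /dform/= lfunE/= add0r. Qed.

Lemma drinfeldE x : x = Defs.iota x.1 + iotas x.2.
Proof. by case: x => X l; congr pair; rewrite /= ?addr0 ?add0r. Qed.

End DoubleForm.

Section DoubleAd.
Context {R : realType} {g : vectType R} {G Gs DG : lieGroup R}.
Variables (Lg : lieAlgebra G g) (Ls : lieAlgebra Gs (dualv g)).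
Variable LD : lieAlgebra DG (drinfeld g).
Hypothesis hLD : is_double_bracket (lbr Lg) (lbr Ls) (lbr LD).
Variable iS : Gs -> DG.
Hypothesis hiS : lifts Ls LD (@iotas R g) iS.
Hypothesis cGs : connected [set: Gs].
Implicit Types (x y c : Gs) (l m : dualv g) (X Y e : g) (z : drinfeld g).

Let sS : smooth_map (atlas Gs) (atlas DG) iS. Proof. by case: hiS => -[]. Qed.

Lemma iSM x y : iS (gmul x y) = gmul (iS x) (iS y).
Proof. by case: hiS => -[_ +] _; exact. Qed.

Lemma iS1 : iS (gone Gs) = gone DG.
Proof.
have := iSM (gone Gs) (gone Gs); rewrite gmul1 => E.
by rewrite -(gmulKl (iS (gone Gs)) (iS (gone Gs))) -E gmulV.
Qed.

Lemma iSV x : iS (ginv x) = ginv (iS x).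
Proof. by rewrite -(gmulKl (iS x) (iS (ginv x))) -iSM gmulVr iS1 gmul1r. Qed.

Lemma lift_ltan l k : smooth k -> ltan Ls l (fun x => k (iS x)) = ltan LD (iotas l) k.
Proof. by case: hiS => _ H sk; exact: H. Qed.

(** The inverse turns [c |-> AdV c] into a right action, so that a left-invariant derivative at [c]
    acts on the outermost factor. *)
Definition AdV c z := Ad LD (ginv (iS c)) z.

Lemma de_exists (phi : dualv (drinfeld g)) : exists k, smooth k /\ phi = de LD k.
Proof. by have [k sk <-] := de_surj LD phi; exists k. Qed.

Lemma AdV_dual k c z : smooth k ->
  de LD k (AdV c z) = ltan LD z (fun w => k (gmul (gmul (ginv (iS c)) w) (iS c))).
Proof.
move=> sk; rewrite deE// AdP//.
by congr (ltan _ _ _); apply/funext => w; rewrite ginvK.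
Qed.

Lemma vsmooth_AdV z : vsmooth (fun c => AdV c z).
Proof.
move=> phi; have [k [sk ->]] := de_exists phi.
under eq_fun do rewrite AdV_dual//.
apply: (@tangent_smooth _ Gs DG (gone DG) (ltan LD z)
  (fun u => k (gmul (gmul (ginv (iS u.1)) u.2) (iS u.1)))).
  exact: ltan_tangent.
have hA := prodP Gs DG.
have s1 := smooth_map_comp hA (atlasP Gs) (atlasP DG)
  (smooth_map_fst (atlasP Gs) (atlasP DG)) sS.
have s2 := smooth_map_snd (atlasP Gs) (atlasP DG).
apply: (smooth_fun_comp hA (atlasP DG)) sk.
apply: (smooth_gmul hA _ s1); apply: (smooth_gmul hA _ s2).
exact: (smooth_ginv hA s1).
Qed.

Lemma AdV_mul c x z : AdV (gmul c x) z = AdV x (AdV c z).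
Proof. by rewrite /AdV iSM ginvM AdM. Qed.

Lemma AdV_derive (phi : dualv (drinfeld g)) l c z :
  ltan Ls l (fun x => phi (AdV (gmul c x) z)) = phi (lbr LD (AdV c z) (iotas l)).
Proof.
have [k [sk ->]] := de_exists phi.
under eq_fun do rewrite AdV_mul AdV_dual//.
rewrite deE// -(ltan_conj_bracket LD (iotas l) (AdV c z) sk).
set q := fun y : DG => ltan LD (AdV c z) (fun w => k (gmul (gmul (ginv y) w) y)).
rewrite -[RHS]/(ltan LD (iotas l) q) -lift_ltan//.
apply: (@tangent_smooth _ DG DG (gone DG) (ltan LD (AdV c z))
  (fun u => k (gmul (gmul (ginv u.1) u.2) u.1))).
  exact: ltan_tangent.
have hA := prodP DG DG.
have s1 := smooth_map_fst (atlasP DG) (atlasP DG).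
have s2 := smooth_map_snd (atlasP DG) (atlasP DG).
apply: (smooth_fun_comp hA (atlasP DG)) sk.
apply: (smooth_gmul hA _ s1); apply: (smooth_gmul hA _ s2).
exact: (smooth_ginv hA s1).
Qed.

Lemma vder_AdV l c z :
  vder (fun k => ltan Ls l (fun x => k (gmul c x))) (fun x => AdV x z) =
  lbr LD (AdV c z) (iotas l).
Proof.
apply: (dual_eq LD) => phi.
rewrite (vderE (tangent_lmul Ls c l) _ (vsmooth_AdV z)).
exact: AdV_derive.
Qed.

Lemma dform_inv z (x y : drinfeld g) : dform (lbr LD z x) y = - dform x (lbr LD z y).
Proof. by case: hLD => _ _ /(_ x y z)/eqP; rewrite addr_eq0 => /eqP. Qed.

Lemma dform_inv_iotas z z' l :
  dform (lbr LD z (iotas l)) z' = dform z (lbr LD (iotas l) z').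
Proof. by rewrite lbrC dformNl dform_inv opprK. Qed.

(* Invariance of the form integrates from the Lie algebra to the connected
   group: the left-invariant derivatives of the pairing vanish. *)
Lemma dform_AdV c z z' : dform (AdV c z) (AdV c z') = dform z z'.
Proof.
pose f c := dform (AdV c z) (AdV c z').
suff -> : dform (AdV c z) (AdV c z') = f (gone Gs).
  by rewrite /f /AdV iS1 ginv1 !Ad1.
have bl1 (x : Gs) (a : R) (u u' w : drinfeld g) : dform (a *: u + u') w = a * dform u w + dform u' w
  by exact: dform_linl.
have bl2 (x : Gs) (a : R) (u w w' : drinfeld g) : dform u (a *: w + w') = a * dform u w + dform u w'
  by exact: dform_linr.
have cs (u w : drinfeld g) : smooth (fun x : Gs => dform u w) by exact: smooth_cst.
have sf : smooth f := smooth_bil bl1 bl2 cs (vsmooth_AdV z) (vsmooth_AdV z').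
have Df x l : ltan Ls l (fun y => f (gmul x y)) = 0.
  have tv := tangent_lmul Ls x l.
  have := tangent_bil tv bl1 bl2 cs (vsmooth_AdV z) (vsmooth_AdV z').
  rewrite (tangent_cst tv) add0r !vder_AdV dform_inv_iotas => ->.
  by rewrite (lbrC _ (AdV x z') _) dformNr addrN.
exact: (zero_lfield_cst cGs sf Df).
Qed.

Lemma Ad_iotas c l : Ad LD (iS c) (iotas l) = iotas (Ad Ls c l).
Proof.
apply: (ltan_eq (L := LD)) => k sk; rewrite AdP//.
rewrite -lift_ltan; last exact: smooth_conj.
rewrite -lift_ltan// AdP; last exact: smooth_comp.
by congr (ltan _ _ _); apply/funext => x; rewrite !iSM iSV.
Qed.

Lemma AdV_iotas c l : AdV c (iotas l) = iotas (Ad Ls (ginv c) l).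
Proof. by rewrite /AdV -iSV Ad_iotas. Qed.

Lemma AdV_add c z z' : AdV c (z + z') = AdV c z + AdV c z'.
Proof. exact: linearD. Qed.

(** The [p] of the overview. By invariance of the form it is the transpose of [Ad Ls c]: the
    coadjoint action of the dual group, as a right action on [g]. *)
Definition coadj c e : g := (AdV c (Defs.iota e)).1.
Definition cocyc c e : dualv g := (AdV c (Defs.iota e)).2.

Lemma AdV_fst c z : (AdV c z).1 = coadj c z.1.
Proof.
by rewrite [in LHS](drinfeldE z) AdV_add/= AdV_iotas /= addr0.
Qed.

Lemma coadj_linear c a e e' : coadj c (a *: e + e') = a *: coadj c e + coadj c e'.
Proof.
rewrite /coadj -[Defs.iota (a *: e + e')](_ : a *: Defs.iota e + Defs.iota e' = _).
  by rewrite /AdV linearP.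
by congr pair; rewrite /= scaler0 addr0.
Qed.

Lemma cocyc_linear c a e e' : cocyc c (a *: e + e') = a *: cocyc c e + cocyc c e'.
Proof.
rewrite /cocyc -[Defs.iota (a *: e + e')](_ : a *: Defs.iota e + Defs.iota e' = _).
  by rewrite /AdV linearP.
by congr pair; rewrite /= scaler0 addr0.
Qed.

(** An explicit preimage, needed to replace the arguments [p e] and [p e'] of the centrality formula
    by arbitrary ones. *)
Lemma coadj_surj c X : coadj c (Ad LD (iS c) (Defs.iota X)).1 = X.
Proof. by rewrite -AdV_fst /AdV AdK. Qed.

Lemma vsmooth_coadj e : vsmooth (fun c => coadj c e).
Proof.
move=> l; have lin_f : linear (fun z : drinfeld g => l z.1 : R^o).
  by move=> a u v; rewrite /= linearP.
pose fM := GRing.isLinear.Build _ _ _ _ _ lin_f.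
pose fL : {linear drinfeld g -> R^o} := HB.pack (fun z : drinfeld g => l z.1 : R^o) fM.
have := vsmooth_AdV (Defs.iota e) (linfun fL).
by under eq_fun do rewrite lfunE/=.
Qed.

Lemma cocyc_smooth e Y : smooth (fun c => cocyc c e Y).
Proof.
have lin_f : linear (fun z : drinfeld g => z.2 Y : R^o).
  by move=> a u v; rewrite /= !lfunE/= lfunE.
pose fM := GRing.isLinear.Build _ _ _ _ _ lin_f.
pose fL : {linear drinfeld g -> R^o} := HB.pack (fun z : drinfeld g => z.2 Y : R^o) fM.
have := vsmooth_AdV (Defs.iota e) (linfun fL).
by under eq_fun do rewrite lfunE/=.
Qed.

(** Invariance moves [iotas l] to the other side of the pairing, where it is bracketed with
    [iotas m] inside the image of [iotas]. *)
Lemma coadj_derive l m c e :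
  ltan Ls l (fun x => m (coadj (gmul c x) e)) = lbr Ls l m (coadj c e).
Proof.
have lin_f : linear (fun z : drinfeld g => m z.1 : R^o).
  by move=> a u v; rewrite /= linearP.
pose fM := GRing.isLinear.Build _ _ _ _ _ lin_f.
pose fL : {linear drinfeld g -> R^o} := HB.pack (fun z : drinfeld g => m z.1 : R^o) fM.
have := AdV_derive (linfun fL) l c (Defs.iota e).
under eq_fun do rewrite lfunE/=.
rewrite lfunE/= -dform_iotas => ->.
rewrite dform_inv_iotas; case: hLD => _ -> _.
by rewrite dform_iotas.
Qed.

(** After pairing with [iota Y], the [g] component of [AdV c (iota e)] produces the bracket of [g]
    and its dual component the bracket of the dual Lie algebra. *)
Lemma cocyc_derive l c e Y :
  ltan Ls l (fun x => cocyc (gmul c x) e Y) = l (lbr Lg Y (coadj c e)) - lbr Ls l (cocyc c e) Y.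
Proof.
have lin_f : linear (fun z : drinfeld g => z.2 Y : R^o).
  by move=> a u v; rewrite /= !lfunE/= lfunE.
pose fM := GRing.isLinear.Build _ _ _ _ _ lin_f.
pose fL : {linear drinfeld g -> R^o} := HB.pack (fun z : drinfeld g => z.2 Y : R^o) fM.
have := AdV_derive (linfun fL) l c (Defs.iota e).
under eq_fun do rewrite lfunE/=.
rewrite lfunE/= -dform_iota => ->.
rewrite dform_inv_iotas [X in dform X _]drinfeldE dformDl -/(coadj c e) -/(cocyc c e).
congr (_ + _).
  rewrite lbrC dformNr -dform_inv.
  by case: hLD => -> _ _; rewrite dform_iotas.
apply: oppr_inj; rewrite opprK -dform_inv.
by case: hLD => _ -> _; rewrite dform_iota.
Qed.

(* The value on [(iota e, iota e')] of [-1/2 (R - Ad_y R)], [y = iS c]. *)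
Definition rbeta c e e' : R := cocyc c e (coadj c e').

(** The image of [iota] is isotropic, and so is its image under [AdV c]. *)
Lemma rbetaC c e e' : rbeta c e e' = - rbeta c e' e.
Proof.
apply/eqP; rewrite -addr_eq0; apply/eqP.
have := dform_AdV c (Defs.iota e) (Defs.iota e'); rewrite /dform/= !lfunE/= addr0.
by rewrite addrC.
Qed.

Lemma vsmooth_cocyc e : vsmooth (fun c => cocyc c e).
Proof. by apply: vsmooth_dual => Y; exact: cocyc_smooth. Qed.

Let evbl1 (x : Gs) a (u u' : dualv g) (w : g) : (a *: u + u') w = a * u w + u' w.
Proof. by rewrite !lfunE/= lfunE. Qed.

Let evbl2 (x : Gs) a (u : dualv g) (w w' : g) : u (a *: w + w') = a * u w + u w'.
Proof. by rewrite linearP. Qed.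

Let evs (u : dualv g) (w : g) : smooth (fun x : Gs => u w).
Proof. exact: smooth_cst. Qed.

Lemma smooth_rbeta e e' : smooth (fun c => rbeta c e e').
Proof. exact: (smooth_bil evbl1 evbl2 evs (vsmooth_cocyc e) (vsmooth_coadj e')). Qed.

(** The variation of [coadj] cancels the dual bracket in the variation of [cocyc]; only the bracket
    of [g] is left. *)
Lemma rbeta_derive l c e e' :
  ltan Ls l (fun x => rbeta (gmul c x) e e') = l (lbr Lg (coadj c e') (coadj c e)).
Proof.
have tv := tangent_lmul Ls c l.
have := tangent_bil tv evbl1 evbl2 evs (vsmooth_cocyc e) (vsmooth_coadj e').
rewrite (tangent_cst tv) add0r => ->.
rewrite (vderE tv _ (vsmooth_coadj e')) coadj_derive.
rewrite -eval_atE (vderE tv _ (vsmooth_cocyc e)).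
under eq_fun do rewrite eval_atE.
by rewrite cocyc_derive subrK.
Qed.

Section OnM.
Context {M : poissonManifold R} (Gam : M -> Gs).
Hypothesis sG : smooth_map (atlas M) (atlas Gs) Gam.
Local Notation pb := (@pbr R M).
Local Notation dl := (delta Ls Gam).

Definition central_term e e' (u : M) : R :=
  bivec Ls Gam (coadj (Gam u) e) u (coadj (Gam u) e') - rbeta (Gam u) e e'.

Let vsp e : vsmooth (fun u => coadj (Gam u) e).
Proof. by move=> phi; exact: (smooth_comp sG (vsmooth_coadj e phi)). Qed.

Let Pis (u w : g) : smooth (fun x : M => bivec Ls Gam u x w).
Proof. exact: vsmooth_eval (vsmooth_bivec Ls sG u). Qed.

Let Pi1 (x : M) a (u u' w : g) :
  bivec Ls Gam (a *: u + u') x w = a * bivec Ls Gam u x w + bivec Ls Gam u' x w.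
Proof. exact: bivec_linear. Qed.

Let Pi2 (x : M) a (u w w' : g) :
  bivec Ls Gam u x (a *: w + w') = a * bivec Ls Gam u x w + bivec Ls Gam u x w'.
Proof. by rewrite linearP. Qed.

Let sPipp e e' : smooth (fun u => bivec Ls Gam (coadj (Gam u) e) u (coadj (Gam u) e')).
Proof. exact: (smooth_bil Pi1 Pi2 Pis (vsp e) (vsp e')). Qed.

Let sbeta e e' : smooth (fun u => rbeta (Gam u) e e').
Proof. exact: (smooth_comp sG (smooth_rbeta e e')). Qed.

Lemma smooth_central_term e e' : smooth (central_term e e').
Proof. exact: smoothB. Qed.

Lemma central_termC e e' u : central_term e e' u = - central_term e' e u.
Proof. by rewrite /central_term bivecC// rbetaC opprD. Qed.

Lemma central_term_linear a e1 e2 e' u : central_term (a *: e1 + e2) e' u = a * central_term e1 e' u + central_term e2 e' u.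
Proof.
rewrite /central_term coadj_linear Pi1 /rbeta cocyc_linear !lfunE/= lfunE/= /GRing.scale/=; ring.
Qed.

(** By [coadj_derive], the variation of the two arguments of [bivec] reproduces the correction terms
    of [delta_bracket], while [rbeta_derive] turns the variation of [rbeta] into [delta] of the
    bracket in [g]. *)
Lemma pbr_central_term e e' f u : smooth f -> pb (central_term e e') f u =
  dl (coadj (Gam u) e) (dl (coadj (Gam u) e') f) u - dl (coadj (Gam u) e') (dl (coadj (Gam u) e) f) u
  - dl (lbr Lg (coadj (Gam u) e) (coadj (Gam u) e')) f u.
Proof.
move=> sf; have tf := pbr_tangent u sf.
rewrite (delta_bracket Ls sG)// (tangentB tf)//; congr (_ - _); last first.
  have := xi_grad Ls sG u sf (smooth_rbeta e e'); rewrite gradE//; last exact: smooth_rbeta.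
  move=> ->; rewrite rbeta_derive deltaE lbrC linearN/=.
  by [].
have := tangent_bil tf Pi1 Pi2 Pis (vsp e) (vsp e') => ->.
have Evd e1 m : m (vder (fun f' => pb f' f u) (fun u => coadj (Gam u) e1)) =
    lbr Ls (xi Ls Gam f u) m (coadj (Gam u) e1).
  rewrite (vderE tf)//.
  have := xi_grad Ls sG u sf (vsmooth_coadj e1 m) => ->.
  rewrite gradE; last exact: vsmooth_coadj.
  exact: coadj_derive.
rewrite Evd bivecC// Evd; ring.
Qed.

End OnM.

End DoubleAd.

(** * Tensors on the double and the R-matrix *)

Section Tensors.
Context {R : realType}.
Implicit Types V W : vectType R.

Lemma tensE V W (x : V) (y : W) (p : dualv V) : tens x y p = p x *: y.
Proof.
have lin_f : linear (fun p : dualv V => (p x : R) *: y).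
  by move=> a p1 p2; rewrite !lfunE/= lfunE/= scalerDl scalerA.
pose fM := GRing.isLinear.Build _ _ _ _ _ lin_f.
pose fL : {linear dualv V -> W} := HB.pack (fun p : dualv V => (p x : R) *: y) fM.
by rewrite /tens -[X in linfun X]/(fL : dualv V -> W) lfunE.
Qed.

Lemma tens_mapE V (A : 'End(V)) (t : tensor V V) (p : dualv V) :
  tens_map A t p = A (t (p \o A)%VF).
Proof.
have lin_f : linear (fun p : dualv V => A (t (p \o A)%VF)).
  by move=> a p1 p2; rewrite comp_lfunDl -comp_lfunZl !linearP.
pose fM := GRing.isLinear.Build _ _ _ _ _ lin_f.
pose fL : {linear dualv V -> V} := HB.pack (fun p : dualv V => A (t (p \o A)%VF)) fM.
by rewrite /tens_map -[X in linfun X]/(fL : dualv V -> V) lfunE.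
Qed.

Context {g : vectType R}.

Definition dform_lin (a : drinfeld g) : dualv (drinfeld g) :=
  linfun (fun x => dform a x : R^o).

Lemma dform_linE a x : dform_lin a x = dform a x.
Proof.
have lin_f : linear (fun x => dform a x : R^o).
  by move=> c u v; rewrite dform_linr.
pose fM := GRing.isLinear.Build _ _ _ _ _ lin_f.
pose fL : {linear drinfeld g -> R^o} := HB.pack (fun x => dform a x : R^o) fM.
by rewrite /dform_lin -[X in linfun X]/(fL : drinfeld g -> R^o) lfunE.
Qed.

(** Nondegeneracy of the form: the restriction of [p] to each summand gives the component of [a] in
    the other. *)
Lemma dform_lin_surj (p : dualv (drinfeld g)) : exists a, p = dform_lin a.
Proof.
have lin1 : linear (fun l : dualv g => p (iotas l) : R^o).
  move=> c u v; rewrite -[iotas _](_ : c *: iotas u + iotas v = _) ?linearP//.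
  by congr pair; rewrite /= scaler0 addr0.
pose fM1 := GRing.isLinear.Build _ _ _ _ _ lin1.
pose f1 : {linear dualv g -> R^o} := HB.pack (fun l : dualv g => p (iotas l) : R^o) fM1.
have lin2 : linear (fun X : g => p (Defs.iota X) : R^o).
  move=> c u v.
  rewrite -[Defs.iota _](_ : c *: Defs.iota u + Defs.iota v = _) ?linearP//.
  by congr pair; rewrite /= scaler0 addr0.
pose fM2 := GRing.isLinear.Build _ _ _ _ _ lin2.
pose f2 : {linear g -> R^o} := HB.pack (fun X : g => p (Defs.iota X) : R^o) fM2.
exists (undual (linfun f1), linfun f2); apply/lfunP => x.
rewrite dform_linE -[RHS]/(x.2 (undual (linfun f1)) + linfun f2 x.1) undualE.
have -> : linfun f1 x.2 = p (iotas x.2) by rewrite lfunE.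
have -> : linfun f2 x.1 = p (Defs.iota x.1) by rewrite lfunE.
by rewrite {1}(drinfeldE x) linearD addrC.
Qed.

Variables (n : nat) (T : n.-tuple g) (Ts : n.-tuple (dualv g)).
Hypothesis hT : dual_bases T Ts.

Lemma dual_bases_coord i X : tnth Ts i X = coord T i X.
Proof.
case: hT => bT dT; rewrite {1}(coord_basis bT (memvf X)) linear_sum (bigD1 i)//=.
rewrite linearZ/= -tnth_nth dT eqxx [_ *: _]mulr1 big1 ?addr0// => j ji.
by rewrite linearZ/= -tnth_nth dT (negbTE ji) [_ *: _]mulr0.
Qed.

Lemma dual_bases_expand X : X = \sum_i tnth Ts i X *: tnth T i.
Proof.
case: hT => bT _; rewrite {1}(coord_basis bT (memvf X)).
by apply: eq_bigr => i _; rewrite dual_bases_coord -tnth_nth.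
Qed.

Lemma dual_bases_expand_dual (l : dualv g) : l = \sum_i l (tnth T i) *: tnth Ts i.
Proof.
apply/lfunP => X; rewrite {1}(dual_bases_expand X) linear_sum sum_lfunE.
by apply: eq_bigr => i _; rewrite linearZ/= scale_lfunE; exact: mulrC.
Qed.

(* Through the identification of the double with its dual, the R-matrix is the
   difference of the projections on the two summands. *)
Lemma RD_dform a : RD T Ts (dform_lin a) = (- a.1, a.2).
Proof.
have -> : RD T Ts (dform_lin a) = \sum_i (a.2 (tnth T i) *: iotas (tnth Ts i) -
    tnth Ts i a.1 *: Defs.iota (tnth T i)).
  rewrite sum_lfunE; apply: eq_bigr => i _.
  by rewrite add_lfunE opp_lfunE !tensE !dform_linE dform_iota dform_iotas.
rewrite sumrB.
have -> : \sum_i a.2 (tnth T i) *: iotas (tnth Ts i) = iotas a.2.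
  rewrite [in RHS](dual_bases_expand_dual a.2).
  elim/big_rec2: _ => [|i y1 y2 _ ->] //.
  by congr pair; rewrite /= scaler0 addr0.
have -> : \sum_i tnth Ts i a.1 *: Defs.iota (tnth T i) = Defs.iota a.1.
  rewrite [in RHS](dual_bases_expand a.1).
  elim/big_rec2: _ => [|i y1 y2 _ ->] //.
  by congr pair; rewrite /= scaler0 addr0.
by congr pair; rewrite /= ?sub0r ?subr0.
Qed.

End Tensors.

(** * The bracket identity in the double *)

Section BracketForm.
Context {R : realType} {g : vectType R} {G Gs DG : lieGroup R}.
Variables (Lg : lieAlgebra G g) (Ls : lieAlgebra Gs (dualv g)).
Variable LD : lieAlgebra DG (drinfeld g).
Hypothesis hLD : is_double_bracket (lbr Lg) (lbr Ls) (lbr LD).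
Variable iS : Gs -> DG.
Hypothesis hiS : lifts Ls LD (@iotas R g) iS.
Hypothesis cGs : connected [set: Gs].
Variables (n : nat) (T : n.-tuple g) (Ts : n.-tuple (dualv g)).
Hypothesis hT : dual_bases T Ts.
Context {M : poissonManifold R} (Gam : M -> Gs).
Hypothesis sG : smooth_map (atlas M) (atlas Gs) Gam.
Local Notation pb := (@pbr R M).
Local Notation A u := (AdV LD iS (Gam u)).
Local Notation p u := (coadj LD iS (Gam u)).

Let sS : smooth_map (atlas Gs) (atlas DG) iS. Proof. by case: hiS => -[]. Qed.

Definition form_rhs (N : 'I_n -> 'I_n -> R) (u : M) : tensor (drinfeld g) (drinfeld g) :=
  - (2^-1 *: (RD T Ts - tens_map (Ad LD (iS (Gam u))) (RD T Ts)))
  + \sum_(a < n) \sum_(b < n)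
      N a b *: tens (iotas (tnth Ts a)) (iotas (tnth Ts b)).

Lemma form_rhs_pair N u a b : tens_pair (dform_lin a) (dform_lin b) (form_rhs N u) =
  rbeta LD iS (Gam u) a.1 b.1 +
  \sum_i \sum_j N i j * (tnth Ts i a.1 * tnth Ts j b.1).
Proof.
rewrite /tens_pair /form_rhs add_lfunE linearD/=; congr (_ + _); last first.
  rewrite sum_lfunE linear_sum; apply: eq_bigr => i _.
  rewrite sum_lfunE linear_sum; apply: eq_bigr => j _.
  rewrite scale_lfunE tensE !linearZ/= !dform_linE !dform_iotas.
  by rewrite /GRing.scale/=.
rewrite opp_lfunE scale_lfunE add_lfunE opp_lfunE tens_mapE RD_dform//.
(* Under the invariant form, precomposition with [Ad_y] corresponds to [Ad_{y^-1}] acting on [a]. *)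
have -> : (dform_lin a \o Ad LD (iS (Gam u)))%VF = dform_lin (A u a).
  apply/lfunP => z; rewrite comp_lfunE !dform_linE.
  by rewrite -(dform_AdV hLD hiS cGs (Gam u) a) /AdV AdK.
rewrite RD_dform// linearN linearZ linearB/= !dform_linE.
rewrite -[X in _ - X](dform_AdV hLD hiS cGs (Gam u)) {2}/AdV AdK.
(* Two instances of invariance: [orth] serves to eliminate [(A u b).2], and [mix] replaces the
   pairing of [Ad Ls (ginv (Gam u)) a.2] with [p u b.1] by [a.2 b.1]. *)
have orth := dform_AdV hLD hiS cGs (Gam u) a b.
have mix := dform_AdV hLD hiS cGs (Gam u) (Defs.iota b.1) (iotas a.2).
move: orth mix; rewrite (AdV_iotas hiS) !dform_iotas /=.
rewrite /rbeta -/(p u b.1).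
have E2 : (A u a).2 = cocyc LD iS (Gam u) a.1 + Ad Ls (ginv (Gam u)) a.2.
  by rewrite [in LHS](drinfeldE a) AdV_add/= (AdV_iotas hiS).
have E1 := AdV_fst hiS (Gam u) b.
rewrite /dform/= E2 E1 !lfunE/= !linearN/=.
rewrite -/(p u b.1) /GRing.scale/= => orth mix.
rewrite mix in orth *.
have -> : (A u b).2 (A u a).1 = b.2 a.1 + a.2 b.1 -
   (cocyc LD iS (Gam u) a.1 (p u b.1) + a.2 b.1) by rewrite -orth addrK.
by field.
Qed.

(** Right translation by [y^-1] makes the left-trivialised differential at [Gam u] the covector
    [de LD h] precomposed with [Ad_y] on the image of [iotas]; through the form this is the vector
    [p u a.1]. *)
Lemma form_lhs_pair h k u a b : smooth h -> smooth k ->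
  de LD h = dform_lin a -> de LD k = dform_lin b ->
  pb (fun m' => h (gmul (iS (Gam m')) (ginv (iS (Gam u)))))
     (fun m' => k (gmul (iS (Gam m')) (ginv (iS (Gam u))))) u =
  bivec Ls Gam (p u a.1) u (p u b.1).
Proof.
move=> sh sk ha kb.
have sr (f : DG -> R) : smooth f ->
    smooth (fun z => f (gmul (iS z) (ginv (iS (Gam u))))).
  move=> sf; apply: (smooth_comp _ sf).
  by apply: (smooth_gmul (atlasP Gs)) => //; exact: smooth_map_cst.
have gr f c : smooth f -> de LD f = dform_lin c ->
    grad Ls (fun z => f (gmul (iS z) (ginv (iS (Gam u))))) (Gam u) = p u c.1.
  move=> sf fc; apply: dualv_eq => l; rewrite gradE; last exact: sr.
  transitivity (ltan Ls l (fun x =>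
      f (gmul (gmul (iS (Gam u)) (iS x)) (ginv (iS (Gam u)))))).
    by congr (ltan _ _ _); apply/funext => x; rewrite (iSM hiS).
  rewrite (lift_ltan hiS l (smooth_conj (iS (Gam u)) sf)).
  rewrite -(AdP LD _ _ sf) -deE// fc dform_linE.
  rewrite -(dform_AdV hLD hiS cGs (Gam u)) {2}/AdV AdK dform_iotas.
  by rewrite (AdV_fst hiS).
have := pbr_grad Ls sG u (sr _ sh) (sr _ sk).
by rewrite !(gr _ _ _ ha) // !(gr _ _ _ kb).
Qed.

Definition is_right_triv u (t : tensor (drinfeld g) (drinfeld g)) :=
  forall h k, smooth h -> smooth k -> tens_pair (de LD h) (de LD k) t =
    pb (fun m' => h (gmul (iS (Gam m')) (ginv (iS (Gam u)))))
       (fun m' => k (gmul (iS (Gam m')) (ginv (iS (Gam u))))) u.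

Lemma is_right_triv_pair u t : is_right_triv u t <->
  forall a b, tens_pair (dform_lin a) (dform_lin b) t = bivec Ls Gam (p u a.1) u (p u b.1).
Proof.
split=> [H a b|H h k sh sk].
  have [h sh hE] := de_surj LD (dform_lin a); have [k sk kE] := de_surj LD (dform_lin b).
  by rewrite -hE -kE H// (form_lhs_pair _ sh sk hE kE).
have [a ha] := dform_lin_surj (de LD h); have [b kb] := dform_lin_surj (de LD k).
by rewrite (form_lhs_pair _ sh sk ha kb) -H ha kb.
Qed.

(** Differentials exhaust the dual, so the pairings determine the tensor and [xget] can only return
    [t]. *)
Lemma right_triv_unique u t : is_right_triv u t ->
  right_triv_bracket LD (iS \o Gam) u = t.
Proof.
move=> Ht; rewrite /right_triv_bracket.
case: xgetP => [t' _ Ht'|nt]; last by have := nt t Ht.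
apply/lfunP => q; apply: (dual_eq LD) => phi.
have [h sh <-] := de_surj LD q; have [k sk <-] := de_surj LD phi.
have := Ht h k sh sk; rewrite /tens_pair => ->.
exact: Ht'.
Qed.

Definition central_coef i j u := central_term Ls LD iS Gam (tnth T i) (tnth T j) u.

Lemma central_term_expand e e' u : central_term Ls LD iS Gam e e' u =
  \sum_i \sum_j central_coef i j u * (tnth Ts i e * tnth Ts j e').
Proof.
have lin1 a e1 e2 e3 := central_term_linear Ls LD iS sG a e1 e2 e3 u.
have lin2 a e1 e2 e3 : central_term Ls LD iS Gam e3 (a *: e1 + e2) u =
    a * central_term Ls LD iS Gam e3 e1 u + central_term Ls LD iS Gam e3 e2 u.
  rewrite (central_termC hLD hiS cGs sG) lin1 !(central_termC hLD hiS cGs sG e3); ring.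
have sum1 (c : 'I_n -> R) (v : 'I_n -> g) e3 : central_term Ls LD iS Gam (\sum_i c i *: v i) e3 u =
    \sum_i c i * central_term Ls LD iS Gam (v i) e3 u.
  elim/big_rec2: _ => [|i y1 y2 _ <-]; last exact: lin1.
  have := lin1 (-1) 0 0 e3; rewrite scaler0 addr0 => ->; ring.
have sum2 (c : 'I_n -> R) (v : 'I_n -> g) e3 : central_term Ls LD iS Gam e3 (\sum_i c i *: v i) u =
    \sum_i c i * central_term Ls LD iS Gam e3 (v i) u.
  elim/big_rec2: _ => [|i y1 y2 _ <-]; last exact: lin2.
  have := lin2 (-1) 0 0 e3; rewrite scaler0 addr0 => ->; ring.
rewrite {1}(dual_bases_expand hT e) sum1; apply: eq_bigr => i _.
rewrite {1}(dual_bases_expand hT e') sum2 mulr_sumr; apply: eq_bigr => j _.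
rewrite /central_coef; ring.
Qed.

Lemma right_trivE u : right_triv_bracket LD (iS \o Gam) u =
  form_rhs (fun i j => central_coef i j u) u.
Proof.
apply: right_triv_unique; apply/is_right_triv_pair => a b.
by rewrite form_rhs_pair -central_term_expand /central_term addrC subrK.
Qed.

Lemma sum_delta2 (N : 'I_n -> 'I_n -> R) i j :
  \sum_a \sum_b N a b * ((i == a)%:R * (j == b)%:R) = N i j.
Proof.
transitivity (\sum_a (i == a)%:R * N a j).
  apply: eq_bigr => a _; rewrite (bigD1 j)//= eqxx mulr1 mulrC big1 ?addr0//.
  by move=> b; rewrite eq_sym => /negbTE ->; rewrite !mulr0.
rewrite (bigD1 i)//= eqxx mul1r big1 ?addr0//.
by move=> a; rewrite eq_sym => /negbTE ->; rewrite mul0r.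
Qed.

(** Identifies the [N] given in the converse with [central_coef], whose bracket with functions is
    known. *)
Lemma form_rhs_inj N N' u : form_rhs N u = form_rhs N' u -> forall i j, N i j = N' i j.
Proof.
move=> E i j.
have dT : forall a b, tnth Ts b (tnth T a) = (a == b)%:R by case: hT.
have ev N1 : tens_pair (dform_lin (Defs.iota (tnth T i))) (dform_lin (Defs.iota (tnth T j)))
    (form_rhs N1 u) = rbeta LD iS (Gam u) (tnth T i) (tnth T j) + N1 i j.
  rewrite form_rhs_pair; congr (_ + _).
  rewrite -[RHS](sum_delta2 N1 i j); apply: eq_bigr => a _; apply: eq_bigr => b _.
  by rewrite -!dT.
by have := ev N; rewrite E ev => /addrI.
Qed.

Lemma action_double_form : is_lie_algebra_action (lbr Lg) (delta Ls Gam) ->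
  has_double_bracket_form LD T Ts (iS \o Gam).
Proof.
move=> hact; exists central_coef; split.
- by move=> a b; exact: smooth_central_term.
- by move=> a b m; exact: (central_termC hLD hiS cGs sG).
- by move=> a b f sf m; rewrite (pbr_central_term hLD hiS sG)// hact// subrr.
- by move=> m; rewrite right_trivE.
Qed.

Lemma double_form_action : has_double_bracket_form LD T Ts (iS \o Gam) ->
  is_lie_algebra_action (lbr Lg) (delta Ls Gam).
Proof.
move=> [N [_ _ cN EN]] e e' f sf m.
have NE i j : N i j = central_coef i j.
  apply/funext => u; apply: (@form_rhs_inj (fun i j => N i j u) (fun i j => central_coef i j u) u).
  by rewrite -right_trivE EN.
have cNN X Y : pb (central_term Ls LD iS Gam X Y) f m = 0.
  have tf := pbr_tangent m sf.
  have -> : central_term Ls LD iS Gam X Y = (fun u => \sum_i \sum_j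
      (tnth Ts i X * tnth Ts j Y) * central_coef i j u).
    apply/funext => u; rewrite central_term_expand; apply: eq_bigr => i _.
    by apply: eq_bigr => j _; rewrite mulrC.
  have sN i j : smooth (central_coef i j) by exact: smooth_central_term.
  rewrite (tangent_sum tf) => [|i _]; last first.
    by apply: smooth_sum => j _; exact: smoothZ.
  rewrite big1// => i _; rewrite (tangent_sum tf) => [|j _]; last exact: smoothZ.
  by rewrite big1// => j _; rewrite (tangentZ tf)// -NE cN// mulr0.
(* Centrality is applied, at the fixed point [m], to the preimages of [e] and [e'] under [p m]. *)
have := cNN (Ad LD (iS (Gam m)) (Defs.iota e)).1 (Ad LD (iS (Gam m)) (Defs.iota e')).1.
rewrite (pbr_central_term hLD hiS sG)// !(coadj_surj hiS) => /eqP.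
by rewrite subr_eq0 => /eqP.
Qed.

End BracketForm.

(** * Moment maps of Poisson-Lie actions *)

Section MomentMaps.
Context {R : realType} (G : poissonLieGroup R) (M : poissonManifold R).
Context {g : vectType R} {Gs : lieGroup R}.
Variables (Lg : lieAlgebra G g) (Ls : lieAlgebra Gs (dualv g)).
Variables (Gam : M -> Gs) (act : G -> M -> M).
Hypothesis sG : smooth_map (atlas M) (atlas Gs) Gam.

(** Along the orbit of [m], an iterated [delta] is an iterated derivative of [phi] on [G]. For a
    right action this is the expression in [lbrE]. For a left action the factors are reversed;
    exchanging the two derivations gives the opposite commutator, which agrees with the sign in the
    normalisation of the infinitesimal action. *)
Lemma moment_map_action : is_moment_map Lg Ls act Gam ->
  is_lie_algebra_action (lbr Lg) (delta Ls Gam).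
Proof.
move=> [[sact _] hact] e e' f sf m.
have sd e1 := delta_smooth Ls sG e1 sf.
have sorb (f1 : M -> R) : smooth f1 -> smooth (fun x : G => f1 (act x m)).
  move=> sf1.
  have s2 : smooth2 (fun z : G * M => f1 (act z.1 z.2)).
    exact: (smooth_fun_comp (prodP G M) (atlasP M) sact sf1).
  exact: smooth2r m s2.
pose phi x := f (act x m).
have sphi : smooth phi by exact: sorb.
case: hact => -[[_ am] Hd].
- have E e1 e2 : delta Ls Gam e1 (delta Ls Gam e2 f) m =
      ltan Lg e1 (fun x => ltan Lg e2 (fun y => phi (gmul y x))).
    rewrite -Hd//.
    have -> : (fun x => delta Ls Gam e2 f (act x m)) =
        (fun x => - ltan Lg e2 (fun y => phi (gmul y x))).
      apply/funext => x; rewrite -Hd//; congr (- ltan _ _ _).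
      by apply/funext => y; rewrite /phi am.
    rewrite (tangentN (ltan_tangent Lg e1)) ?opprK//.
    exact: (tangent_smooth (ltan_tangent Lg e2) (smooth2_swap (smooth2_mul sphi))).
  have sw e1 e2 : ltan Lg e1 (fun x => ltan Lg e2 (fun y => phi (gmul y x))) =
      ltan Lg e2 (fun y => ltan Lg e1 (fun x => phi (gmul y x))).
    exact: (tangent_swap (ltan_tangent Lg e1) (ltan_tangent Lg e2)
      (smooth2_swap (smooth2_mul sphi))).
  by rewrite !E (sw e e') (sw e' e) -Hd// lbrE// opprB.
- have E e1 e2 : delta Ls Gam e1 (delta Ls Gam e2 f) m =
      ltan Lg e1 (fun x => ltan Lg e2 (fun y => phi (gmul x y))).
    rewrite -Hd//; congr (ltan _ _ _); apply/funext => x.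
    rewrite -Hd//; congr (ltan _ _ _).
    by apply/funext => y; rewrite /phi am.
  by rewrite !E -Hd// lbrE.
Qed.

End MomentMaps.

Theorem mainTheorem6 (R : realType)
  (G : poissonLieGroup R) (Gs DG : lieGroup R) (M : poissonManifold R)
  (g : vectType R)
  (Lg : lieAlgebra G g)
  (Ls : lieAlgebra Gs (dualv g))
  (LD : lieAlgebra DG (drinfeld g))
  (hLs : forall f h : G -> R, smooth f -> smooth h ->
    lbr Ls (de Lg f) (de Lg h) = de Lg (plbr f h))
  (hGs_conn : connected [set: Gs])
  (hGs_sc : @simply_connected R Gs)
  (hLD : is_double_bracket (lbr Lg) (lbr Ls) (lbr LD))
  (iS : Gs -> DG) (hiS : lifts Ls LD (@iotas R g) iS)
  (n : nat) (T : n.-tuple g) (Ts : n.-tuple (dualv g)) (hT : dual_bases T Ts)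
  (Gam : M -> Gs) (hGam : smooth_map (atlas M) (atlas Gs) Gam) :
  [/\ (forall act : G -> M -> M, is_moment_map Lg Ls act Gam ->
         is_lie_algebra_action (lbr Lg) (delta Ls Gam)),
      (is_lie_algebra_action (lbr Lg) (delta Ls Gam) ->
         has_double_bracket_form LD T Ts (iS \o Gam)) &
      (has_double_bracket_form LD T Ts (iS \o Gam) ->
         is_lie_algebra_action (lbr Lg) (delta Ls Gam))].
Proof.
split.
- by move=> act; exact: moment_map_action.
- exact: (action_double_form hLD hiS hGs_conn hT hGam).
- exact: (double_form_action hLD hiS hGs_conn hT hGam).
Qed.
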